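(* Let $n\ge 1$, let $\Gamma$ be a group of type $F_n$, let $Y$ be a simplicial complex which is a $K(\Gamma,1)$ and has finite $n$-skeleton, and let $X$ be the $n$-skeleton of the universal cover of $Y$, with its $\Gamma$-action by deck transformations. Let $\{\Lambda_i\}_i$ be a family of finite index subgroups of $\Gamma$. If $\Gamma$ is strongly $n$-Kazhdan, then $\{\Lambda_i\backslash X\}_i$ is a family of bounded degree spectral expanders, that is: (a) the finite simplicial complexes $\Lambda_i\backslash X$ have uniformly bounded degree (there is a constant $D$ such that for every $i$ each vertex of $\Lambda_i\backslash X$ is contained in at most $D$ simplices); (b) there is $\epsilon>0$ such that for every $i$ and every $0\le l\le n-1$ the spectral gap of the upper Laplacian $\Delta_l^+$ on $C^l(\Lambda_i\backslash X,\mathbb{C})$ is at least $\epsilon$; and (c) if $[\Gamma:\Lambda_i]\to\infty$, then the number of vertices of $\Lambda_i\backslash X$ tends to infinity.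
   Context: A group $\Gamma$ is of type $F_n$ if there is a $K(\Gamma,1)$ CW complex with finite $n$-skeleton. A group $\Gamma$ is strongly $n$-Kazhdan if $H^j(\Gamma,\pi)=0$ for all $1\le j\le n$ and every unitary representation $\pi$ of $\Gamma$ on a Hilbert space (ordinary group cohomology with coefficients in the $\Gamma$-module $V_\pi$). For a finite simplicial complex $Z$ with set $Z^l$ of $l$-simplices (with chosen orientations), $C^l(Z,\mathbb{C})=\mathrm{Hom}_{\mathbb{C}}(\mathbb{C}[Z^l],\mathbb{C})$ is the space of simplicial $l$-cochains with the inner product making the basis dual to $Z^l$ orthonormal, and $d_l:C^l(Z,\mathbb{C})\to C^{l+1}(Z,\mathbb{C})$ is the simplicial coboundary map. The upper Laplacian is $\Delta_l^+=d_l^*d_l$ on $C^l(Z,\mathbb{C})$. Its spectral gap is the minimum eigenvalue of the restriction of $\Delta_l^+$ to the orthogonal complement of $d_{l-1}C^{l-1}(Z,\mathbb{C})$ ($+\infty$ if this complement is zero); for $l=0$ the augmented complex is used, i.e. $d_{-1}C^{-1}(Z,\mathbb{C})$ is the space of constant functions on vertices. *)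

(* Defs.v *)
From HB Require Import structures.
From mathcomp Require Import all_boot all_order all_algebra finmap complex.
From mathcomp Require Import all_classical all_reals all_analysis.

Set Implicit Arguments.
Unset Strict Implicit.
Unset Printing Implicit Defensive.

Import Order.TTheory GRing.Theory Num.Theory.
Import numFieldNormedType.Exports.

Local Open Scope classical_set_scope.
Local Open Scope ring_scope.

(* Homotopy theory of topological spaces; a path in T is a function R -> T    *)
(* whose restriction to [0, 1] is continuous.                                 *)
Section Homotopy.
Variables (R : realType) (T : topologicalType).

Definition is_path (x y : T) (c : R -> T) : Prop :=
  [/\ {within `[0, 1], continuous c}, c 0 = x & c 1 = y].

Definition path_connected_space : Prop :=
  (exists x : T, True) /\ forall x y : T, exists c : R -> T, is_path x y c.

Definition path_homotopic (c d : R -> T) : Prop :=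
  exists H : R * R -> T,
    [/\ {within `[0, 1] `*` `[0, 1], continuous H},
        forall s, s \in `[0, 1] -> H (s, 0) = c s /\ H (s, 1) = d s
      & forall t, t \in `[0, 1] -> H (0, t) = c 0 /\ H (1, t) = c 1].

Definition path_concat (c d : R -> T) : R -> T :=
  fun s => if s <= 2^-1 then c (2 * s) else d (2 * s - 1).

Definition simply_connected_space : Prop :=
  path_connected_space /\
  forall (x : T) (c : R -> T), is_path x x c -> path_homotopic c (cst x).

Definition contractible_space : Prop :=
  exists (x0 : T) (H : T * R -> T),
    {within [set: T] `*` `[0, 1], continuous H} /\
    forall x, H (x, 0) = x /\ H (x, 1) = x0.

(* [f] is defined on loops and induces an isomorphism from the quotient group *)
(* pi_1(T, x) onto G.                                                         *)
Definition pi1_isomorphism (x : T) (G : groupType) (f : (R -> T) -> G) : Prop :=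
  [/\ forall c d, is_path x x c -> is_path x x d ->
        (f c = f d <-> path_homotopic c d),
      forall g, exists2 c, is_path x x c & f c = g
    & forall c d, is_path x x c -> is_path x x d ->
        f (path_concat c d) = (f c * f d)%g].

End Homotopy.

Section Coverings.
Variables (E B : topologicalType) (p : E -> B).

Definition homeo_between (S : set E) (U : set B) : Prop :=
  exists s : B -> E,
    [/\ {within U, continuous s},
        forall b, U b -> S (s b) /\ p (s b) = b
      & forall e, S e -> U (p e) /\ s (p e) = e].

Definition covering_map : Prop :=
  continuous p /\
  forall b, exists (U : set B) (sheets : set (set E)),
    [/\ open U /\ U b,
        forall S, sheets S -> open S /\ homeo_between S U,
        forall S S', sheets S -> sheets S' -> S `&` S' !=set0 -> S = S'
      & p @^-1` U = \bigcup_(S in sheets) S].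

Definition universal_covering (R : realType) : Prop :=
  covering_map /\ simply_connected_space R E.

Definition deck_transformation (h : E -> E) : Prop :=
  [/\ continuous h,
      exists h' : E -> E, [/\ continuous h', cancel h h' & cancel h' h]
    & p \o h = p].

End Coverings.

(* Connected, with fundamental group G and contractible universal cover. The  *)
(* universal cover being unique up to homeomorphism over T, its               *)
(* contractibility is stated for every model.                                 *)
Definition eilenberg_maclane1 (R : realType) (G : groupType)
    (T : topologicalType) : Prop :=
  [/\ path_connected_space R T,
      exists (x : T) (f : (R -> T) -> G), pi1_isomorphism x f,
      exists (E : topologicalType) (p : E -> T), universal_covering p R
    & forall (E : topologicalType) (p : E -> T),
        universal_covering p R -> contractible_space R E].

Section CWComplexes.
Variable R : realType.

Definition disc (k : nat) : set 'rV[R]_k :=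
  [set x | \sum_(i < k) x ord0 i ^+ 2 <= 1].
Definition open_disc (k : nat) : set 'rV[R]_k :=
  [set x | \sum_(i < k) x ord0 i ^+ 2 < 1].
Arguments disc : clear implicits.
Arguments open_disc : clear implicits.

(* [chi j] is the characteristic map of the j-th cell, of dimension [dim j].  *)
(* It automatically restricts to a homeomorphism from the open disc to the    *)
(* open cell, because the disc is compact and T is Hausdorff.                 *)
Definition cw_structure (T : topologicalType) (J : Type) (dim : J -> nat)
    (chi : forall j, 'rV[R]_(dim j) -> T) : Prop :=
  let cell j := chi j @` open_disc (dim j) in
  [/\ hausdorff_space T,
      forall j, {within disc (dim j), continuous (chi j)} /\
                {in open_disc (dim j) &, injective (chi j)},
      (forall i j, cell i `&` cell j !=set0 -> i = j) /\
      \bigcup_j cell j = [set: T],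
      forall j, exists2 B : set J, finite_set B &
        (forall i, B i -> (dim i < dim j)%N) /\
        chi j @` (disc (dim j) `\` open_disc (dim j)) `<=` \bigcup_(i in B) cell i
    & forall A : set T,
        closed A <-> forall j, closed (disc (dim j) `&` chi j @^-1` A)].

Definition type_F (n : nat) (G : groupType) : Prop :=
  exists (T : topologicalType) (J : Type) (dim : J -> nat)
         (chi : forall j, 'rV[R]_(dim j) -> T),
    [/\ cw_structure chi, finite_set [set j | (dim j <= n)%N]
      & eilenberg_maclane1 R G T].

End CWComplexes.

(* An abstract simplicial complex; its vertices are the v with [fset v] a     *)
(* face, which need not be all the elements of V.                             *)
Record scomplex (V : choiceType) := SComplex {
  faces :> {fset V} -> Prop;
  face_neq0 : forall s, faces s -> s != fset0;
  face_sub : forall s t, faces s -> (t `<=` s)%fset -> t != fset0 -> faces t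
}.

Record smap (V W : choiceType) (K : scomplex V) (L : scomplex W) := SMap {
  smap_fun :> V -> W;
  smapP : forall s, K s -> L [fset smap_fun v | v in s]%fset
}.

Section Skeleton.
Variables (V : choiceType) (K : scomplex V) (n : nat).

Definition skel_faces : set {fset V} := [set s | K s /\ (#|` s| <= n.+1)%N].

Fact skel_neq0 s : skel_faces s -> s != fset0.
Proof. by case=> + _; exact: face_neq0. Qed.

Fact skel_sub s t :
  skel_faces s -> (t `<=` s)%fset -> t != fset0 -> skel_faces t.
Proof.
move=> [Ks sn] ts t0; split; first exact: face_sub ts t0.
exact: leq_trans (fsubset_leq_card ts) sn.
Qed.

Definition skeleton : scomplex V := SComplex skel_neq0 skel_sub.

End Skeleton.

Section Realization.
Variables (R : realType) (V : choiceType) (K : scomplex V).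

Record realization := RPoint {
  bary :> V -> R;
  baryP : exists2 s, K s &
    [/\ forall v, 0 <= bary v, forall v, v \notin s -> bary v = 0
      & \sum_(v <- s) bary v = 1]
}.

HB.instance Definition _ := gen_eqMixin realization.
HB.instance Definition _ := gen_choiceMixin realization.

Definition carried (x : realization) (s : {fset V}) : Prop :=
  forall v, v \notin s -> x v = 0.

(* The weak topology: U is open iff its trace on every closed simplex is open *)
(* for the Euclidean topology of that simplex.                                *)
Definition weak_open : set_system realization := [set U |
  forall s, K s -> forall x, U x -> carried x s ->
    exists2 e : R, 0 < e & forall y, carried y s ->
      (forall v, v \in s -> `|x v - y v| < e) -> U y].

Fact weak_openT : weak_open setT.
Proof. by move=> s _ x _ _; exists 1. Qed.

Fact weak_openI : setI_closed weak_open.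
Proof.
move=> A B oA oB s Ks x [Ax Bx] xs.
have [e e0 eA] := oA s Ks x Ax xs; have [d d0 dB] := oB s Ks x Bx xs.
exists (Num.min e d); first by rewrite lt_min e0.
move=> y ys xy; split.
  by apply: eA => // v /xy; rewrite lt_min => /andP[].
by apply: dB => // v /xy; rewrite lt_min => /andP[].
Qed.

Fact weak_open_bigU (I : Type) (f : I -> set realization) :
  (forall i, weak_open (f i)) -> weak_open (\bigcup_i f i).
Proof.
move=> of_ s Ks x [i _ fx] xs; have [e e0 ef] := of_ i s Ks x fx xs.
by exists e => // y ys xy; exists i => //; exact: ef.
Qed.

HB.instance Definition _ := isOpenTopological.Build realization
  weak_openT weak_openI weak_open_bigU.

End Realization.

Section RealizationMap.
Variables (R : realType) (V W : choiceType).
Variables (K : scomplex V) (L : scomplex W) (f : smap K L).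

Definition push (x : V -> R) (w : W) : R := \sum_(v \in f @^-1` [set w]) x v.

Fact pushE (s : {fset V}) (x : V -> R) (w : W) :
  (forall v, v \notin s -> x v = 0) -> push x w = \sum_(v <- s | f v == w) x v.
Proof.
move=> xs; rewrite /push [RHS]bigfs ?fset_uniq//; last by move=> v _ /xs.
suff -> : [set` (fun v => f v == w)] = f @^-1` [set w] by [].
by apply/seteqP; split=> v /= /eqP.
Qed.

Fact push_subproof (x : realization R K) : exists2 t, L t &
  [/\ forall w, 0 <= push x w, forall w, w \notin t -> push x w = 0
    & \sum_(w <- t) push x w = 1].
Proof.
have [s Ks [x0 xs x1]] := baryP x.
exists [fset f v | v in s]%fset; first exact: smapP.
have pE w := pushE w xs.
split=> [w|w ws|]; first by rewrite pE sumr_ge0.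
  rewrite pE big_seq_cond big1// => v /andP[vs /eqP fv].
  by move: ws; rewrite -fv in_imfset.
under eq_bigr do rewrite pE big_mkcond.
rewrite exchange_big -x1 big_seq [RHS]big_seq; apply: eq_bigr => v vs.
rewrite (bigD1_seq (f v)) ?fset_uniq ?in_imfset//= eqxx.
by rewrite big1 ?addr0// => w; rewrite eq_sym => /negbTE ->.
Qed.

Definition realization_map (x : realization R K) : realization R L :=
  RPoint (push_subproof x).

End RealizationMap.

Arguments realization_map R {V W K L} f x.

(* [act] identifies G with the group of deck transformations of |E| -> |B|.   *)
Definition deck_action (R : realType) (G : groupType) (V W : choiceType)
    (E : scomplex W) (B : scomplex V) (p : smap E B) (act : G -> smap E E) :=
  let rho g := realization_map R (act g) in
  let deck := deck_transformation (realization_map R p) in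
  [/\ forall g, deck (rho g),
      forall g h, rho (g * h)%g = rho g \o rho h,
      injective rho
    & forall h, deck h -> exists g, h = rho g].

Definition is_subgroup (G : groupType) (L : set G) : Prop :=
  group_closed [in L].

Definition left_cosets (G : groupType) (L : set G) : set (set G) :=
  range (fun g => [set (g * h)%g | h in L]).

Definition subgroup_index (G : groupType) (L : set G) : nat :=
  #|` fset_set (left_cosets L)|.

(* L \ K has the L-orbits of vertices as vertices and the images of the faces *)
(* of K as faces. When K is (a skeleton of) a covering complex and L acts by  *)
(* deck transformations, a face of K is determined up to L by the orbits of   *)
(* its vertices, so that this is the topological quotient.                    *)
Section Quotient.
Variables (G : groupType) (W : choiceType) (act : G -> W -> W).
Variables (L : set G) (K : scomplex W).

Definition vorbit (w : W) : set W := [set act g w | g in L].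

Definition quot_faces : set {fset set W} :=
  [set [fset vorbit w | w in s]%fset | s in faces K].

Fact quot_neq0 s : quot_faces s -> s != fset0.
Proof.
move=> [t Kt <-]; have /fset0Pn[w wt] := face_neq0 Kt.
by apply/fset0Pn; exists (vorbit w); rewrite in_imfset.
Qed.

Fact quot_sub s t :
  quot_faces s -> (t `<=` s)%fset -> t != fset0 -> quot_faces t.
Proof.
move=> [u Ku <-] tu t0.
have tE : [fset vorbit w | w in [fset w in u | vorbit w \in t]]%fset = t.
  apply/fsetP => a; apply/imfsetP/idP => [[w /=]|at_].
    by rewrite !inE => /andP[_ wt] ->.
  have /imfsetP[w /= wu aE] := fsubsetP tu _ at_.
  by exists w => //; rewrite !inE wu -aE.
exists [fset w in u | vorbit w \in t]%fset; last exact: tE.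
apply: (face_sub Ku).
  by apply/fsubsetP => w; rewrite !inE => /andP[].
by apply: contra_neq t0 => e; rewrite -tE e imfset0.
Qed.

Definition quotient_complex : scomplex (set W) := SComplex quot_neq0 quot_sub.

End Quotient.

Arguments quotient_complex {G W} act L K.

(* The orientation of a face is the class, modulo even permutations, of a     *)
(* chosen ordering of its vertices.                                           *)
Record orientation (V : choiceType) (Z : scomplex V) := Orientation {
  ordering :> {fset V} -> seq V;
  orderingP : forall s : {fset V}, Z s -> perm_eq (ordering s) s
}.

Definition inversions (V : choiceType) (s t : seq V) : nat :=
  \sum_(a <- s) \sum_(b <- s)
    ((index a s < index b s) && (index b t < index a t))%N.

Section Cochains.
Variables (R : realType) (V : choiceType) (Z : scomplex V) (o : orientation Z).
Local Notation C := R[i].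

(* The set of l-simplices, for a finite complex Z.                            *)
Definition simplices (l : nat) : {fset {fset V}} :=
  fset_set [set s | Z s /\ #|` s| = l.+1].

Definition cochain (l : nat) := {ffun simplices l -> C}.

Definition inner (l : nat) (f g : cochain l) : C := \sum_s f s * (g s)^*.

(* The coefficient of s in the boundary of t.                                 *)
Definition incidence (t s : {fset V}) : C :=
  \sum_(v <- o t | s == (t `\ v)%fset)
    (-1) ^+ (index v (o t) + inversions (rem v (o t)) (o s)).

Definition coboundary (l : nat) (f : cochain l) : cochain l.+1 :=
  [ffun t => \sum_s incidence (val t) (val s) * f s].

Definition coboundary_adj (l : nat) (g : cochain l.+1) : cochain l :=
  [ffun s => \sum_t (incidence (val t) (val s))^* * g t].

Fact coboundary_adjP (l : nat) (f : cochain l) (g : cochain l.+1) :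
  inner (coboundary f) g = inner f (coboundary_adj g).
Proof.
rewrite /inner; under eq_bigr do rewrite ffunE mulr_suml.
rewrite exchange_big /=; apply: eq_bigr => s _.
rewrite ffunE rmorph_sum mulr_sumr; apply: eq_bigr => t _.
by rewrite rmorphM /= conjCK mulrA [_ * f s]mulrC.
Qed.

Definition upper_laplacian (l : nat) (f : cochain l) : cochain l :=
  coboundary_adj (coboundary f).

Definition coboundaries (l : nat) : set (cochain l) :=
  match l return set (cochain l) with
  | 0 => [set f | exists c : C, f = [ffun=> c]]
  | l'.+1 => range (@coboundary l')
  end.

Definition coboundaries_perp (l : nat) : set (cochain l) :=
  [set f | forall g, coboundaries g -> inner f g = 0].

(* Being a self-adjoint operator, the restriction has only real eigenvalues.  *)
Definition spectral_gap (l : nat) : \bar R :=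
  ereal_inf [set a%:E | a in [set a : R | exists f : cochain l,
    [/\ f != 0, coboundaries_perp f & upper_laplacian f = (a%:C)%C *: f]]].

End Cochains.

Section GroupCohomology.
Variables (G : groupType) (K : nzRingType) (M : lmodType K) (pi : G -> M -> M).

(* Homogeneous cochains, i.e. cochains on the standard resolution of G.       *)
Definition group_cochain (j : nat) : set (('I_j.+1 -> G) -> M) :=
  [set f | forall g x, f (fun i => (g * x i)%g) = pi g (f x)].

Definition group_coboundary (j : nat) (f : ('I_j.+1 -> G) -> M) :
    ('I_j.+2 -> G) -> M :=
  fun x => \sum_(k < j.+2) (-1) ^+ k *: f (fun i => x (lift k i)).

(* H^(j.+1)(G, M) = 0 *)
Definition group_cohomologyS_eq0 (j : nat) : Prop :=
  forall f, group_cochain (j := j.+1) f -> group_coboundary f = (fun=> 0) ->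
    exists2 h, group_cochain (j := j) h & group_coboundary h = f.

End GroupCohomology.

Section Kazhdan.
Variables (R : realType) (G : groupType).

(* A Hilbert space is a complete normed space over R[i] whose norm comes from *)
(* an inner product.                                                          *)
Definition hilbert_dot (H : completeNormedModType R[i])
    (dot : {dot H for Num.conj}) : Prop :=
  forall x : H, `|x| ^+ 2 = dot x x.

Definition unitary_representation (H : completeNormedModType R[i])
    (dot : {dot H for Num.conj}) (pi : G -> H -> H) : Prop :=
  [/\ forall g, linear (pi g),
      pi 1%g = id,
      forall g h, pi (g * h)%g = pi g \o pi h
    & forall g x y, dot (pi g x) (pi g y) = dot x y].

Definition strongly_kazhdan (n : nat) : Prop :=
  forall (H : completeNormedModType R[i]) (dot : {dot H for Num.conj})
         (pi : G -> H -> H),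
    hilbert_dot dot -> unitary_representation dot pi ->
    forall j, (j < n)%N -> group_cohomologyS_eq0 pi j.

End Kazhdan.

(* Main.v *)
(* Since the universal cover is contractible, simplicial chains on tuples of
   vertices spanning a face of it are acyclic (barycentric subdivision, then a
   Lebesgue number argument along a contraction). Choosing contracting chains
   and running a zigzag turns an equivariant cocycle of the universal cover
   with values in a unitary representation into a group cocycle of the same
   degree, so the Kazhdan hypothesis makes equivariant cocycles of degree at
   most n equivariant coboundaries. The universal cover itself, rather than
   its n-skeleton, carries this argument; the skeleton matters only for the
   finiteness of the quotients.

   The uniform gap comes from applying this to a single representation: for
   subgroups Lam_k of the family, equivariant cochains with values in the
   Hilbert sum of the l2(G / Lam_k), realized inside l2(nat * set G), are the
   square summable sequences of cochains of the quotients Lam_k \ X. If there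
   were no gap in degree l, there would be unit cochains phi_k orthogonal to
   coboundaries with |d phi_k|^2 <= 2^-k. The sequence (d phi_k) is then a
   square summable cocycle, so d phi_k = d h_k with (h_k) square summable;
   h_k - phi_k is closed, hence a coboundary and orthogonal to phi_k, so that
   |h_k| >= 1 for all k, a contradiction. *)

(* Exactness alone gives no uniformity: for one quotient, vanishing cohomology solves d h = c
   without any control of |h|. In the Hilbert sum the control is part of the solution. An
   equivariant solution has finite norm at each tuple, and finitely many orbits of tuples of a given
   size account for the simplices of all quotients, so the |h_k|^2 are summable. This takes the
   place of the open mapping theorem. Cochains are functions of ordered tuples of vertices, with
   repetitions and the empty tuple allowed. Subdivision, prisms and the zigzag are then recursions
   on lists, and a tuple of size j + 1 has degree j. The orientations of the quotients, chosen
   independently, enter only through [alt] and [unalt]. The Kazhdan property speaks of tuples of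
   group elements. Freeness on vertices gives an equivariant map from vertices to [G], along which
   group cochains are pulled back. The other direction needs a contraction of the chain complex; it
   need not be equivariant, but its translates form an equivariant family. *)
Require Import Defs.
From HB Require Import structures.
From mathcomp Require Import all_boot all_order all_algebra finmap complex.
From mathcomp Require Import all_classical all_reals all_analysis.
From mathcomp Require Import ring lra.
Set Implicit Arguments.
Unset Strict Implicit.
Unset Printing Implicit Defensive.
Import Order.TTheory GRing.Theory Num.Theory.
Import numFieldNormedType.Exports.
Local Open Scope classical_set_scope.
Local Open Scope ring_scope.

(** * Ordered cochains and chains *)

(* The alternating sum of the faces of a tuple, by recursion on the tuple. The
   empty tuple is allowed, so that all complexes are augmented. *)
Fixpoint sdiff (A : Type) (M : zmodType) (f : seq A -> M) (s : seq A) : M :=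
  if s is x :: t then f t - sdiff (fun u => f (x :: u)) t else 0.

Fixpoint face_of (A : Type) (s t : seq A) {struct t} : Prop :=
  if t is x :: u then
    s = u \/ (if s is y :: v then y = x /\ face_of v u else False)
  else False.

Fixpoint allp (A : Type) (P : A -> Prop) (s : seq A) : Prop :=
  if s is x :: t then P x /\ allp P t else True.

Section Sdiff.
Variables (A : Type) (M : zmodType).
Implicit Types (f g : seq A -> M) (s t : seq A).

Lemma size_face s t : face_of s t -> (size s).+1 = size t.
Proof.
elim: t s => [|x t IH] s //= [->//|].
by case: s => [|y v] //= [_ /IH ->].
Qed.

Lemma face_of_sub (P : A -> Prop) s t : face_of s t -> allp P t -> allp P s.
Proof.
elim: t s => [|y t IH] s //= [->|]; first by case.
by case: s => // z s [-> st] [? ?]; split=> //; exact: IH st _.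
Qed.

Lemma eq_sdiff f g s : (forall t, face_of t s -> f t = g t) ->
  sdiff f s = sdiff g s.
Proof.
elim: s f g => [|x s IH] f g //= fg; congr (_ - _); first by apply: fg; left.
by apply: IH => t ts; apply: fg; right.
Qed.

Lemma sdiffD f g s : sdiff (fun t => f t + g t) s = sdiff f s + sdiff g s.
Proof. by elim: s f g => [|x s IH] f g /=; rewrite ?addr0// IH opprD addrACA. Qed.

Lemma sdiffN f s : sdiff (fun t => - f t) s = - sdiff f s.
Proof. by elim: s f => [|x s IH] f /=; rewrite ?oppr0// IH opprB addrC opprK. Qed.

Lemma sdiffB f g s : sdiff (fun t => f t - g t) s = sdiff f s - sdiff g s.
Proof. by rewrite sdiffD sdiffN. Qed.

Lemma sdiff0 s : sdiff (fun=> 0 : M) s = 0.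
Proof. by elim: s => //= x s ->; rewrite subr0. Qed.

(** The terms in which [x] is omitted, first or second, cancel; those that keep [x] are the
    induction hypothesis for [fun u => f (x :: u)]. *)
Lemma sdiff_sdiff f s : sdiff (sdiff f) s = 0.
Proof.
elim: s f => [|x s IH] f //=.
by rewrite sdiffB IH subr0 subrr.
Qed.

Lemma sdiff_raddf (N : zmodType) (h : M -> N) :
  {morph h : x y / x - y} -> forall f s, h (sdiff f s) = sdiff (h \o f) s.
Proof.
move=> hB f s; elim: s f => [|x s IH] f /=.
  by have := hB 0 0; rewrite !subrr.
by rewrite hB IH.
Qed.

Lemma sdiff_map (B : Type) (h : B -> A) f (s : seq B) :
  sdiff (fun t : seq B => f (map h t)) s = sdiff f (map h s).
Proof. by elim: s f => [|x s IH] f //=; rewrite (IH (fun u => f (h x :: u))). Qed.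

End Sdiff.

(* A chain is encoded by the functional that evaluates cochains on it. *)
Inductive is_chain (A : Type) (M : zmodType) (S : seq A -> Prop) :
    ((seq A -> M) -> M) -> Prop :=
| chain0 : is_chain S (fun=> 0)
| chain_tuple s : S s -> is_chain S (fun f => f s)
| chainB z1 z2 : is_chain S z1 -> is_chain S z2 ->
    is_chain S (fun f => z1 f - z2 f).

Section Chains.
Variables (A : Type) (M : zmodType).
Implicit Types (f g : seq A -> M) (z : (seq A -> M) -> M) (S T : seq A -> Prop).

Lemma chain_ext S z f g : is_chain S z -> (forall s, S s -> f s = g s) ->
  z f = z g.
Proof. by elim=> //= [s Ss ->//|z1 z2 _ IH1 _ IH2 fg]; rewrite IH1 ?IH2. Qed.

Lemma chain_D S z f g : is_chain S z -> z (fun s => f s + g s) = z f + z g.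
Proof.
elim=> //= [|z1 z2 _ -> _ ->]; first by rewrite addr0.
by rewrite opprD addrACA.
Qed.

Lemma chain_B S z f g : is_chain S z -> z (fun s => f s - g s) = z f - z g.
Proof.
elim=> //= [|z1 z2 _ -> _ ->]; first by rewrite subr0.
by rewrite !opprB addrACA [RHS]addrACA; congr (_ + _); rewrite addrC.
Qed.

Lemma chain_zero S z : is_chain S z -> z (fun=> 0) = 0.
Proof. by elim=> //= z1 z2 _ -> _ ->; rewrite subr0. Qed.

(** A chain is an integral combination of evaluations, so it commutes with additive maps. For [pi g]
    this makes the zigzag equivariant. *)
Lemma chain_raddf S z (h : M -> M) : {morph h : x y / x - y} ->
  is_chain S z -> forall f, z (h \o f) = h (z f).
Proof.
move=> hB; elim=> //= [f|z1 z2 _ IH1 _ IH2 f]; last by rewrite IH1 IH2 hB.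
by have := hB 0 0; rewrite !subrr.
Qed.

Lemma chainN S z : is_chain S z -> is_chain S (fun f => - z f).
Proof.
move=> cz; have -> : (fun f => - z f) = (fun f => 0 - z f).
  by apply/funext => f; rewrite sub0r.
exact: (@chainB A M S (fun=> 0) z (@chain0 A M S) cz).
Qed.

Lemma chainD S z1 z2 : is_chain S z1 -> is_chain S z2 ->
  is_chain S (fun f => z1 f + z2 f).
Proof.
move=> c1 c2; have -> : (fun f => z1 f + z2 f) = (fun f => z1 f - (- z2 f)).
  by apply/funext => f; rewrite opprK.
by apply: (@chainB _ _ _ z1 (fun f => - z2 f)) => //; exact: chainN.
Qed.

Lemma chain_sub S T z : (forall s, S s -> T s) -> is_chain S z -> is_chain T z.
Proof.
move=> ST; elim=> [|s /ST|z1 z2 _ c1 _ c2]; [exact: chain0|exact: chain_tuple|].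
exact: chainB.
Qed.

(** Substitution of chains for tuples: a linear operator on chains is encoded by its transpose [Phi]
    on cochains, and only its value on single tuples has to be inspected. *)
Lemma chain_bind (B : Type) (S : seq B -> Prop) T
    (Phi : (seq A -> M) -> seq B -> M) (z : (seq B -> M) -> M) :
  (forall s, S s -> is_chain T (fun f => Phi f s)) -> is_chain S z ->
  is_chain T (fun f => z (Phi f)).
Proof.
move=> ST; elim=> [|s /ST//|z1 z2 _ c1 _ c2]; [exact: chain0|].
exact: chainB.
Qed.

Lemma chain_sdiff s : is_chain (fun t => face_of t s) (fun f => sdiff f s).
Proof.
elim: s => [|x s IH] /=; first exact: chain0.
apply: (@chainB _ _ _ (fun f => f s) (fun f => sdiff (fun u => f (x :: u)) s)).
  by apply: chain_tuple; left.
apply: (@chain_bind _ _ _ (fun f t => f (x :: t)) (fun f => sdiff f s)) IH.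
by move=> t ts; apply: chain_tuple; right.
Qed.

Lemma chain_bind_sdiff S s (Phi : (seq A -> M) -> seq A -> M) :
  (forall t, face_of t s -> is_chain S (fun f => Phi f t)) ->
  is_chain S (fun f => sdiff (Phi f) s).
Proof.
move=> h.
exact: (@chain_bind _ _ _ Phi (fun f => sdiff f s)) h (chain_sdiff s).
Qed.

End Chains.

Section Cup.
Variables (A : Type) (M : zmodType).

(* The Leibniz rule of the Alexander-Whitney product. *)
Lemma sdiff_cup (F : seq A -> seq A -> M) k s : (k.+1 < size s)%N ->
  sdiff (fun t => F (take k.+1 t) (drop k t)) s =
  sdiff (F^~ (drop k.+1 s)) (take k.+2 s) +
  (if odd k then - sdiff (F (take k.+1 s)) (drop k s)
   else sdiff (F (take k.+1 s)) (drop k s)).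
Proof.
elim: k F s => [|k IH] F [|x s] //= ks.
  by case: s ks => // y s _ /=; rewrite ?take0 ?drop0 subr0 [RHS]addrA subrK.
rewrite (IH (fun u v => F (x :: u) v)) // opprD addrA.
by case: (odd k) => //=; rewrite opprK.
Qed.

End Cup.

(** * From acyclicity to equivariant acyclicity *)

Section Contraction.
Variables (A : Type) (M : zmodType) (S : seq A -> Prop).
Hypothesis S0 : S [::].
Hypothesis S_face : forall s t, S t -> face_of s t -> S s.
Hypothesis acyclic : forall z : (seq A -> M) -> M, is_chain S z ->
  (forall f, z (sdiff f) = 0) ->
  exists2 b : (seq A -> M) -> M, is_chain S b & forall f, b (sdiff f) = z f.

(** The identity dc + cd = id of a contraction of the augmented chain complex, read at [s]. The
    value of [f] on the boundary of a chain [b] is [b (sdiff f)]. *)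
Definition is_contraction_at (c : seq A -> (seq A -> M) -> M) s :=
  is_chain S (c s) /\
  forall f, c s (sdiff f) = f s - sdiff (fun t => c t f) s.

(** With d the boundary, s - c(ds) has boundary ds - (ds - c(dds)) = 0 because [c] is a contraction
    at the faces of [s]; acyclicity fills this cycle. *)
Lemma contraction_step (c : seq A -> (seq A -> M) -> M) s : S s ->
  (forall t, face_of t s -> is_contraction_at c t) ->
  exists b, is_chain S b /\
    forall f, b (sdiff f) = f s - sdiff (fun t => c t f) s.
Proof.
move=> Ss cs.
have [||b b1 b2] := acyclic (z := fun f => f s - sdiff (fun t => c t f) s).
- apply: (@chainB _ _ _ (fun f => f s)); first exact: chain_tuple.
  by apply: chain_bind_sdiff => t /cs[].
- move=> f.
  have -> : sdiff (fun t => c t (sdiff f)) s =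
            sdiff (fun t => f t - sdiff (fun u => c u f) t) s.
    by apply: eq_sdiff => t /cs[_ ->].
  by rewrite sdiffB sdiff_sdiff subr0 subrr.
- by exists b.
Qed.

Lemma contraction_exists :
  exists c, forall s, S s -> is_contraction_at c s.
Proof.
pose step (c : seq A -> (seq A -> M) -> M) s : (seq A -> M) -> M :=
  xget (fun=> 0) [set b | is_chain S b /\
    forall f, b (sdiff f) = f s - sdiff (fun t => c t f) s].
(* [cn n] is meant for tuples of size [n] only: their faces have size [n.-1], where [cn n.-1] is
   available. The empty tuple has no face, whence the arbitrary start. *)
pose cn := fix cn n := if n is m.+1 then step (cn m) else step (fun _ _ => 0).
pose c s := cn (size s) s; exists c.
suff cP n s : S s -> size s = n -> is_contraction_at c s by move=> s /cP; apply.
elim: n s => [|n IH] s Ss sn.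
  case: s Ss sn => // Ss _.
  pose c0 (s : seq A) (f : seq A -> M) : M := 0.
  have [h1 h2] : is_chain S (step c0 [::]) /\
      forall f, step c0 [::] (sdiff f) = f [::] - sdiff (c0^~ f) [::].
    rewrite /step; case: xgetP => [b' -> //|nb].
    have [|b [b1 b2]] := @contraction_step c0 [::] Ss; first by [].
    by have [] := nb b.
  by [].
have cE t : face_of t s -> c t = cn n t.
  by move=> /size_face; rewrite /c sn => -[->].
have E f : f s - sdiff (fun t => cn n t f) s = f s - sdiff (fun t => c t f) s.
  by congr (_ - _); apply: eq_sdiff => t ts; rewrite cE.
have [b [b1 b2]] : exists b, is_chain S b /\
    forall f, b (sdiff f) = f s - sdiff (fun t => c t f) s.
  apply: contraction_step => // t ts; apply: IH; first exact: S_face Ss ts.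
  by have := size_face ts; rewrite sn => -[].
have [h1 h2] : is_chain S (step (cn n) s) /\
    forall f, step (cn n) s (sdiff f) = f s - sdiff (fun t => cn n t f) s.
  rewrite /step; case: xgetP => [b' -> //|/(_ b)[]].
  by split=> // f; rewrite E.
split; first by rewrite /c sn.
by move=> f; rewrite {1}/c sn -E; exact: h2.
Qed.

End Contraction.

Section Zigzag.
Variables (G : groupType) (A : Type) (act : G -> A -> A) (S : seq A -> Prop).
Variables (M : zmodType) (pi : G -> M -> M) (q : A -> G).
Local Notation vertex x := (S [:: x]).
Hypothesis S0 : S [::].
Hypothesis S_face : forall s t, S t -> face_of s t -> S s.
Hypothesis S_vertex : forall s, S s -> allp (fun x => vertex x) s.
Hypothesis S_act : forall g s, S s -> S (map (act g) s).
Hypothesis S_take : forall k s, S s -> S (take k s).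
Hypothesis S_drop : forall k s, S s -> S (drop k s).
Hypothesis act1 : forall x, vertex x -> act 1%g x = x.
Hypothesis actM : forall g h x, vertex x -> act (g * h)%g x = act g (act h x).
Hypothesis q_act : forall g x, vertex x -> q (act g x) = (g * q x)%g.
Hypothesis piB : forall g, {morph pi g : x y / x - y}.
Hypothesis acyclic : forall z : (seq A -> M) -> M, is_chain S z ->
  (forall f, z (sdiff f) = 0) ->
  exists2 b : (seq A -> M) -> M, is_chain S b & forall f, b (sdiff f) = z f.

Lemma tuple_act1 s : S s -> map (act 1%g) s = s.
Proof. by move/S_vertex; elim: s => //= x s IH [/act1 -> /IH ->]. Qed.

Lemma tuple_actM g h s : S s -> map (act (g * h)%g) s = map (act g) (map (act h) s).
Proof. by move/S_vertex; elim: s => //= x s IH [/actM -> /IH ->]. Qed.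

Lemma map_q_act g s : S s -> map q (map (act g) s) = map (fun h => g * h)%g (map q s).
Proof. by move/S_vertex; elim: s => //= x s IH [/q_act -> /IH ->]. Qed.

Definition equivariant (f : seq A -> M) : Prop :=
  forall g s, S s -> f (map (act g) s) = pi g (f s).

Section Fixed.
Variable cs : seq A -> (seq A -> M) -> M.
Hypothesis csP : forall s, S s -> is_contraction_at S cs s.

(** The contraction conjugated by [g], as an operator on cochains. [cs] itself need not be
    equivariant, but its conjugates are permuted by the group. *)
Definition translate (g : G) (f : seq A -> M) (s : seq A) : M :=
  cs (map (act g^-1%g) s) (fun t => f (map (act g) t)).

Lemma translateP g f s : S s ->
  translate g (sdiff f) s = f s - sdiff (translate g f) s.
Proof.
move=> Ss; rewrite /translate.
have [_ h] := csP (S_act g^-1 Ss).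
have -> : (fun t => sdiff f (map (act g) t)) =
          sdiff (fun t => f (map (act g) t)).
  by apply/funext => t; rewrite sdiff_map.
rewrite h -tuple_actM// mulgV tuple_act1//; congr (_ - _).
by rewrite -(sdiff_map _ (fun t => cs t (fun u => f (map (act g) u)))).
Qed.

Lemma translateB g f1 f2 s : S s ->
  translate g (fun t => f1 t - f2 t) s = translate g f1 s - translate g f2 s.
Proof.
by move=> Ss; rewrite /translate (chain_B _ _ (csP (S_act g^-1 Ss)).1).
Qed.

Lemma translate_ext g f1 f2 s : S s -> (forall t, S t -> f1 t = f2 t) ->
  translate g f1 s = translate g f2 s.
Proof.
move=> Ss f12; apply: (chain_ext (csP (S_act g^-1 Ss)).1) => t St.
by apply: f12; exact: S_act.
Qed.

Lemma translate0 g s : S s -> translate g (fun=> 0) s = 0.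
Proof. by move=> Ss; exact: (chain_zero (csP (S_act g^-1 Ss)).1). Qed.

Lemma translate_sdiff (B : Type) (F : seq B -> seq A -> M) g us s : S s ->
  translate g (fun t => sdiff (F^~ t) us) s =
  sdiff (fun vs => translate g (F vs) s) us.
Proof.
move=> Ss; elim: us F => [|u us IH] F /=; first exact: translate0.
by rewrite translateB// (IH (fun vs => F (u :: vs))).
Qed.

(** Descent in the double complex of functions of a tuple of [G] and a tuple of vertices: each
    further group element trades one vertex degree for one group degree. *)
Fixpoint zigzag (c : seq A -> M) (gs : seq G) : seq A -> M :=
  if gs is g :: hs then translate g (zigzag c hs) else c.

Lemma zigzag_equiv c g hs s : equivariant c -> S s ->
  zigzag c (map (fun h => g * h)%g hs) (map (act g) s) = pi g (zigzag c hs s).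
Proof.
move=> ce; elim: hs s => [|h hs IH] s Ss /=; first exact: ce.
rewrite /translate -tuple_actM// invgM mulgVK.
have [ch _] := csP (S_act h^-1 Ss).
rewrite -(chain_raddf (piB g) ch); apply: (chain_ext ch) => t St /=.
by rewrite tuple_actM// IH//; exact: S_act.
Qed.

(** By [translateP], the coboundary of [translate g F] is [F] minus the translate of the coboundary
    of [F]. Unfolded down to the cocycle [c], this leaves the alternating sum over deletions in
    [gs]. *)
Lemma sdiff_zigzag c gs s : (forall t, S t -> sdiff c t = 0) -> S s ->
  gs <> [::] -> sdiff (zigzag c gs) s = sdiff (zigzag c ^~ s) gs.
Proof.
move=> dc Ss; case: gs => // g gs _; elim: gs g s Ss => [|h gs IH] g s Ss.
  rewrite /= subr0; have := translateP g c Ss.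
  rewrite (translate_ext _ Ss dc) translate0// => /eqP.
  by rewrite eq_sym subr_eq0 => /eqP.
have -> : sdiff (zigzag c [:: g, h & gs]) s =
    zigzag c (h :: gs) s - translate g (sdiff (zigzag c (h :: gs))) s.
  by rewrite translateP// subKr.
rewrite [RHS]/=; congr (_ - _).
rewrite (translate_ext _ Ss (IH h)).
exact: (translate_sdiff (zigzag c) g (h :: gs) Ss).
Qed.

(** A primitive [a] of the group cocycle at the end of the zigzag is carried back to a primitive of
    [c]. The cochains [B k] send the first [k.+1] vertices through [q] and keep the vertices from
    position [k] on. They join [c], at [k = 0], to the pullback of the coboundary of [a], at
    [k = j.+1]. Consecutive ones agree up to sign modulo the coboundary of the equivariant cup
    product [hk]. *)
Lemma zigzag_exact c j (a : seq G -> M) : equivariant c ->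
  (forall s, S s -> sdiff c s = 0) ->
  (forall g hs, a (map (fun h => g * h)%g hs) = pi g (a hs)) ->
  (forall gs, size gs = j.+2 -> zigzag c gs [::] = sdiff a gs) ->
  exists2 h, equivariant h & forall s, S s -> size s = j.+2 -> sdiff h s = c s.
Proof.
move=> ce dc ae ba.
pose B k s := sdiff (zigzag c (map q (take k.+1 s))) (drop k s).
have B0 s : S s -> size s = j.+2 -> B 0%N s = c s.
  case: s => // x s Ss _; rewrite /B.
  by rewrite sdiff_zigzag ?drop0//= ?take0/= ?subr0.
suff st k : (k <= j.+1)%N -> exists2 h, equivariant h &
    forall s, S s -> size s = j.+2 -> sdiff h s = B k s.
  have [h he hB] := st 0%N isT; exists h => // s Ss sj.
  by rewrite hB// B0.
move=> kj; have [i ->] : exists i, k = (j.+1 - i)%N.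
  by exists (j.+1 - k)%N; rewrite subKn.
elim: i {k kj} => [|i [h he hB]].
  (* At [k = j.+1] a single vertex is left, so [B] is the zigzag at the empty tuple, that is the
     coboundary of [a] pulled back by [q]. *)
  exists (fun s => a (map q s)).
    by move=> g s Ss; rewrite map_q_act.
  move=> s Ss sj; rewrite subn0 /B sdiff_map.
  case/lastP: s Ss sj => // s x Ss; rewrite size_rcons => -[sj].
  rewrite -ba ?size_map ?size_rcons ?sj//.
  rewrite -[in X in sdiff _ X]sj -cats1 drop_size_cat//= subr0.
  by rewrite take_oversize// size_cat/= sj addn1.
(* From [i = j.+1] on, the truncated subtraction stays at zero and there is nothing to do. *)
have [ji|ij] := leqP j.+1 i.
  have -> : (j.+1 - i.+1 = j.+1 - i)%N by move: ji; rewrite -subn_eq0 subnS => /eqP ->.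
  by exists h.
pose k := (j.+1 - i.+1)%N.
have kE : (j.+1 - i = k.+1)%N by rewrite /k subnS prednK// subn_gt0.
rewrite -/k kE in hB *.
pose F us s := zigzag c (map q us) s.
pose hk s := F (take k.+1 s) (drop k s).
have hke : equivariant hk.
  move=> g s Ss; rewrite /hk -!map_take -!map_drop /F map_q_act; last exact: S_take.
  by apply: zigzag_equiv => //; exact: S_drop.
have dhk s : S s -> size s = j.+2 -> sdiff hk s = B k.+1 s + (if odd k then - B k s else B k s).
  move=> Ss sj; rewrite sdiff_cup; last first.
    by rewrite sj !ltnS /k subSS leq_subr.
  congr (_ + _).
  rewrite /F /B sdiff_zigzag//; last 2 first.
  - exact: S_drop.
  - by case: (s) sj.
  by rewrite -[RHS]sdiff_map.
exists (fun s => if odd k then h s - hk s else hk s - h s).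
  move=> g s Ss; rewrite he// hke//; case: (odd k); by rewrite piB.
move=> s Ss sj; have := dhk s Ss sj; have := hB s Ss sj.
case: (odd k); rewrite sdiffB => -> ->; first by rewrite opprD addrA subrr add0r opprK.
by rewrite addrC addKr.
Qed.

End Fixed.
End Zigzag.

Lemma group_coboundary_codom (G : groupType) (K : nzRingType) (M : lmodType K)
    (f : seq G -> M) j (x : 'I_j.+2 -> G) :
  group_coboundary (fun y => f (codom y)) x = sdiff f (codom x).
Proof.
rewrite /group_coboundary; elim: j f x => [|j IH] f x.
  rewrite !big_ord_recl big_ord0 /= !codomE !enum_ordSl !enum_ord0 /=.
  rewrite !expr0 !expr1 scale1r scaleN1r addr0 subr0.
  congr (f [:: x _] - f [:: x _]); exact/val_inj.
rewrite big_ord_recl expr0 scale1r [in RHS]codomE enum_ordSl /=.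
have cE k (y : 'I_k.+1 -> G) : codom y = y ord0 :: codom (fun i => y (lift ord0 i)).
  by rewrite !codomE enum_ordSl /= -map_comp.
congr (_ + _).
  by rewrite codomE -map_comp.
rewrite -map_comp -codomE -(IH (fun u => f (x ord0 :: u))) -sumrN.
apply: eq_bigr => k _.
rewrite /bump leq0n add1n exprS mulN1r scaleNr; congr (- (_ *: f _)).
rewrite cE; congr (x _ :: _); first exact/val_inj.
apply: eq_codom => i /=; congr x; apply: val_inj => /=.
rewrite /bump /=.
by rewrite !add1n ltnS; case: leqP.
Qed.

Section EquivariantAcyclic.
Variables (G : groupType) (K : nzRingType) (M : lmodType K) (pi : G -> M -> M).
Variables (A : Type) (act : G -> A -> A) (S : seq A -> Prop) (q : A -> G).
Local Notation vertex x := (S [:: x]).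
Hypothesis S0 : S [::].
Hypothesis S_face : forall s t, S t -> face_of s t -> S s.
Hypothesis S_vertex : forall s, S s -> allp (fun x => vertex x) s.
Hypothesis S_act : forall g s, S s -> S (map (act g) s).
Hypothesis S_take : forall k s, S s -> S (take k s).
Hypothesis S_drop : forall k s, S s -> S (drop k s).
Hypothesis act1 : forall x, vertex x -> act 1%g x = x.
Hypothesis actM : forall g h x, vertex x -> act (g * h)%g x = act g (act h x).
Hypothesis q_act : forall g x, vertex x -> q (act g x) = (g * q x)%g.
Hypothesis piB : forall g, {morph pi g : x y / x - y}.
Hypothesis acyclic : forall z : (seq A -> M) -> M, is_chain S z ->
  (forall f, z (sdiff f) = 0) ->
  exists2 b : (seq A -> M) -> M, is_chain S b & forall f, b (sdiff f) = z f.

(** Degree j + 1 is size [j.+2]. The zigzag evaluated at the empty tuple is a homogeneous group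
    cocycle, and [zigzag_exact] converts its primitive into one of [c]. *)
Lemma equivariant_acyclic (j : nat) (c : seq A -> M) :
  group_cohomologyS_eq0 pi j ->
  equivariant act S pi c -> (forall s, S s -> sdiff c s = 0) ->
  exists2 h, equivariant act S pi h &
    forall s, S s -> size s = j.+2 -> sdiff h s = c s.
Proof.
move=> Hj ce dc.
have [cs csP] := contraction_exists S_face acyclic.
pose b (x : 'I_j.+2 -> G) := zigzag act cs c (codom x) [::].
have pi0 g : pi g 0 = 0 by have := piB g 0 0; rewrite !subrr.
have bc : group_cochain pi (j := j.+1) b.
  move=> g x; rewrite /b.
  have -> : codom (fun i => (g * x i)%g) = map (fun h => (g * h)%g) (codom x).
    by rewrite !codomE -map_comp.
  have := zigzag_equiv S_vertex S_act actM piB csP g (codom x) ce S0.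
  exact.
have db : group_coboundary b = (fun=> 0).
  apply/funext => x; rewrite (group_coboundary_codom (fun gs => zigzag act cs c gs [::])).
  rewrite -(sdiff_zigzag S_vertex S_act act1 actM csP dc S0)//.
  by rewrite codomE enum_ordSl.
have [h hc dh] := Hj _ bc db.
(* The extension by zero to other sizes is still equivariant, as [pi g] fixes zero. *)
pose a gs : M := if size gs == j.+1 then h (fun i => nth 1%g gs i) else 0.
apply: (zigzag_exact S_vertex S_act S_take S_drop act1 actM q_act piB csP (a := a)) => //.
  move=> g gs; rewrite /a size_map; case: ifP => [/eqP gsj|_]; last by rewrite pi0.
  rewrite -hc; congr h; apply/funext => i.
  by rewrite (nth_map 1%g)// gsj.
move=> gs gsj.
pose x (i : 'I_j.+2) := nth 1%g gs i.
have xE : codom x = gs.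
  rewrite codomE (map_comp (nth 1%g gs)) val_enum_ord -gsj.
  by rewrite -/(mkseq _ _) mkseq_nth.
rewrite -{1}xE -[LHS]/(b x) -dh -xE -group_coboundary_codom.
rewrite /group_coboundary; apply: eq_bigr => k _; congr (_ *: _).
rewrite /a size_codom card_ord eqxx; congr h; apply/funext => i.
by rewrite codomE (nth_map i) ?size_enum_ord// nth_ord_enum.
Qed.

End EquivariantAcyclic.

(** * The Hilbert space of square summable functions *)

Section UnconditionalSum.
Variables (R : realType) (T : choiceType).
Implicit Types (u v : T -> R) (F : {fset T}).

Definition fsums u : set R := [set \sum_(t <- F) u t | F in [set: {fset T}]].

Definition psummable u : Prop := (forall t, 0 <= u t) /\ has_ubound (fsums u).

Definition psum u : R := sup (fsums u).

Lemma fsums_neq0 u : fsums u !=set0.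
Proof. by exists (\sum_(t <- fset0) u t), fset0. Qed.

Lemma psum_ub u F : psummable u -> \sum_(t <- F) u t <= psum u.
Proof.
move=> [_ ub]; apply: sup_upper_bound; last by exists F.
by split=> //; exact: fsums_neq0.
Qed.

Lemma psum_le u (b : R) : (forall F, \sum_(t <- F) u t <= b) -> psum u <= b.
Proof. by move=> ub; apply: ge_sup; [exact: fsums_neq0|move=> _ [F _ <-]]. Qed.

Lemma psummable_le u v : psummable v -> (forall t, 0 <= u t <= v t) ->
  psummable u.
Proof.
move=> sv uv; split=> [t|]; first by case/andP: (uv t).
exists (psum v) => _ [F _ <-]; apply: le_trans (psum_ub F sv).
by apply: ler_sum => t _; case/andP: (uv t).
Qed.

Lemma le_psum u v : psummable v -> (forall t, 0 <= u t <= v t) ->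
  psum u <= psum v.
Proof.
move=> sv uv; apply: psum_le => F; apply: le_trans (psum_ub F sv).
by apply: ler_sum => t _; case/andP: (uv t).
Qed.

Lemma psum_ge0 u : psummable u -> 0 <= psum u.
Proof. by move=> su; have := psum_ub fset0 su; rewrite big_seq_fset0. Qed.

Lemma psum_ge u t : psummable u -> u t <= psum u.
Proof. by move=> su; have := psum_ub [fset t]%fset su; rewrite big_seq_fset1. Qed.

Lemma psummableD u v : psummable u -> psummable v ->
  psummable (fun t => u t + v t).
Proof.
move=> su sv; split=> [t|]; first by rewrite addr_ge0//; [case: su|case: sv].
exists (psum u + psum v) => _ [F _ <-].
by rewrite big_split lerD// psum_ub.
Qed.

Lemma psumD u v : psummable u -> psummable v ->
  psum (fun t => u t + v t) = psum u + psum v.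
Proof.
move=> su sv; apply/eqP; rewrite eq_le; apply/andP; split.
  by apply: psum_le => F; rewrite big_split lerD// psum_ub.
(* For the converse inequality two finite sets are replaced by their union, on which both partial
   sums are at least as large. *)
rewrite -lerBrDr; apply: psum_le => F1; rewrite lerBrDr addrC -lerBrDr.
apply: psum_le => F2; rewrite lerBrDr.
apply: le_trans (psum_ub (F1 `|` F2)%fset (psummableD su sv)).
rewrite big_split /= addrC.
have h (w : T -> R) (F F' : {fset T}) : (forall t, 0 <= w t) -> (F `<=` F')%fset ->
    \sum_(t <- F) w t <= \sum_(t <- F') w t.
  move=> w0 FF'; rewrite [leRHS](big_fsetID _ (mem F))/=.
  have -> : [fset x in F' | x \in F]%fset = F.
    apply/fsetP => x; rewrite !inE/=; case: (boolP (x \in F)) => xF; rewrite ?andbF// andbT.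
    exact: (fsubsetP FF').
  by rewrite lerDl sumr_ge0.
by apply: lerD; apply: h; rewrite ?fsubsetUl ?fsubsetUr//; [case: sv|case: su].
Qed.

Lemma psummableZ (c : R) u : 0 <= c -> psummable u ->
  psummable (fun t => c * u t).
Proof.
move=> c0 su; split=> [t|]; first by rewrite mulr_ge0//; case: su.
exists (c * psum u) => _ [F _ <-].
by rewrite -mulr_sumr ler_wpM2l// psum_ub.
Qed.

Lemma psumZ (c : R) u : 0 <= c -> psummable u ->
  psum (fun t => c * u t) = c * psum u.
Proof.
move=> c0 su; apply/eqP; rewrite eq_le; apply/andP; split.
  by apply: psum_le => F; rewrite -mulr_sumr ler_wpM2l// psum_ub.
have [->|cn0] := eqVneq c 0.
  rewrite mul0r; have := psum_ge0 (psummableZ (lexx 0) su); exact.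
have cp : 0 < c by rewrite lt_def cn0.
rewrite mulrC -ler_pdivlMr//; apply: psum_le => F.
by rewrite ler_pdivlMr// mulrC mulr_sumr psum_ub//; exact: psummableZ.
Qed.

Lemma fsums_bij u (s s' : T -> T) : cancel s s' -> cancel s' s ->
  fsums (u \o s) = fsums u.
Proof.
move=> ss' s's; have h (w : T -> R) (r r' : T -> T) : cancel r r' -> fsums (w \o r) `<=` fsums w.
  move=> rr' _ [F _ <-]; exists (r @` F)%fset => //.
  rewrite big_imfset//= => x y _ _; exact: (can_inj rr').
apply/seteqP; split; first exact: h ss'.
have -> : fsums u = fsums ((u \o s) \o s').
  by congr fsums; apply/funext => t /=; rewrite s's.
exact: h s's.
Qed.

End UnconditionalSum.

Section L2.
Variables (R : realType) (T : choiceType).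
Local Notation C := R[i].

Definition sqmod (z : C) : R := (complex.Re z) ^+ 2 + (complex.Im z) ^+ 2.

Lemma sqmod_ge0 z : 0 <= sqmod z.
Proof. by rewrite addr_ge0// sqr_ge0. Qed.

Lemma sqmod_eq0 z : sqmod z = 0 -> z = 0.
Proof.
case: z => a b /eqP; rewrite /sqmod /= paddr_eq0 ?sqr_ge0// !sqrf_eq0.
by move=> /andP[/eqP -> /eqP ->].
Qed.

Lemma sqmod0 : sqmod 0 = 0.
Proof. by rewrite /sqmod /= expr0n addr0. Qed.

Lemma sqmodM z w : sqmod (z * w) = sqmod z * sqmod w.
Proof. by case: z w => [a b] [c d]; rewrite /sqmod /=; ring. Qed.

Lemma sqmod_norm z : `|z| = (Num.sqrt (sqmod z))%:C%C.
Proof. exact: normc_def. Qed.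

(* The pointwise form of Minkowski's inequality. *)
Lemma sqmodD_le (a b : R) z w : 0 < a -> 0 < b ->
  sqmod (z + w) <= (1 + b / a) * sqmod z + (1 + a / b) * sqmod w.
Proof.
move=> a0 b0; case: z w => [x y] [x' y']; rewrite /sqmod /=.
have h (p q : R) : (p + q) ^+ 2 <= (1 + b / a) * p ^+ 2 + (1 + a / b) * q ^+ 2.
  have -> : (1 + b / a) * p ^+ 2 + (1 + a / b) * q ^+ 2 =
      (p + q) ^+ 2 + (a * b)^-1 * (b * p - a * q) ^+ 2.
    by field; rewrite !gt_eqF.
  by rewrite lerDl mulr_ge0 ?sqr_ge0// invr_ge0 mulr_ge0 ?ltW.
have := lerD (h x x') (h y y'); rewrite !mulrDr; lra.
Qed.

Definition l2_pred : {pred T -> C} :=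
  fun f => `[< psummable (fun t => sqmod (f t)) >].

Lemma l2_predP (f : T -> C) :
  reflect (psummable (fun t => sqmod (f t))) (f \in l2_pred).
Proof. exact: asboolP. Qed.

Lemma l2_submod : submod_closed l2_pred.
Proof.
split.
  apply/l2_predP; split=> [t|]; first exact: sqmod_ge0.
  by exists 0 => _ [F _ <-]; rewrite big1// => t _; exact: sqmod0.
move=> a f g /l2_predP sf /l2_predP sg; apply/l2_predP.
have h := psummableD (psummableZ (ler0n R 2) (psummableZ (sqmod_ge0 a) sf))
  (psummableZ (ler0n R 2) sg).
apply: psummable_le h _ => t; rewrite sqmod_ge0/=.
have := @sqmodD_le 1 1 (a * f t) (g t) ltr01 ltr01.
rewrite sqmodM divr1 -[1 + 1]/(2%:R); exact.
Qed.

HB.instance Definition _ := GRing.isSubmodClosed.Build _ _ l2_pred l2_submod.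

Record l2 := MkL2 { l2_val :> T -> C; _ : l2_val \in l2_pred }.

HB.instance Definition _ := [isSub for l2_val].
HB.instance Definition _ := [Choice of l2 by <:].
HB.instance Definition _ := [SubChoice_isSubLmodule of l2 by <:].

Implicit Types (f g : l2).

Lemma l2P f : psummable (fun t => sqmod (f t)).
Proof. by apply/l2_predP; case: f. Qed.

Lemma l2_ext f g : (forall t, f t = g t) -> f = g.
Proof. by move=> fg; apply: val_inj; apply/funext. Qed.

Lemma l2DE f g t : (f + g) t = f t + g t. Proof. by []. Qed.
Lemma l2NE f t : (- f) t = - f t. Proof. by []. Qed.
Lemma l2ZE (a : C) f t : (a *: f) t = a * f t. Proof. by []. Qed.
Definition l2_sqnorm f : R := psum (fun t => sqmod (f t)).

Definition l2_norm f : C := (Num.sqrt (l2_sqnorm f))%:C%C.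

Lemma l2_sqnorm_ge0 f : 0 <= l2_sqnorm f.
Proof. exact: psum_ge0 (l2P f). Qed.

Lemma l2_norm0_eq0 f : l2_norm f = 0 -> f = 0.
Proof.
move=> [/eqP]; rewrite sqrtr_eq0 => f0; apply: l2_ext => t.
apply: sqmod_eq0; apply/eqP; rewrite eq_le sqmod_ge0 andbT.
exact: le_trans (psum_ge t (l2P f)) f0.
Qed.

Lemma l2_normZ (a : C) f : l2_norm (a *: f) = `|a| * l2_norm f.
Proof.
rewrite /l2_norm sqmod_norm -rmorphM; congr (_%:C)%C.
rewrite -sqrtrM ?sqmod_ge0//; congr Num.sqrt.
rewrite /l2_sqnorm -psumZ ?sqmod_ge0//; last exact: l2P.
by congr psum; apply/funext => t; rewrite l2ZE sqmodM.
Qed.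

(** The pointwise inequality is summed with weights [a] and [b] equal to the two norms; its
    right-hand side then adds up to exactly (a + b)^2. Since the weights are divided by, zero norms
    are treated apart. *)
Lemma l2_normD f g : l2_norm (f + g) <= l2_norm f + l2_norm g.
Proof.
rewrite /l2_norm -rmorphD lecR.
set a := Num.sqrt (l2_sqnorm f); set b := Num.sqrt (l2_sqnorm g).
have [a0|an0] := eqVneq a 0.
  have -> : f = 0 by apply: l2_norm0_eq0; rewrite /l2_norm -/a a0.
  by rewrite add0r a0 add0r.
have [b0|bn0] := eqVneq b 0.
  have -> : g = 0 by apply: l2_norm0_eq0; rewrite /l2_norm -/b b0.
  by rewrite addr0 b0 addr0.
have a0 : 0 < a by rewrite lt_def an0 sqrtr_ge0.
have b0 : 0 < b by rewrite lt_def bn0 sqrtr_ge0.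
rewrite -[leRHS]ger0_norm; last by rewrite addr_ge0 ?ltW.
rewrite -sqrtr_sqr ler_sqrt ?sqr_ge0//.
have sf := psummableZ (c := 1 + b / a) (ltac:(by rewrite addr_ge0// divr_ge0 ?ltW)) (l2P f).
have sg := psummableZ (c := 1 + a / b) (ltac:(by rewrite addr_ge0// divr_ge0 ?ltW)) (l2P g).
have -> : (a + b) ^+ 2 = (1 + b / a) * l2_sqnorm f + (1 + a / b) * l2_sqnorm g.
  rewrite -[l2_sqnorm f]sqr_sqrtr ?l2_sqnorm_ge0// -/a.
  rewrite -[l2_sqnorm g]sqr_sqrtr ?l2_sqnorm_ge0// -/b.
  by field; rewrite an0 bn0.
rewrite /l2_sqnorm -psumZ; [|by rewrite addr_ge0// divr_ge0 ?ltW|exact: l2P].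
rewrite -psumZ; [|by rewrite addr_ge0// divr_ge0 ?ltW|exact: l2P].
rewrite -psumD//; apply: le_psum; first exact: psummableD.
by move=> t; rewrite sqmod_ge0 sqmodD_le.
Qed.

HB.instance Definition _ :=
  Lmodule_isNormed.Build C l2 l2_normD l2_normZ l2_norm0_eq0.

Lemma l2_normE f : `|f| = l2_norm f.
Proof. by []. Qed.

Lemma l2_norm_sq f : `|f| ^+ 2 = (l2_sqnorm f)%:C%C.
Proof.
by rewrite l2_normE /l2_norm -rmorphXn/= sqr_sqrtr//; exact: l2_sqnorm_ge0.
Qed.

Lemma l2_norm_le f (e : R) : 0 <= e -> (`|f| <= e%:C%C) = (l2_sqnorm f <= e ^+ 2).
Proof.
move=> e0; rewrite l2_normE /l2_norm lecR -{1}[e]ger0_norm//.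
by rewrite -sqrtr_sqr ler_sqrt// sqr_ge0.
Qed.

Lemma sqmod_cvg (F : set_system l2) (FF : Filter F) (f : l2) (g : T -> C) t :
  complex.Re (f' t) @[f' --> F] --> complex.Re (g t) ->
  complex.Im (f' t) @[f' --> F] --> complex.Im (g t) ->
  sqmod (f t - f' t) @[f' --> F] --> sqmod (f t - g t).
Proof.
move=> hR hI; rewrite /sqmod.
have E (z w : C) : complex.Re (z - w) = complex.Re z - complex.Re w by case: z w => [? ?] [].
have E' (z w : C) : complex.Im (z - w) = complex.Im z - complex.Im w by case: z w => [? ?] [].
under eq_fun do rewrite E E' !expr2.
rewrite E E' !expr2.
have cR : (fun f' : l2 => complex.Re (f t) - complex.Re (f' t)) @ F -->
    complex.Re (f t) - complex.Re (g t).
  by apply: cvgB => //; exact: cvg_cst.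
have cI : (fun f' : l2 => complex.Im (f t) - complex.Im (f' t)) @ F -->
    complex.Im (f t) - complex.Im (g t).
  by apply: cvgB => //; exact: cvg_cst.
by apply: cvgD; apply: cvgM.
Qed.

Lemma fsum_cvg (F : set_system l2) (FF : Filter F) (D : {fset T})
    (u : l2 -> T -> R) (v : T -> R) :
  (forall t, u f t @[f --> F] --> v t) ->
  (\sum_(t <- D) u f t) @[f --> F] --> \sum_(t <- D) v t.
Proof.
move=> uv.
exact: (@cvg_big R T +%R 0 xpredT (@add_continuous R) l2 F D (fun t f => u f t) v).
Qed.

Lemma cauchy_coord (F : set_system l2) (FF : ProperFilter F) (h : l2 -> R) :
  (forall f g : l2, (h f - h g) ^+ 2 <= l2_sqnorm (f - g)) ->
  cauchy F -> exists l : R, h f @[f --> F] --> l.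
Proof.
move=> hP Fc; apply/cvg_ex; apply: R_complete; apply/cauchy_ballP => e e0.
have /cauchy_ballP /(_ e%:C%C) := Fc.
rewrite ltcR => /(_ e0) H.
have : \forall f \near F & g \near F, ball (h f) e (h g).
  apply: filterS H => -[f g] /=.
  rewrite -!ball_normE /ball_ /= l2_normE /l2_norm ltcR => fg.
  rewrite -ltr_sqr ?nnegrE ?normr_ge0 ?ltW// real_normK ?num_real//.
  apply: le_lt_trans (hP f g) _.
  by rewrite -[ltLHS]sqr_sqrtr ?l2_sqnorm_ge0// ltr_sqr ?nnegrE ?sqrtr_ge0 ?ltW.
by move=> -[[A B] /= [FA FB] AB]; exists (h @` A, h @` B) => /=; [split|];
  [apply: filterS FA => x Ax; exists x|apply: filterS FB => x Bx; exists x|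
   move=> [_ _] [/= [x Ax <-] [y By <-]]; exact: (AB (x, y))].
Qed.

(** The limit is taken coordinatewise. The Cauchy bound on finite partial sums passes to it,
    uniformly in the finite set, and this yields both its square summability and the convergence in
    norm. *)
Lemma l2_complete (F : set_system l2) : ProperFilter F -> cauchy F -> cvg F.
Proof.
move=> FF Fc.
have sqRe f t : (complex.Re (f t)) ^+ 2 <= l2_sqnorm f.
  by apply: le_trans (psum_ge t (l2P f)); rewrite lerDl sqr_ge0.
have sqIm f t : (complex.Im (f t)) ^+ 2 <= l2_sqnorm f.
  by apply: le_trans (psum_ge t (l2P f)); rewrite lerDr sqr_ge0.
have /choice[gR hR] t : exists l : R, complex.Re ((f' : l2) t) @[f' --> F] --> l.
  apply: (@cauchy_coord F FF (fun f => complex.Re (f t))) => // f g.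
  have := sqRe (f - g) t; rewrite l2DE l2NE.
  by case: (f t) (g t) => [? ?] [].
have /choice[gI hI] t : exists l : R, complex.Im ((f' : l2) t) @[f' --> F] --> l.
  apply: (@cauchy_coord F FF (fun f => complex.Im (f t))) => // f g.
  have := sqIm (f - g) t; rewrite l2DE l2NE.
  by case: (f t) (g t) => [? ?] [].
pose g t := Complex (gR t) (gI t).
have near_g (e : R) : 0 < e -> F [set f : l2 | forall D : {fset T},
    \sum_(t <- D) sqmod (f t - g t) <= e ^+ 2].
  move=> e0; have /cauchyP /(_ (e / 2)%:C%C) := Fc.
  rewrite ltcR divr_gt0// => /(_ isT)[x Fx].
  apply: filterS (Fx) => f xf D.
  apply: (@closed_cvg _ R F FF (fun f' : l2 => \sum_(t <- D) sqmod (f t - f' t))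
    (fun y => y <= e ^+ 2)).
  - exact: closed_le.
  - apply: filterS Fx => f' xf'.
    have h : `|f - f'| <= e%:C%C.
      have -> : f - f' = (x - f') - (x - f) by rewrite opprB [RHS]addrC subrKA.
      apply: le_trans (ler_normB _ _) _.
      rewrite [e]splitr rmorphD lerD//.
        by move: xf'; rewrite -ball_normE => /ltW.
      by move: xf; rewrite -ball_normE => /ltW.
    move: h; rewrite l2_norm_le; last exact: ltW.
    by apply: le_trans; exact: (psum_ub D (l2P (f - f'))).
  - by apply: fsum_cvg => t; apply: sqmod_cvg; [exact: hR|exact: hI].
have gl2 : g \in l2_pred.
  have [f hf] := filter_ex (near_g 1 ltr01).
  have fg : (fun t => f t - g t) \in l2_pred.
    apply/l2_predP; split=> [t|]; first exact: sqmod_ge0.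
    by exists (1 ^+ 2) => _ [D _ <-].
  have -> : g = l2_val f - (fun t => f t - g t).
    by apply/funext => t; rewrite !fctE subKr.
  by rewrite rpredB//; exact: valP f.
apply/cvg_ex; exists (MkL2 gl2); apply/cvgrPdist_le => e e0.
have eE : e = (complex.Re e)%:C%C by rewrite RRe_real ?gtr0_real.
have e0' : 0 < complex.Re e by rewrite eE ltcR in e0.
apply: filterS (near_g _ e0') => f hf.
rewrite distrC eE l2_norm_le; last exact: ltW.
exact: psum_le.
Qed.

HB.instance Definition _ := Uniform_isComplete.Build l2 l2_complete.

End L2.

(** * Absolutely convergent sums and the inner product *)

Section Dot.
Variables (R : realType) (T : choiceType).
Local Notation C := R[i].
Implicit Types (u v a b : T -> R).

Definition asummable u : Prop := psummable (fun t => `|u t|).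

Definition rsum u : R :=
  psum (fun t => Num.max (u t) 0) - psum (fun t => Num.max (- u t) 0).

Lemma asummable_pos u : asummable u -> psummable (fun t => Num.max (u t) 0).
Proof.
move=> su; apply: (psummable_le su) => t.
by rewrite le_max lexx orbT ge_max normr_ge0 ler_norm.
Qed.

Lemma asummable_neg u : asummable u -> psummable (fun t => Num.max (- u t) 0).
Proof.
move=> su; apply: (psummable_le su) => t.
by rewrite le_max lexx orbT ge_max normr_ge0 -normrN ler_norm.
Qed.

Lemma posneg (x : R) : Num.max x 0 - Num.max (- x) 0 = x.
Proof.
have [x0|x0] := leP x 0; first by rewrite max_l ?oppr_ge0// sub0r opprK.
by rewrite max_r ?subr0// oppr_le0 ltW.
Qed.

(** The negative part plus [a] equals the positive part plus [b], and sums of nonnegative functions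
    are additive. Being free to choose the decomposition is what makes [rsum] linear. *)
Lemma rsumE u a b : psummable a -> psummable b ->
  (forall t, u t = a t - b t) -> rsum u = psum a - psum b.
Proof.
move=> sa sb uE.
have su : asummable u.
  apply: (psummable_le (psummableD sa sb)) => t; rewrite normr_ge0 uE.
  apply: le_trans (ler_normB _ _) _.
  by rewrite !ger0_norm//; [case: sb|case: sa].
have := psumD (asummable_pos su) sb; have := psumD (asummable_neg su) sa.
have -> : (fun t => Num.max (- u t) 0 + a t) = (fun t => Num.max (u t) 0 + b t).
  by apply/funext => t; have := posneg (u t); have := uE t; lra.
by rewrite /rsum => ->; lra.
Qed.

Lemma rsum_lin (c : R) u v : asummable u -> asummable v ->
  rsum (fun t => c * u t + v t) = c * rsum u + rsum v.
Proof.
move=> su sv; rewrite {2 3}/rsum.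
have [pu nu pv nv] := And4 (asummable_pos su) (asummable_neg su)
  (asummable_pos sv) (asummable_neg sv).
have [c0|/ltW c0] := leP 0 c.
  rewrite (rsumE (psummableD (psummableZ c0 pu) pv) (psummableD (psummableZ c0 nu) nv)).
    by rewrite !psumD ?psumZ//; [lra|exact: psummableZ|exact: psummableZ].
  by move=> t; rewrite -{1}(posneg (u t)) -{1}(posneg (v t)); lra.
have c1 : 0 <= - c by rewrite oppr_ge0.
rewrite (rsumE (psummableD (psummableZ c1 nu) pv) (psummableD (psummableZ c1 pu) nv)).
  by rewrite !psumD ?psumZ//; [lra|exact: psummableZ|exact: psummableZ].
by move=> t; rewrite -{1}(posneg (u t)) -{1}(posneg (v t)); lra.
Qed.

Lemma asummable_lin (c : R) u v : asummable u -> asummable v ->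
  asummable (fun t => c * u t + v t).
Proof.
move=> su sv; apply: (psummable_le (psummableD (psummableZ (normr_ge0 c) su) sv)).
by move=> t; rewrite normr_ge0 -normrM ler_normD.
Qed.

Lemma rsum_nneg u : psummable u -> rsum u = psum u.
Proof.
move=> su; have s0 : psummable (fun _ : T => 0 : R).
  by apply: (psummable_le su) => t; rewrite lexx /=; case: su => + _; exact.
rewrite (rsumE su s0); last by move=> t; rewrite subr0.
have -> : psum (fun _ : T => 0 : R) = 0; last by rewrite subr0.
apply/eqP; rewrite eq_le psum_ge0// andbT.
by apply: psum_le => F; rewrite big1.
Qed.

Lemma rsum_bij u (s s' : T -> T) : cancel s s' -> cancel s' s ->
  rsum (u \o s) = rsum u.
Proof.
move=> ss' s's; rewrite /rsum /psum.
have := fsums_bij (fun t => Num.max (u t) 0) ss' s's.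
have := fsums_bij (fun t => Num.max (- u t) 0) ss' s's.
by rewrite /comp => -> ->.
Qed.

Definition csummable (z : T -> C) : Prop :=
  asummable (fun t => complex.Re (z t)) /\ asummable (fun t => complex.Im (z t)).

Definition csum (z : T -> C) : C :=
  Complex (rsum (fun t => complex.Re (z t))) (rsum (fun t => complex.Im (z t))).

Lemma csum_lin (c : C) (z w : T -> C) : csummable z -> csummable w ->
  csum (fun t => c * z t + w t) = c * csum z + csum w.
Proof.
case: c => c1 c2 [zR zI] [wR wI]; rewrite /csum.
have -> : (fun t => complex.Re (Complex c1 c2 * z t + w t)) =
    (fun t => c1 * complex.Re (z t) + (- c2 * complex.Im (z t) + complex.Re (w t))).
  by apply/funext => t; case: (z t) (w t) => [? ?] [? ?] /=; ring.
have -> : (fun t => complex.Im (Complex c1 c2 * z t + w t)) =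
    (fun t => c1 * complex.Im (z t) + (c2 * complex.Re (z t) + complex.Im (w t))).
  by apply/funext => t; case: (z t) (w t) => [? ?] [? ?] /=; ring.
have h1 := asummable_lin (- c2) zI wR; have h2 := asummable_lin c2 zR wI.
rewrite (rsum_lin c1 zR h1) (rsum_lin _ zI wR) (rsum_lin c1 zI h2) (rsum_lin _ zR wI).
by apply/eqP; rewrite eq_complex /=; apply/andP; split; apply/eqP; ring.
Qed.

Local Notation H := (l2 R T).
Implicit Types (f g h : H).

Definition l2_dot f g : C := csum (fun t => f t * conjc (g t)).

Lemma csummable_dot f g : csummable (fun t => f t * conjc (g t)).
Proof.
have s := psummableD (l2P f) (l2P g).
have h (a b c d : R) : `|a * c + b * d| <= a ^+ 2 + b ^+ 2 + (c ^+ 2 + d ^+ 2).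
  have := sqr_ge0 (a + c); have := sqr_ge0 (a - c).
  have := sqr_ge0 (b + d); have := sqr_ge0 (b - d).
  have := sqr_ge0 a; have := sqr_ge0 b; have := sqr_ge0 c; have := sqr_ge0 d.
  by rewrite ler_norml !sqrrB !sqrrD => *; apply/andP; split; lra.
split; apply: (psummable_le s) => t; rewrite normr_ge0 /sqmod;
  case: (f t) (g t) => [a b] [c d] /=.
  by have := h a b c d; rewrite mulrN opprK.
by have := h b (- a) c d; rewrite sqrrN mulNr mulrN addrC [b ^+ 2 + _]addrC.
Qed.

Lemma l2_dot_lin (c : C) f h g :
  l2_dot (c *: f + h) g = c * l2_dot f g + l2_dot h g.
Proof.
rewrite /l2_dot -csum_lin; [|exact: csummable_dot|exact: csummable_dot].
by congr csum; apply/funext => t; rewrite l2DE l2ZE mulrDl mulrA.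
Qed.

Lemma l2_dot_herm f g : l2_dot f g = conjc (l2_dot g f).
Proof.
have s0 : asummable (fun _ : T => 0 : R).
  apply: (psummable_le (l2P f)) => t; rewrite normr0 lexx; exact: sqmod_ge0.
have r0 : rsum (fun _ : T => 0 : R) = 0.
  by rewrite /rsum oppr0 subrr.
have [sR sI] := csummable_dot g f.
rewrite /l2_dot /csum /=; congr Complex.
  by congr rsum; apply/funext => t; case: (f t) (g t) => [a b] [c d] /=; ring.
have := rsum_lin (-1) sI s0; rewrite r0 addr0 mulN1r => <-.
by congr rsum; apply/funext => t; case: (f t) (g t) => [a b] [c d] /=; ring.
Qed.

Lemma l2_dotE f : l2_dot f f = (l2_sqnorm f)%:C%C.
Proof.
rewrite /l2_dot /csum; congr Complex.
  rewrite -[RHS]rsum_nneg; last exact: l2P.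
  by congr rsum; apply/funext => t; rewrite /sqmod; case: (f t) => a b /=; ring.
have -> : (fun t => complex.Im (f t * conjc (f t))) = (fun=> 0).
  by apply/funext => t; case: (f t) => a b /=; ring.
by rewrite /rsum oppr0 subrr.
Qed.

Lemma l2_dot_bilinear :
  bilinear_for ( *%R : GRing.Scale.law _ _) (Num.conj \; *%R : GRing.Scale.law _ _) l2_dot.
Proof.
split=> [g c f h|f c g h] /=; first exact: l2_dot_lin.
rewrite (l2_dot_herm f (c *: g + h)) (l2_dot_herm f g) (l2_dot_herm f h).
by rewrite l2_dot_lin rmorphD rmorphM.
Qed.

HB.instance Definition _ := bilinear_isBilinear.Build C H H C
  ( *%R : GRing.Scale.law _ _) (Num.conj \; *%R : GRing.Scale.law _ _) l2_dot l2_dot_bilinear.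

Lemma l2_dot_hermitian f g : l2_dot f g = (-1) ^+ false * Num.conj (l2_dot g f).
Proof. by rewrite expr0 mul1r l2_dot_herm. Qed.

HB.instance Definition _ :=
  isHermitianSesquilinear.Build C H false Num.conj l2_dot l2_dot_hermitian.

Lemma l2_dot_gt0 f : f != 0 -> 0 < l2_dot f f.
Proof.
move=> f0; rewrite l2_dotE ltcR lt_def l2_sqnorm_ge0 andbT.
apply: contra_neq f0 => f0; apply: l2_norm0_eq0.
by rewrite /l2_norm f0 sqrtr0.
Qed.

HB.instance Definition _ := isDotProduct.Build C H l2_dot l2_dot_gt0.

Lemma l2_hilbert : hilbert_dot (l2_dot : {dot H for Num.conj}).
Proof. by move=> f; rewrite l2_norm_sq -l2_dotE. Qed.

End Dot.

(** * Unitary representations from permutations of the index set *)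

Section PermutationRepresentation.
Variables (R : realType) (T : choiceType) (G : groupType) (act : G -> T -> T).
Hypothesis act1 : forall t, act 1%g t = t.
Hypothesis actM : forall g h t, act (g * h)%g t = act g (act h t).
Local Notation H := (l2 R T).

Lemma act_can g : cancel (act g) (act g^-1%g).
Proof. by move=> t; rewrite -actM mulVg act1. Qed.

Lemma act_canV g : cancel (act g^-1%g) (act g).
Proof. by move=> t; rewrite -actM mulgV act1. Qed.

Fact l2_perm_subproof (g : G) (f : H) :
  (fun t => f (act g^-1%g t)) \in @l2_pred R T.
Proof.
apply/l2_predP; have [f0 fu] := l2P f; split=> [t|]; first exact: f0.
by move: fu; rewrite -(fsums_bij _ (act_canV g) (act_can g)).
Qed.

Definition l2_perm (g : G) (f : H) : H := MkL2 (l2_perm_subproof g f).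

Lemma l2_perm_unitary :
  unitary_representation (@l2_dot R T : {dot H for Num.conj}) l2_perm.
Proof.
split.
- by move=> g c f h; exact: l2_ext.
- by apply/funext => f; apply: l2_ext => t /=; rewrite invg1 act1.
- by move=> g h; apply/funext => f; apply: l2_ext => t /=; rewrite invgM actM.
- move=> g x y; rewrite -[LHS]/(l2_dot _ _) -[RHS]/(l2_dot _ _) /l2_dot /csum /=.
  congr Complex.
    exact: (rsum_bij (fun t => complex.Re (x t * conjc (y t))) (act_canV g) (act_can g)).
  exact: (rsum_bij (fun t => complex.Im (x t * conjc (y t))) (act_canV g) (act_can g)).
Qed.

End PermutationRepresentation.

(** * Barycentric subdivision of linear chains *)

Lemma allpP (A : eqType) (P : A -> Prop) (s : seq A) :
  allp P s <-> forall x, x \in s -> P x.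
Proof.
elim: s => [|x s IH] //=; split.
  by move=> [Px /IH Ps] y; rewrite inE => /orP[/eqP ->//|/Ps].
move=> h; split; first by apply: h; rewrite inE eqxx.
by apply/IH => y ys; apply: h; rewrite inE ys orbT.
Qed.

Lemma allp_impl (A : Type) (P Q : A -> Prop) (s : seq A) :
  (forall x, P x -> Q x) -> allp P s -> allp Q s.
Proof. by move=> PQ; elim: s => //= x s IH [/PQ ? /IH]. Qed.

Lemma subrACA' (M : zmodType) (x y z t : M) : x - y - (z - t) = x - z - (y - t).
Proof. by rewrite !opprB addrACA [RHS]addrACA; congr (_ + _); rewrite addrC. Qed.

Section Prism.
Variables (A X : Type) (M : zmodType) (a b : A -> X).

(** The prism operator, transposed to cochains: the alternating sum over i of the tuples
    [a w0, ..., a wi, b wi, ..., b wk]. *)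
Fixpoint prism (f : seq X -> M) (s : seq A) : M :=
  if s is w :: t then
    f (a w :: b w :: map b t) - prism (fun u => f (a w :: u)) t
  else 0.

Lemma prismB f g s :
  prism (fun t => f t - g t) s = prism f s - prism g s.
Proof.
elim: s f g => [|w s IH] f g /=; first by rewrite subr0.
by rewrite IH subrACA'.
Qed.

Lemma prism_sdiff f s :
  prism (sdiff f) s + sdiff (prism f) s = f (map b s) - f (map a s).
Proof.
elim: s f => [|w s IH] f; first by rewrite /= addr0 subrr.
have := IH (fun t => f (a w :: t)).
rewrite /= prismB sdiffB.
have -> : sdiff (fun t => f [:: a w, b w & map b t]) s =
          sdiff (fun u => f [:: a w, b w & u]) (map b s).
  by rewrite -(sdiff_map b (fun u => f [:: a w, b w & u])).
set p1 := prism _ s; set d1 := sdiff _ s => /(canRL (addrK _)) ->.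
rewrite 3!opprB [_ + (_ - prism f s)]addrA subrKA -!addrA addKr addKr.
by rewrite [X in _ + X]addrCA subrr addr0.
Qed.

Lemma chain_prism (P : X -> Prop) s :
  allp (fun w => P (a w) /\ P (b w)) s ->
  is_chain (fun t => allp P t /\ (size t <= (size s).+1)%N) (prism^~ s).
Proof.
elim: s => [|w s IH] /=; first by move=> _; exact: chain0.
move=> [[Pa Pb] Ps].
apply: (@chainB _ _ _ (fun f => f [:: a w, b w & map b s])
  (fun f => prism (fun u => f (a w :: u)) s)).
  apply: chain_tuple; rewrite /= size_map; split=> //; split=> //; split=> //.
  by elim: s Ps {IH} => //= x s IH [[? ?] /IH].
apply: (@chain_bind _ _ _ _ _ (fun f u => f (a w :: u)) (fun f => prism f s) _ (IH Ps)).
by move=> t [Pt ts]; apply: chain_tuple.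
Qed.

End Prism.

Section Subdivision.
Variables (R : realType) (O : Type) (M : zmodType).
Local Notation X := (O -> R).
Implicit Types (f g : seq X -> M) (s t : seq X) (C : X -> Prop).

Definition barycenter s : X := fun i => (\sum_(x <- s) x i) / (size s)%:R.

(** Convexity in the only form used by subdivision: stability under averages of finite lists. *)
Definition baryclosed C : Prop :=
  forall s, s <> [::] -> allp C s -> C (barycenter s).

Lemma baryclosedI C1 C2 : baryclosed C1 -> baryclosed C2 ->
  baryclosed (fun x => C1 x /\ C2 x).
Proof.
by move=> b1 b2 s s0 Cs; split; [apply: b1|apply: b2] => //;
  apply: allp_impl Cs => x [].
Qed.

(** Barycentric subdivision, transposed to cochains: the cone from the barycenter over the
    subdivided boundary. The recursion passes to faces, which are not subterms, so the size [n]
    serves as fuel. *)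
Fixpoint sdn n f s : M :=
  if n is m.+1 then sdiff (sdn m (fun t => f (barycenter s :: t))) s else f s.

Definition sd f s : M := sdn (size s) f s.

(* The chain homotopy between subdivision and the identity. *)
Fixpoint sdhn n f s : M :=
  if n is m.+1 then
    f (barycenter s :: s) - sdiff (sdhn m (fun t => f (barycenter s :: t))) s
  else 0.

Definition sdh f s : M := sdhn (size s) f s.

Lemma sd_nil f : sd f [::] = f [::]. Proof. by []. Qed.

Lemma sd_cons f x u (s := x :: u) :
  sd f s = sdiff (sd (fun t => f (barycenter s :: t))) s.
Proof.
by apply: eq_sdiff => t /size_face [ts]; rewrite /sd ts.
Qed.

Lemma sdh_nil f : sdh f [::] = 0. Proof. by []. Qed.

Lemma sdh_cons f x u (s := x :: u) :
  sdh f s = f (barycenter s :: s) -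
            sdiff (sdh (fun t => f (barycenter s :: t))) s.
Proof.
by congr (_ - _); apply: eq_sdiff => t /size_face [ts]; rewrite /sdh ts.
Qed.

Lemma size_ind (P : seq X -> Prop) : P [::] ->
  (forall x u, (forall t, (size t <= size u)%N -> P t) -> P (x :: u)) ->
  forall s, P s.
Proof.
move=> P0 PS s; have [n sn] := ubnP (size s); elim: n s sn => // n IH [//|x u] /= un.
by apply: PS => t tu; apply: IH; apply: leq_ltn_trans tu _.
Qed.

Lemma face_le x u t : face_of t (x :: u) -> (size t <= size u)%N.
Proof. by move=> /size_face [->]. Qed.

Lemma sdB f g s : sd (fun t => f t - g t) s = sd f s - sd g s.
Proof.
elim/size_ind: s f g => [//|x u IH] f g; rewrite !sd_cons -sdiffB.
by apply: eq_sdiff => t /face_le tu; rewrite IH.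
Qed.

Lemma sdhB f g s : sdh (fun t => f t - g t) s = sdh f s - sdh g s.
Proof.
elim/size_ind: s f g => [|x u IH] f g; first by rewrite !sdh_nil subr0.
rewrite !sdh_cons subrACA' -sdiffB; congr (_ - _).
by apply: eq_sdiff => t /face_le tu; rewrite IH.
Qed.

(** The boundary of a cone is its base minus the cone over the boundary of the base. Here the base
    is the subdivided boundary, a cycle by the induction hypothesis and [sdiff_sdiff]. *)
Lemma sd_sdiff f s : sd (sdiff f) s = sdiff (sd f) s.
Proof.
elim/size_ind: s f => [//|x u IH] f; rewrite sd_cons /=.
set b := barycenter _.
have E t : face_of t (x :: u) ->
    sd (fun v => f v - sdiff (fun w => f (b :: w)) v) t =
    sd f t - sdiff (sd (fun w => f (b :: w))) t.
  by move=> /face_le tu; rewrite sdB IH.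
have := eq_sdiff E; rewrite sdiffB sdiff_sdiff subr0; exact.
Qed.

Lemma sdh_sdiff f s : sdh (sdiff f) s + sdiff (sdh f) s = f s - sd f s.
Proof.
elim/size_ind: s f => [|x u IH] f; first by rewrite sdh_nil addr0 sd_nil subrr.
rewrite sdh_cons sd_cons; set s := x :: u; set b := barycenter _.
have E t : face_of t s ->
    sdh (fun v => f v - sdiff (fun w => f (b :: w)) v) t =
    sdh f t - (f (b :: t) - sd (fun w => f (b :: w)) t -
               sdiff (sdh (fun w => f (b :: w))) t).
  by move=> /face_le tu; rewrite sdhB -IH// addrK.
have := eq_sdiff E; rewrite !sdiffB sdiff_sdiff subr0 => E'.
rewrite [sdiff (sdh (fun t => sdiff f (b :: t))) s]E'.
rewrite -[sdiff f (b :: s)]/(f s - sdiff (fun t => f (b :: t)) s).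
by rewrite opprB -addrA subrK subrKA.
Qed.

Lemma chain_cons (P Q : seq X -> Prop) (b : X) (z : (seq X -> M) -> M) :
  is_chain P z -> (forall t, P t -> Q (b :: t)) ->
  is_chain Q (fun f => z (fun t => f (b :: t))).
Proof.
move=> cz PQ; apply: (@chain_bind _ _ _ _ _ (fun f t => f (b :: t)) z _ cz).
by move=> t Pt; apply: chain_tuple; exact: PQ.
Qed.

Lemma chain_sd C s : baryclosed C -> allp C s ->
  is_chain (allp C) (sd^~ s).
Proof.
move=> bC; elim/size_ind: s => [_|x u IH Cs]; first exact: chain_tuple.
have -> : sd^~ (x :: u) =
    (fun f => sdiff (sd (fun t => f (barycenter (x :: u) :: t))) (x :: u)).
  by apply/funext => f; rewrite sd_cons.
apply: (@chain_bind_sdiff _ _ _ _ (fun f => sd (fun t => f (barycenter (x :: u) :: t)))).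
move=> t ts; apply: (@chain_cons (allp C) _ _ (sd^~ t)).
  by apply: IH; [exact: face_le ts|exact: face_of_sub ts Cs].
by move=> v Cv; split=> //; apply: bC.
Qed.

Lemma chain_sdh C s : baryclosed C -> allp C s ->
  is_chain (allp C) (sdh^~ s).
Proof.
move=> bC; elim/size_ind: s => [_|x u IH Cs]; first exact: chain0.
have Cb : C (barycenter (x :: u)) by exact: bC.
have -> : sdh^~ (x :: u) = (fun f => f (barycenter (x :: u) :: x :: u) -
    sdiff (sdh (fun t => f (barycenter (x :: u) :: t))) (x :: u)).
  by apply/funext => f; rewrite sdh_cons.
apply: (@chainB _ _ _ (fun f => f _)); first exact: chain_tuple.
apply: (@chain_bind_sdiff _ _ _ _ (fun f => sdh (fun t => f (barycenter (x :: u) :: t)))).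
move=> t ts; apply: (@chain_cons (allp C) _ _ (sdh^~ t)).
  by apply: IH; [exact: face_le ts|exact: face_of_sub ts Cs].
by move=> v Cv; split.
Qed.

Definition dist_le (d : R) (x y : X) : Prop := forall i, `|x i - y i| <= d.

Definition narrow (d : R) t : Prop := allp (fun x => allp (dist_le d x) t) t.

Definition hull s (x : X) : Prop := forall C, baryclosed C -> allp C s -> C x.

Lemma hull_baryclosed s : baryclosed (hull s).
Proof.
move=> t t0 ht C bC Cs; apply: (bC) => //.
by apply: allp_impl ht => x; apply.
Qed.

Lemma barycenter_close s (y : X) (d : R) : 0 <= d -> s <> [::] ->
  allp (dist_le d y) s -> dist_le d y (barycenter s).
Proof.
move=> d0 s0 ys i; rewrite /barycenter.
have sp : 0 < (size s)%:R :> R by rewrite ltr0n; case: (s) s0.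
have -> : y i - (\sum_(x <- s) x i) / (size s)%:R =
    (\sum_(x <- s) (y i - x i)) / (size s)%:R.
  rewrite sumrB big_const_seq count_predT iter_addr_0 mulrBl -[y i *+ _]mulr_natr.
  by rewrite mulfK// gt_eqF.
rewrite normrM normfV (gtr0_norm sp) ler_pdivrMr//.
apply: le_trans (ler_norm_sum _ _ _) _.
rewrite mulr_natr -[leRHS]iter_addr_0 -[in leRHS](count_predT s) -big_const_seq.
by rewrite big_seq [leRHS]big_seq; apply: ler_sum => x xs; move/allpP: ys => /(_ x xs).
Qed.

Lemma close_baryclosed (d : R) (y : X) : 0 <= d -> baryclosed (dist_le d y).
Proof. by move=> d0 s s0 ys; exact: barycenter_close. Qed.

(** The point [y] is one of those averaged and contributes nothing to the difference, so only
    [(size s).-1] of the [size s] terms count. *)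
Lemma barycenter_contract s (y : X) (d : R) : 0 <= d -> y \in s ->
  narrow d s -> dist_le ((size s).-1%:R / (size s)%:R * d) y (barycenter s).
Proof.
move=> d0 ys /allpP /(_ y ys) /allpP yd i; rewrite /barycenter.
have sp : 0 < (size s)%:R :> R by rewrite ltr0n; case: (s) ys.
have -> : y i - (\sum_(x <- s) x i) / (size s)%:R =
    (\sum_(x <- s) (y i - x i)) / (size s)%:R.
  rewrite sumrB big_const_seq count_predT iter_addr_0 mulrBl -[y i *+ _]mulr_natr.
  by rewrite mulfK// gt_eqF.
rewrite normrM normfV (gtr0_norm sp) mulrAC ler_pM2r ?invr_gt0//.
rewrite (big_rem y)//= subrr add0r.
apply: le_trans (ler_norm_sum _ _ _) _.
rewrite mulr_natl -(size_rem ys) -[leRHS]iter_addr_0 -[in leRHS](count_predT (rem y s)).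
rewrite -big_const_seq big_seq [leRHS]big_seq; apply: ler_sum => x /mem_rem xs.
exact: yd.
Qed.

(** The classical mesh estimate. The barycenter is within the reduced distance of all of [s], hence
    of its hull, and the other entries come from subdividing a face. The ratio of
    [barycenter_contract] grows with the size, which is at most [N.+1]. *)
Lemma chain_sd_narrow (N : nat) s (d : R) : 0 <= d -> (size s <= N.+1)%N ->
  narrow d s ->
  is_chain (fun t => [/\ allp (hull s) t, narrow (N%:R / N.+1%:R * d) t &
                         size t = size s]) (sd^~ s).
Proof.
move=> d0; set r := N%:R / N.+1%:R.
have rd0 : 0 <= r * d by rewrite mulr_ge0// divr_ge0.
elim/size_ind: s => [_ _|x u IH sN ns]; first exact: chain_tuple.
set s := x :: u; set b := barycenter s.
have bC : allp (dist_le (r * d) b) s.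
  apply/allpP => y ys i; rewrite distrC.
  apply: le_trans (barycenter_contract d0 ys ns i) _.
  apply: ler_wpM2r => //; rewrite /r ler_pdivrMr ?ltr0n// mulrAC ler_pdivlMr ?ltr0n//.
  rewrite -!natrM ler_nat /=.
  by rewrite !mulnS mulnC addnC [leqRHS]addnC leq_add2l.
have -> : sd^~ s = (fun f => sdiff (sd (fun t => f (b :: t))) s).
  by apply/funext => f; rewrite sd_cons.
apply: (@chain_bind_sdiff _ _ _ _ (fun f => sd (fun t => f (b :: t)))).
move=> t ts; apply: (@chain_cons
  (fun v => [/\ allp (hull t) v, narrow (r * d) v & size v = size t]) _ _ (sd^~ t)).
  apply: IH; first exact: face_le ts.
    by apply: leq_trans sN; exact: leq_trans (face_le ts) _.
  by apply: (face_of_sub ts); apply: allp_impl ns => y; exact: face_of_sub ts.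
move=> v [hv nv sv].
have hv' : allp (hull s) v.
  by apply: allp_impl hv => y hy C bCC Cs; apply: hy => //; exact: face_of_sub Cs.
have bv : allp (dist_le (r * d) b) v.
  by apply: allp_impl hv' => y; apply => //; exact: close_baryclosed.
split.
- by split=> //; apply: hull_baryclosed => //; apply/allpP => y ys C _ /allpP; apply.
- split; first by split=> // i; rewrite subrr normr0.
  apply/allpP => y yv; split.
    by move=> i; rewrite distrC; move/allpP: bv => /(_ y yv).
  by move/allpP: nv => /(_ y yv).
- by rewrite /= sv (size_face ts).
Qed.

Lemma chain_iter_sd (N m : nat) C s (d : R) : 0 <= d -> (size s <= N.+1)%N ->
  narrow d s -> baryclosed C -> allp C s ->
  is_chain (fun t => [/\ allp C t, narrow ((N%:R / N.+1%:R) ^+ m * d) t &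
                         size t = size s]) (iter m sd ^~ s).
Proof.
move=> d0 sN ns bC Cs; elim: m => [|m IH].
  by apply: chain_tuple; rewrite expr0 mul1r.
have -> : (iter m.+1 sd)^~ s = (fun f => iter m sd (sd f) s).
  by apply/funext => f; rewrite iterSr.
apply: (@chain_bind _ _ _ _ _ sd (iter m sd ^~ s) _ IH) => t [Ct nt st].
have c0 : 0 <= (N%:R / N.+1%:R : R) ^+ m * d.
  by rewrite mulr_ge0// exprn_ge0// divr_ge0.
have tN : (size t <= N.+1)%N by rewrite st.
apply: chain_sub (chain_sd_narrow c0 tN nt) => v [hv nv sv].
split; last by rewrite sv.
- by apply: allp_impl hv => y; apply.
- by rewrite exprS -mulrA.
Qed.

Lemma iter_sd_sdiff m f s : iter m sd (sdiff f) s = sdiff (iter m sd f) s.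
Proof.
elim: m f s => [//|m IH] f s.
by rewrite !iterSr -IH; congr (iter m sd _ s); apply/funext => t; rewrite sd_sdiff.
Qed.

Lemma chain_iter_sd_sub m C s : baryclosed C -> allp C s ->
  is_chain (allp C) (iter m sd ^~ s).
Proof.
move=> bC Cs; elim: m => [|m IH]; first exact: chain_tuple.
have -> : (iter m.+1 sd)^~ s = (fun f => iter m sd (sd f) s).
  by apply/funext => f; rewrite iterSr.
apply: (@chain_bind _ _ _ _ _ sd (iter m sd ^~ s) _ IH) => t Ct.
exact: chain_sd.
Qed.

(** The homotopies between consecutive subdivisions are added up; the term in which the boundary
    falls outside vanishes because [z] is a cycle. *)
Lemma iter_sd_homotopic (D : seq X -> Prop) m (z : (seq X -> M) -> M) :
  (forall s, D s -> is_chain D (sd^~ s)) ->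
  (forall s, D s -> is_chain D (sdh^~ s)) ->
  is_chain D z -> (forall f, z (sdiff f) = 0) ->
  exists2 b, is_chain D b &
    forall f, b (sdiff f) = z f - z (iter m sd f).
Proof.
move=> Dsd Dsdh cz zd; elim: m => [|m [b cb bE]].
  by exists (fun=> 0); [exact: chain0|move=> f; rewrite subrr].
have ci : is_chain D (fun f => z (iter m sd f)).
  elim: m {b cb bE} => [//|m IH].
  have -> : (fun f => z (iter m.+1 sd f)) = (fun f => z (iter m sd (sd f))).
    by apply/funext => f; rewrite iterSr.
  exact: (@chain_bind _ _ _ _ _ sd (fun f => z (iter m sd f)) Dsd IH).
exists (fun f => b f + z (iter m sd (sdh f))).
  apply: (@chainD _ _ _ b) => //.
  exact: (@chain_bind _ _ _ _ _ sdh (fun f => z (iter m sd f)) Dsdh ci).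
move=> f; rewrite bE iterSr.
have h : z (iter m sd (sdiff (sdh f))) = 0.
  have -> : iter m sd (sdiff (sdh f)) = sdiff (iter m sd (sdh f)).
    by apply/funext => s; rewrite iter_sd_sdiff.
  exact: zd.
have -> : z (iter m sd (sdh (sdiff f))) =
    z (iter m sd f) - z (iter m sd (sd f)).
  have := chain_D (sdh (sdiff f)) (sdiff (sdh f)) ci.
  rewrite h addr0 => <-; rewrite -(chain_B f (sd f) ci).
  by congr (z (iter m sd _)); apply/funext => s; rewrite sdh_sdiff.
by rewrite addrA subrK.
Qed.

End Subdivision.

(** * Contractible simplicial complexes are acyclic *)

Lemma within_continuous_nbhs (T U : topologicalType) (A : set T) (f : T -> U)
    (x : T) (B : set U) :
  {within A, continuous f} -> A x -> nbhs (f x) B ->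
  nbhs x [set y | A y -> B (f y)].
Proof. by move=> /subspace_continuousP cf Ax /(cf x Ax). Qed.

Lemma seq_argmax (R : realType) (A : eqType) (f : A -> R) (s : seq A) :
  s <> [::] -> exists2 x, x \in s & forall y, y \in s -> f y <= f x.
Proof.
elim: s => // x [|y s] IH _.
  by exists x; rewrite ?inE// => y; rewrite inE => /eqP ->.
have [//|z zs zP] := IH _.
have [xz|zx] := leP (f x) (f z).
  exists z; first by rewrite inE zs orbT.
  by move=> w; rewrite inE => /orP[/eqP ->//|/zP].
exists x; first by rewrite inE eqxx.
by move=> w; rewrite inE => /orP[/eqP ->//|/zP /le_trans]; apply; exact: ltW.
Qed.

(** Ordered simplices, degenerate ones included; the empty tuple generates degree -1 of the
    augmented complex. *)
Definition ftuple (W : choiceType) (K : scomplex W) (s : seq W) : Prop :=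
  s = [::] \/ K [fset x in s]%fset.

Lemma fset_sum_le (R : realType) (W : choiceType) (f : W -> R) (A B : {fset W}) :
  (forall w, 0 <= f w) -> (A `<=` B)%fset ->
  \sum_(w <- A) f w <= \sum_(w <- B) f w.
Proof.
move=> f0 AB; rewrite [leRHS](big_fsetID _ (mem A))/=.
have -> : [fset x in B | x \in A]%fset = A.
  apply/fsetP => x; rewrite !inE/=.
  case: (boolP (x \in A)) => xA; rewrite ?andbF// andbT; exact: (fsubsetP AB).
by rewrite lerDl sumr_ge0.
Qed.

Section Ftuple.
Variables (W : choiceType) (K : scomplex W).

Lemma ftuple_sub s t : ftuple K t -> {subset s <= t} -> ftuple K s.
Proof.
move=> Kt st; have [->|s0] := eqVneq s [::]; first by left.
right; case: Kt => [t0|Kt].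
  by case: s st s0 => // x s /(_ x); rewrite inE eqxx t0 => /(_ isT).
apply: (face_sub Kt).
  by apply/fsubsetP => x; rewrite !inE; exact: st.
case: s s0 {st} => // x s _; apply/fset0Pn; exists x.
by rewrite !inE eqxx.
Qed.

Lemma ftuple_face s t : ftuple K t -> face_of s t -> ftuple K s.
Proof.
move=> Kt st; apply: ftuple_sub Kt _ => x xs.
have /allpP : allp (fun y => y \in t) s by apply: face_of_sub st _; apply/allpP.
exact.
Qed.

Lemma ftuple_in (A : {fset W}) s : K A -> {subset s <= A} -> ftuple K s.
Proof.
move=> KA sA; have [->|s0] := eqVneq s [::]; first by left.
right; apply: (face_sub KA); first by apply/fsubsetP => x; rewrite !inE; exact: sA.
case: s s0 {sA} => // x s _; apply/fset0Pn; exists x.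
by rewrite !inE eqxx.
Qed.

End Ftuple.

(** * Neighbourhoods of faces and cylinders over faces *)

Section Realization.
Variables (R : realType) (W : choiceType) (K : scomplex W).
Local Notation E := (realization R K).

Lemma realization_ext (x y : E) : (forall w, x w = y w) -> x = y.
Proof.
case: x y => [f Pf] [g Pg] /= /funext fg; rewrite fg in Pf *.
by congr RPoint; exact: Prop_irrelevance.
Qed.

(* For [#|A| = k], a point with mass more than k/(k+1) on A has its largest
   coordinate in A. *)
Definition mostly_in (A : {fset W}) : set E :=
  [set x | (#|` A|)%:R / (#|` A|).+1%:R < \sum_(w <- A) x w].

Lemma open_mostly_in A : open (mostly_in A).
Proof.
change (weak_open (mostly_in A)); move=> s Ks x; rewrite /mostly_in /=.
set c := _ / _; move=> cx xs.
(* The slack is divided by one more than the size of [A], so that the total loss stays strictly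
   below it, also for an empty [A]. *)
exists ((\sum_(w <- A) x w - c) / (#|` A|).+1%:R).
  by rewrite divr_gt0// subr_gt0.
set e := _ / _ => y ys xy.
have e0 : 0 < e by rewrite divr_gt0// subr_gt0.
have h : \sum_(w <- A) x w - \sum_(w <- A) y w <= \sum_(w <- A) e.
  rewrite -sumrB; apply: ler_sum => w _.
  have [ws|ws] := boolP (w \in s).
    by apply: le_trans (ler_norm _) _; apply/ltW; exact: xy.
  by rewrite (xs _ ws) (ys _ ws) subrr ltW.
have : \sum_(w <- A) e < \sum_(w <- A) x w - c.
  rewrite big_const_seq count_predT iter_addr_0 -mulr_natr mulrC.
  rewrite /e mulrCA gtr_pMr ?subr_gt0// ltr_pdivrMr// mul1r ltr_nat.
  exact: ltnSn.
by move: h; set S := \sum_(w <- A) y w; lra.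
Qed.

Lemma realization_sum1 (A : {fset W}) (x : E) : carried x A ->
  \sum_(w <- A) x w = 1.
Proof.
have [B KB [x0 xB <-]] := baryP x => xA.
rewrite (@big_fset_incl _ _ _ _ A (A `|` B)%fset) ?fsubsetUl//; last first.
  by move=> w _ /xA.
rewrite [RHS](@big_fset_incl _ _ _ _ B (A `|` B)%fset) ?fsubsetUr//.
by move=> w _ /xB.
Qed.

Lemma realization_sum_le1 (A : {fset W}) (x : E) : \sum_(w <- A) x w <= 1.
Proof.
have [B KB [x0 xB x1]] := baryP x.
rewrite -(@realization_sum1 (A `|` B)%fset x); last first.
  by move=> w; rewrite inE negb_or => /andP[_ /xB].
exact: fset_sum_le (fsubsetUl _ _).
Qed.

(** If a largest coordinate were outside [A], the mass of [A] would be at most k times it, while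
    both together are at most 1; so that mass would be at most k/(k+1). *)
Lemma mostly_in_argmax A (x : E) v :
  mostly_in A x -> (forall w, x w <= x v) -> v \in A.
Proof.
move=> xA xv; apply/negPn/negP => vA.
have sAv : \sum_(w <- A) x w + x v <= 1.
  have := realization_sum_le1 (v |` A)%fset x.
  by rewrite big_fsetU1//= addrC.
have sA : \sum_(w <- A) x w <= (#|` A|)%:R * x v.
  rewrite mulr_natl -iter_addr_0 -[in leRHS](count_predT (enum_fset A)).
  by rewrite -big_const_seq; exact: ler_sum.
move: xA; rewrite /mostly_in /= ltr_pdivrMr ?ltr0n// -natr1.
set k := (_%:R : R) in sA *; have : k * (\sum_(w <- A) x w + x v) <= k * 1 by exact: ler_wpM2l.
by lra.
Qed.

Lemma carried_argmax A (x : E) v :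
  carried x A -> (forall w, x w <= x v) -> v \in A.
Proof.
move=> xA xv; apply/negPn/negP => vA.
have := realization_sum1 xA; rewrite big1_seq => [|w /= _].
  by move/eqP; rewrite eq_sym oner_eq0.
apply/eqP; rewrite eq_le; have [B KB [-> _ _]] := baryP x.
by rewrite andbT -(xA _ vA).
Qed.

Lemma carried_mostly_in A (x : E) : carried x A -> mostly_in A x.
Proof.
by move=> /realization_sum1 xA; rewrite /mostly_in /= xA ltr_pdivrMr// mul1r ltr_nat ltnSn.
Qed.

Lemma realization_carrier (x : E) : exists2 A, K A & carried x A.
Proof. by have [A KA [_ xA _]] := baryP x; exists A. Qed.

Lemma exists_argmax (x : E) : exists v, forall w, x w <= x v.
Proof.
have [A KA [x0 xA _]] := baryP x.
have A0 : enum_fset A <> [::].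
  by move=> A0; have /fset0Pn[w] := face_neq0 KA; rewrite -[w \in A]/(w \in enum_fset A) A0.
have [v vA vx] := seq_argmax (bary x) A0; exists v => w.
by have [/vx//|/xA ->] := boolP (w \in A).
Qed.

(* Points of the cylinder over a face, with [None] as time coordinate. *)
Definition cyl (A : {fset W}) (x : option W -> R) : Prop :=
  [/\ 0 <= x None <= 1, forall w, 0 <= x (Some w),
      forall w, w \notin A -> x (Some w) = 0
    & \sum_(w <- A) x (Some w) = 1].

Lemma cyl_realization A x : K A -> cyl A x ->
  exists r : E, forall w, r w = x (Some w).
Proof.
move=> KA [_ x0 xA x1].
have P : exists2 s, K s & [/\ forall v, 0 <= x (Some v),
    forall v, v \notin s -> x (Some v) = 0 & \sum_(v <- s) x (Some v) = 1].
  by exists A.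
by exists (RPoint P).
Qed.

Lemma cyl_baryclosed A : baryclosed (cyl A).
Proof.
move=> s s0 /allpP sC.
have sp : 0 < (size s)%:R :> R by rewrite ltr0n; case: (s) s0.
have [h1 h2 h3 h4] : [/\ forall x, x \in s -> 0 <= x None <= 1,
    forall x, x \in s -> forall w, 0 <= x (Some w),
    forall x, x \in s -> forall w, w \notin A -> x (Some w) = 0 &
    forall x, x \in s -> \sum_(w <- A) x (Some w) = 1].
  by split=> x /sC[].
have sumc (c : R) : \sum_(x <- s) c = c * (size s)%:R.
  by rewrite big_const_seq count_predT iter_addr_0 mulr_natr.
rewrite /cyl /barycenter; split.
- rewrite divr_ge0//=; last by rewrite big_seq sumr_ge0// => x /h1 /andP[].
  rewrite ler_pdivrMr// -sumc big_seq [leRHS]big_seq; apply: ler_sum => x.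
  by move=> /h1 /andP[].
- by move=> w; rewrite divr_ge0// big_seq sumr_ge0// => x /h2.
- by move=> w wA; rewrite big_seq big1 ?mul0r// => x /h3 ->.
- rewrite -mulr_suml exchange_big /= big_seq.
  under eq_bigr do rewrite h4//.
  by rewrite -big_seq sumc mul1r divff// gt_eqF.
Qed.

End Realization.

(** * Simplicial approximation of a contraction *)

Section Contraction.
Variables (R : realType) (W : choiceType) (K : scomplex W).
Local Notation E := (realization R K).
Variables (x0 : E) (H : E * R -> E).
Hypothesis H_continuous : {within [set: E] `*` `[0, 1], continuous H}.
Variable vtx : E -> W.
Hypothesis vtxP : forall (x : E) w, x w <= x (vtx x).

Definition cyl_point (x : option W -> R) : E :=
  xget x0 [set r : E | forall w, r w = x (Some w)].

Lemma cyl_pointE A x : K A -> cyl A x -> forall w, cyl_point x w = x (Some w).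
Proof.
move=> KA Ax; have [r rE] := cyl_realization KA Ax.
by rewrite /cyl_point; case: xgetP => [y -> //|/(_ r)[]].
Qed.

Lemma cyl_point_carried A x : K A -> cyl A x -> carried (cyl_point x) A.
Proof. by move=> KA Ax w wA; rewrite (cyl_pointE KA Ax); case: Ax => _ _ ->. Qed.

(** A simplicial approximation of the contraction: a vertex at which the image of the point has its
    largest coordinate. *)
Definition nu (x : option W -> R) : W := vtx (H (cyl_point x, x None)).

(** [B] is a face carrying the image of [x]. By continuity, points near [x] are sent into the open
    set [mostly_in B], where the largest coordinate belongs to [B]. *)
Lemma nu_local A (x : option W -> R) : K A -> cyl A x -> exists2 e : R, 0 < e &
  exists2 B, K B & forall y : option W -> R, cyl A y -> dist_le e x y -> nu y \in B.
Proof.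
move=> KA Ax; have [B KB HB] := realization_carrier (H (cyl_point x, x None)).
have xI : ([set: E] `*` `[0, 1]) (cyl_point x, x None).
  by split=> //=; rewrite in_itv /=; case: Ax.
have oB : nbhs (H (cyl_point x, x None)) (mostly_in B).
  by apply: open_nbhs_nbhs; split; [exact: open_mostly_in|exact: carried_mostly_in].
have := within_continuous_nbhs H_continuous xI oB.
move=> [[U V] /= [Ux Vx] UV].
move: Ux; rewrite nbhsE => -[U' [oU' U'x] U'U].
have [e1 e10 h1] := (oU' : weak_open U') A KA _ U'x (cyl_point_carried KA Ax).
move: Vx => /nbhs_ballP[e2 /= e20 h2].
have m0 : 0 < Num.min e1 e2 by rewrite lt_min e10.
exists (Num.min e1 e2 / 2); first by rewrite divr_gt0.
have lt_e : Num.min e1 e2 / 2 < Num.min e1 e2 by rewrite ltr_pdivrMr// mulr_natr mulr2n ltrDl.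
exists B => // y Ay xy; apply: mostly_in_argmax (vtxP _).
apply: (UV (cyl_point y, y None)) => /=.
  split=> /=.
    apply: U'U; apply: h1; first exact: cyl_point_carried.
    move=> v vA; rewrite (cyl_pointE KA Ax) (cyl_pointE KA Ay).
    apply: le_lt_trans (xy _) _; apply: lt_le_trans lt_e _.
    by rewrite ge_min lexx.
  apply: h2; apply: le_lt_trans (xy _) _; apply: lt_le_trans lt_e _.
  by rewrite ge_min lexx orbT.
by split=> //; rewrite /= in_itv /=; case: Ay.
Qed.

(** A Lebesgue number, from the compactness of the cylinder and [nu_local]. *)
Lemma nu_lebesgue A : K A -> exists2 d : R, 0 < d &
  forall t, allp (cyl A) t -> narrow d t -> ftuple K (map nu t).
Proof.
move=> KA; have /fset0Pn[w0 w0A] := face_neq0 KA.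
pose n := #|` A|.
(* Matrix coordinates for the cylinder: the barycentric coordinates in the order of [A], then the
   time in the last place. *)
pose par (a : 'rV[R]_n.+1) (o : option W) : R :=
  if o is Some w then
    if w \in A then a ord0 (inord (index w A)) else 0
  else a ord0 ord_max.
pose vec (x : option W -> R) : 'rV[R]_n.+1 :=
  \row_i (if (i < n)%N then x (Some (nth w0 A i)) else x None).
have parK x : cyl A x -> par (vec x) = x.
  move=> [_ _ xA _]; apply/funext => -[w|] /=; last first.
    by rewrite mxE /= ltnn.
  case: ifPn => [wA|/xA ->//].
  have iA : (index w A < n)%N by rewrite index_mem.
  by rewrite mxE inordK ?ltnS ?(ltnW iA)// iA nth_index.
pose D : set 'rV[R]_n.+1 := [set a | cyl A (par a)].
have cD : compact D.
  pose D1 : set 'rV[R]_n.+1 := [set a | forall i, `[0, 1]%classic (a ord0 i)].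
  pose D2 : set 'rV[R]_n.+1 :=
    [set a | \sum_(w <- A) a ord0 (inord (index w A)) = 1].
  have -> : D = D1 `&` D2.
    have sumE a : \sum_(w <- A) par a (Some w) =
        \sum_(w <- A) a ord0 (inord (index w A)).
      by rewrite big_seq [RHS]big_seq; apply: eq_bigr => w /= ->.
    apply/seteqP; split=> a /=.
      move=> [a1 a2 a3 a4]; split; last by rewrite /D2 /= -sumE.
      move=> i; rewrite /= in_itv /=; have [ni|i_n] := leqP n i.
        have -> : i = ord_max by apply/val_inj/eqP; rewrite /= eqn_leq ni -ltnS ltn_ord.
        exact: a1.
      have nA : nth w0 A i \in A by rewrite mem_nth.
      have iE : a ord0 i = par a (Some (nth w0 A i)).
        by rewrite /= nA index_uniq ?fset_uniq// inord_val.
      rewrite iE a2 /= -a4; rewrite (big_fsetD1 (nth w0 A i))//= lerDl.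
      by rewrite sumr_ge0// => w _; exact: a2 w.
    move=> [ai a1]; split.
    - by have := ai ord_max; rewrite /= in_itv.
    - move=> w /=; case: ifP => // _.
      by have := ai (inord (index w A)); rewrite /= in_itv /= => /andP[].
    - by move=> w /negbTE /= ->.
    - by rewrite sumE.
  apply: (@compact_closedI _ D1 D2).
    by apply: (@rV_compact R _ (fun=> `[0, 1]%classic)) => i; exact: segment_compact.
  have cS : continuous (fun a : 'rV[R]_n.+1 => \sum_(w <- A) a ord0 (inord (index w A))).
    move=> a; apply: (@cvg_big R W +%R 0 xpredT (@add_continuous R) _ (nbhs a)
      (enum_fset A) (fun w (b : 'rV[R]_n.+1) => b ord0 (inord (index w A)))) => w _.
    exact: coord_continuous.
  apply: (@preimage_closed _ _ (fun a : 'rV[R]_n.+1 => \sum_(w <- A) a ord0 (inord (index w A)))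
    [set x | x = 1]); last exact: closed_eq.
  by move=> a _; exact: cS.
have /compact_near_coveringP cov := cD.
pose P (d : R) a := forall t, allp (cyl A) t -> allp (dist_le d (par a)) t ->
  ftuple K (map nu t).
have /cov : forall a, D a -> \forall a' \near a & d \near (0 : R)^'+, P d a'.
  move=> a Da; have [e e0 [B KB eB]] := nu_local KA Da.
  have e20 : 0 < e / 2 by rewrite divr_gt0.
  (* One half of [e] for the distance from [a] to [a'], the other for the distance from [a'] to the
     tuple. *)
  exists (ball a (e / 2), [set d | d <= e / 2]) => /=.
    by split; [exact: nbhsx_ballx|exact: nbhs_right_le].
  move=> [a' d] /= [[_ aa'] de] t tA ta'.
  apply: (ftuple_in KB) => w /mapP[x xt ->].
  move/allpP : tA => /(_ x xt) Ax; move/allpP : ta' => /(_ x xt) a'x.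
  apply: eB => // i.
  rewrite -[par a i](subrK (par a' i)) -addrA.
  apply: le_trans (ler_normD _ _) _; rewrite [leRHS]splitr lerD//; last first.
    exact: le_trans (a'x i) de.
  apply/ltW; case: i => [w'|] /=; last exact: aa'.
  by case: ifP => _; [exact: aa'|rewrite subrr normr0].
move=> covP.
have [d [dP d0]] : exists d, (forall a, D a -> P d a) /\ 0 < d.
  have h : \forall d \near (0 : R)^'+, D `<=` P d /\ 0 < d.
    by apply: filterI => //; exact: nbhs_right_gt.
  by case: (@filter_ex _ _ (at_right_proper_filter 0) _ h) => d [? ?]; exists d.
exists d => // -[|x t]; first by move=> _ _; left.
move=> At nt; apply: (dP (vec x)) => //; rewrite ?/D /= parK; by case: At nt => ? ? [].
Qed.

Hypothesis H0 : forall x, H (x, 0) = x.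
Hypothesis H1 : forall x, H (x, 1) = x0.
Variable M : zmodType.
Implicit Types (f : seq W -> M) (z : (seq W -> M) -> M).

Definition cyl_vertex (e : R) (w : W) (o : option W) : R :=
  if o is Some v then (v == w)%:R else e.

Lemma cyl_cyl_vertex A e w : w \in A -> 0 <= e <= 1 -> cyl A (cyl_vertex e w).
Proof.
move=> wA e01; split=> //= [v vA|].
  by case: eqP vA => // ->; rewrite wA.
rewrite (big_fsetD1 w)//= eqxx big_seq big1 ?addr0// => v.
by rewrite !inE => /andP[/negbTE ->].
Qed.

Lemma cyl_le1 A (x : option W -> R) i : cyl A x -> 0 <= x i <= 1.
Proof.
case=> x1 xp xA xs; case: i => // w; rewrite xp /=.
have [wA|/xA ->//] := boolP (w \in A).
by rewrite -xs (big_fsetD1 w)//= lerDl sumr_ge0.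
Qed.

Lemma cyl_narrow A (t : seq (option W -> R)) : allp (cyl A) t -> narrow 1 t.
Proof.
move=> /allpP At; apply/allpP => x /At Ax; apply/allpP => y /At Ay i.
have := cyl_le1 i Ax; have := cyl_le1 i Ay.
by move=> /andP[? ?] /andP[? ?]; rewrite ler_norml; apply/andP; split; lra.
Qed.

Lemma exists_exp_le (r d : R) : 0 <= r < 1 -> 0 < d ->
  exists m0, forall m, (m0 <= m)%N -> r ^+ m <= d.
Proof.
move=> /andP[r0 r1] d0; have /cvgrPdist_le /(_ d d0) : r ^+ n @[n --> \oo] --> 0.
  by apply: cvg_expr; rewrite ger0_norm.
move=> [m0 _ h]; exists m0 => m mm; have := h m mm.
by rewrite /= sub0r normrN ger0_norm ?exprn_ge0.
Qed.

(** Enough subdivisions bring the prism over a tuple below the Lebesgue number of its cylinder. A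
    chain involves finitely many tuples, so one [m0] serves for all. *)
Lemma chain_prism_nu z : is_chain (ftuple K) z ->
  exists m0, forall m, (m0 <= m)%N -> is_chain (ftuple K) (fun f =>
    z (prism (cyl_vertex 0) (cyl_vertex 1)
         (iter m (@sd R (option W) M) (fun t => f (map nu t))))).
Proof.
elim=> [|s [->|Ks]|z1 z2 _ [m1 h1] _ [m2 h2]].
- by exists 0%N => m _; exact: chain0.
- by exists 0%N => m _; exact: chain0.
- set A := [fset x in s]%fset in Ks.
  have [d d0 dP] := nu_lebesgue Ks.
  (* The prism over [s] has tuples of size at most [N.+1], whence the contraction ratio [r]. *)
  pose N := size s; pose r : R := N%:R / N.+1%:R.
  have r01 : 0 <= r < 1.
    by rewrite divr_ge0//= ltr_pdivrMr ?ltr0n// mul1r ltr_nat ltnSn.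
  have [m0 m0P] := exists_exp_le r01 d0; exists m0 => m mm.
  pose z1 := prism (M := M) (cyl_vertex 0) (cyl_vertex 1) ^~ s.
  have c1 := @chain_prism W _ M (cyl_vertex 0) (cyl_vertex 1) (cyl A) s.
  apply: (@chain_bind _ _ _ _ _
    (fun f => iter m (@sd R (option W) M) (fun t => f (map nu t))) z1 _ (c1 _)); last first.
    apply/allpP => w ws; have wA : w \in A by rewrite !inE.
    by split; apply: cyl_cyl_vertex; rewrite ?lexx ?ler01.
  move=> t [At ts].
  have c2 := chain_iter_sd M m ler01 ts (cyl_narrow At) (@cyl_baryclosed _ _ A) At.
  apply: (@chain_bind _ _ _ _ _ (fun f u => f (map nu u))
    (fun g => iter m (@sd R (option W) M) g t) _ c2).
  move=> u [Au nu_ _]; apply: chain_tuple; apply: dP => //.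
  rewrite mulr1 -/r in nu_; move/allpP: nu_ => nu_.
  apply/allpP => x /nu_ /allpP xu; apply/allpP => y /xu xy i.
  exact: le_trans (xy i) (m0P m mm).
- exists (maxn m1 m2) => m; rewrite geq_max => /andP[m1m m2m].
  exact: (@chainB _ _ _ _ _ (h1 _ m1m) (h2 _ m2m)).
Qed.

(** Three pieces fill [z]: [b2] joins it to its subdivision at time 0; the subdivided prism, pushed
    forward by [nu], joins this to time 1; there the contraction is constant, so [z1] consists of
    tuples constant at [w1], and the cone from [w1] fills it. *)
Lemma contraction_acyclic z : is_chain (ftuple K) z ->
  (forall f, z (sdiff f) = 0) ->
  exists2 b, is_chain (ftuple K) b & forall f, b (sdiff f) = z f.
Proof.
move=> cz zd; have [m /(_ m (leqnn m)) c1] := chain_prism_nu cz.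
pose SD := iter m (@sd R (option W) M).
pose p0 := cyl_vertex 0; pose p1 := cyl_vertex 1.
pose D (t : seq (option W -> R)) := exists2 A, K A & allp (cyl A) t.
have [A0 KA0 xA0] := realization_carrier x0.
have Dp e s : 0 <= e <= 1 -> ftuple K s -> D (map (cyl_vertex e) s).
  move=> e01 [->|Ks]; first by exists A0.
  exists [fset x in s]%fset => //; apply/allpP => _ /mapP[w ws ->].
  by apply: cyl_cyl_vertex; rewrite // !inE.
have cp e (b : (seq W -> M) -> M) : 0 <= e <= 1 -> is_chain (ftuple K) b ->
    is_chain D (fun g => b (fun s => g (map (cyl_vertex e) s))).
  move=> e01 cb.
  apply: (@chain_bind _ _ _ _ _ (fun g s => g (map (cyl_vertex e) s)) b _ cb).
  by move=> s Ks; apply: chain_tuple; exact: Dp.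
have Dsd s : D s -> is_chain D ((@sd R (option W) M)^~ s).
  move=> [A KA As]; apply: chain_sub (chain_sd M (@cyl_baryclosed _ _ A) As) => t At.
  by exists A.
have Dsdh s : D s -> is_chain D ((@sdh R (option W) M)^~ s).
  move=> [A KA As]; apply: chain_sub (chain_sdh M (@cyl_baryclosed _ _ A) As) => t At.
  by exists A.
pose z0 (g : seq (option W -> R) -> M) := z (fun s => g (map p0 s)).
have cz0 : is_chain D z0 by apply: cp => //; rewrite lexx ler01.
have z0d g : z0 (sdiff g) = 0.
  rewrite /z0 -[RHS](zd (fun s => g (map p0 s))); congr z.
  by apply/funext => s; rewrite sdiff_map.
have [b2 cb2 b2E] := iter_sd_homotopic m Dsd Dsdh cz0 z0d.
pose v0 (x : option W -> R) := vtx (cyl_point x).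
have cb2' : is_chain (ftuple K) (fun f => b2 (fun t => f (map v0 t))).
  apply: (@chain_bind _ _ _ _ _ (fun f t => f (map v0 t)) b2 _ cb2) => t [A KA At].
  apply: chain_tuple; apply: (ftuple_in KA) => _ /mapP[x xt ->].
  apply: carried_argmax (vtxP _).
  by move/allpP : At => /(_ x xt) Ax; exact: cyl_point_carried.
pose w1 := vtx x0.
pose z1 (f : seq W -> M) := z (fun s => SD (fun t => f (map (fun=> w1) t)) (map p1 s)).
have cz1 : is_chain (fun t => allp (eq w1) t) z1.
  have c := cp 1 z (introT andP (conj ler01 (lexx 1))) cz.
  apply: (@chain_bind _ _ _ _ _ (fun f => SD (fun t => f (map (fun=> w1) t)))
    (fun g => z (fun s => g (map p1 s))) _ c) => t [A KA At].
  have c' := chain_iter_sd_sub M m (@cyl_baryclosed _ _ A) At.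
  apply: (@chain_bind _ _ _ _ _ (fun f u => f (map (fun=> w1) u)) (SD^~ t) _ c') => u _.
  by apply: chain_tuple; elim: u.
have z1d f : z1 (sdiff f) = 0.
  rewrite /z1 -[RHS](zd (fun s => SD (fun t => f (map (fun=> w1) t)) (map p1 s))).
  congr z; apply/funext => s; rewrite (sdiff_map p1 (SD _)) -iter_sd_sdiff.
  congr (SD _ _); apply/funext => t.
  by rewrite sdiff_map.
have Kw1 : K [fset w1]%fset.
  by apply: (face_sub KA0); rewrite ?fsub1set ?(carried_argmax xA0 (vtxP _))//;
    apply/fset0Pn; exists w1; rewrite inE.
(* Averages of points at time [e] are at time [e], so maps to vertices need to agree only there. *)
have SD_ext (e : R) (f : seq W -> M) (v1 v2 : (option W -> R) -> W) : 0 <= e <= 1 ->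
    (forall x, x None = e -> v1 x = v2 x) ->
    z (fun s => SD (fun t => f (map v1 t)) (map (cyl_vertex e) s)) =
    z (fun s => SD (fun t => f (map v2 t)) (map (cyl_vertex e) s)).
  move=> e01 v12; apply: (chain_ext cz) => s [->|Ks].
    by rewrite /SD; elim: (m) => //= m' IH; rewrite !sd_nil.
  pose C (x : option W -> R) := cyl [fset w in s]%fset x /\ x None = e.
  have bC : baryclosed C.
    apply: baryclosedI; first exact: cyl_baryclosed.
    move=> t t0 /allpP te; rewrite /barycenter big_seq.
    under eq_bigr do rewrite te//.
    rewrite -big_seq big_const_seq count_predT iter_addr_0 -[e *+ _]mulr_natr mulfK//.
    by rewrite pnatr_eq0; case: (t) t0.
  have Cs : allp C (map (cyl_vertex e) s).
    apply/allpP => _ /mapP[w ws ->]; split=> //.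
    by apply: cyl_cyl_vertex; rewrite // !inE.
  apply: (chain_ext (chain_iter_sd_sub M m bC Cs)) => t Ct; congr f.
  by elim: t Ct => //= x t IH [[_ /v12 ->] /IH ->].
have zp1 f : z (fun s => SD (fun t => f (map nu t)) (map p1 s)) = z1 f.
  apply: SD_ext; first by rewrite ler01 lexx.
  by move=> x x1; rewrite /nu x1 H1.
have zp0 f : z (fun s => SD (fun t => f (map nu t)) (map p0 s)) =
             z0 (SD (fun t => f (map v0 t))).
  apply: SD_ext; first by rewrite ler01 lexx.
  by move=> x xe; rewrite /nu xe H0.
exists (fun f => z1 (fun t => f (w1 :: t)) -
   z (prism p0 p1 (SD (fun t => f (map nu t)))) + b2 (fun t => f (map v0 t))).
  apply: (@chainD _ _ _ (fun f => z1 (fun t => f (w1 :: t)) -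
    z (prism p0 p1 (SD (fun t => f (map nu t)))))) => //.
  apply: (@chainB _ _ _ (fun f => z1 (fun t => f (w1 :: t)))) => //.
  apply: (@chain_bind _ _ _ _ _ (fun f t => f (w1 :: t)) z1 _ cz1) => t w1t.
  apply: chain_tuple; apply: (ftuple_in Kw1) => w; rewrite !inE => /orP[//|wt].
  by move/allpP : w1t => /(_ w wt) ->.
move=> f.
have -> : z1 (fun t => sdiff f (w1 :: t)) = z1 f.
  have := chain_B f (sdiff (fun t => f (w1 :: t))) cz1.
  by rewrite z1d subr0.
have -> : z (prism p0 p1 (SD (fun t => sdiff f (map nu t)))) =
    z1 f - z0 (SD (fun t => f (map v0 t))).
  pose F := SD (fun t => f (map nu t)).
  rewrite -zp1 -zp0 -(chain_B _ _ cz) -[RHS]subr0 -(zd (prism p0 p1 F)).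
  rewrite -(chain_B _ _ cz); congr z; apply/funext => s.
  rewrite -prism_sdiff addrK; congr (prism _ _ _ s); apply/funext => t.
  rewrite -iter_sd_sdiff; congr (SD _ t); apply/funext => u.
  by rewrite sdiff_map.
have -> : b2 (fun t => sdiff f (map v0 t)) = z f - z0 (SD (fun t => f (map v0 t))).
  rewrite (_ : (fun t => sdiff f (map v0 t)) = sdiff (fun t => f (map v0 t))).
    rewrite b2E; congr (_ - _); rewrite /z0; apply: (chain_ext cz) => s [->//|Ks].
    (* The point of a vertex is carried by the singleton of that vertex, so [v0] returns the vertex
       itself. *)
    congr f; rewrite -map_comp -[RHS]map_id; apply/eq_in_map => w ws /=.
    have wK : K [fset w]%fset.
      by apply: (face_sub Ks); rewrite ?fsub1set ?inE//; apply/fset0Pn; exists w; rewrite inE.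
    have ww : cyl [fset w]%fset (cyl_vertex 0 w).
      by apply: cyl_cyl_vertex; rewrite ?inE// lexx ler01.
    have := carried_argmax (cyl_point_carried wK ww) (vtxP _).
    by rewrite inE => /eqP.
  by apply/funext => u; rewrite sdiff_map.
by rewrite opprB [z1 f + _]addrCA subrr addr0 addrC subrK.
Qed.

End Contraction.

Lemma contractible_acyclic (R : realType) (W : choiceType) (K : scomplex W)
    (M : zmodType) (z : (seq W -> M) -> M) :
  contractible_space R (realization R K) -> is_chain (ftuple K) z ->
  (forall f, z (sdiff f) = 0) ->
  exists2 b : (seq W -> M) -> M, is_chain (ftuple K) b &
    forall f, b (sdiff f) = z f.
Proof.
move=> [x0 [H [Hc H01]]]; have /choice[vtx vtxP] := @exists_argmax R W K.
by apply: (@contraction_acyclic R W K x0 H Hc vtx vtxP) => x; case: (H01 x).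
Qed.

(** * Lifting through covering maps *)

Lemma nbhs_preimage (T U : topologicalType) (f : T -> U) (x : T) (O : set U) :
  {for x, continuous f} -> open O -> O (f x) -> nbhs x (f @^-1` O).
Proof. by move=> cf oO Ofx; apply: cf; exact: open_nbhs_nbhs. Qed.

Lemma nbhsI (T : topologicalType) (x : T) (C D : set T) :
  nbhs x C -> nbhs x D -> nbhs x (C `&` D).
Proof. exact: filterI. Qed.

Lemma nbhsS (T : topologicalType) (x : T) (C D : set T) :
  nbhs x C -> C `<=` D -> nbhs x D.
Proof. by move=> Cx CD; exact: filterS Cx. Qed.

Lemma pair_continuous (T U U' : topologicalType) (f : T -> U) (g : T -> U') x :
  {for x, continuous f} -> {for x, continuous g} ->
  {for x, continuous (fun y => (f y, g y))}.
Proof.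
move=> cf cg O [[C D] /= [Cf Dg] CD].
have := nbhsI (cf _ Cf) (cg _ Dg).
by move=> /nbhsS; apply => y /= [Cy Dy]; exact: (CD (f y, g y)).
Qed.

(** Paths and homotopies are continuous only within the unit interval; precomposing with [clamp 1]
    makes them continuous everywhere and leaves their values on the interval unchanged. *)
Definition clamp (R : realType) (T t : R) : R := Num.max 0 (Num.min t T).

Section Clamp.
Variable R : realType.
Implicit Types t T : R.

Lemma clamp_itv T t : 0 <= T -> 0 <= clamp T t <= T.
Proof. by move=> T0; rewrite /clamp le_max lexx /= ge_max T0 ge_min lexx orbT. Qed.

Lemma clamp_id T t : 0 <= t <= T -> clamp T t = t.
Proof. by move=> /andP[t0 tT]; rewrite /clamp min_l// max_r. Qed.

Lemma clamp_continuous T : continuous (clamp T : R -> R).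
Proof.
move=> t; apply: (@continuous_max R R (fun=> 0) (fun t => Num.min t T)).
  exact: cvg_cst.
by apply: (@continuous_min R R id (fun=> T)); [exact: cvg_id|exact: cvg_cst].
Qed.

Lemma within_clamp_continuous (X U : topologicalType) (f : X * R -> U) :
  {within [set: X] `*` `[0, 1], continuous f} ->
  continuous (fun z : X * R => f (z.1, clamp 1 z.2)).
Proof.
move=> cf [x t] O /= Of.
have xI : ([set: X] `*` `[0, 1]) (x, clamp 1 t).
  by split=> //=; rewrite in_itv /= clamp_itv.
have [[A B] /= [Ax Bt] AB] := within_continuous_nbhs cf xI Of.
exists (A, clamp 1 @^-1` B) => /=.
  by split=> //; exact: (@clamp_continuous 1 t _ Bt).
move=> [y s] /= [Ay Bs]; apply: (AB (y, clamp 1 s)) => //.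
by split=> //=; rewrite in_itv /= clamp_itv.
Qed.

Lemma within_clamp_continuous1 (U : topologicalType) (f : R -> U) :
  {within `[0, 1], continuous f} -> continuous (fun t => f (clamp 1 t)).
Proof.
move=> cf t O /= Of.
have tI : `[0, 1]%classic (clamp 1 t) by rewrite /= in_itv /= clamp_itv.
have := @clamp_continuous 1 t _ (within_continuous_nbhs cf tI Of).
move=> h; apply: (@filterS _ (nbhs t) _ _ _ _ h) => s; apply.
by rewrite /= in_itv /= clamp_itv.
Qed.

End Clamp.

Section Lifting.
Variables (R : realType) (E B : topologicalType) (p : E -> B).
Hypothesis p_covering : covering_map p.

Lemma covering_separated (e e' : E) : p e = p e' -> e <> e' ->
  exists S S' : set E, [/\ open S, open S', S e, S' e' & S `&` S' = set0].
Proof.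
move=> pe ee'; have [_ /(_ (p e))[U [sheets [[oU Ue] sh dis pU]]]] := p_covering.
have : (p @^-1` U) e by [].
rewrite pU => -[S shS Se].
have : (p @^-1` U) e' by rewrite /= -pe.
rewrite pU => -[S' shS' Se'].
exists S, S'; have [oS [s [_ _ sS]]] := sh _ shS; have [oS' _] := sh _ shS'.
split=> //; apply/eqP/negPn/negP => /set0P SS'.
have SE := dis _ _ shS shS' SS'; apply: ee'.
have [_ <-] := sS e Se; rewrite pe.
by have [_] : U (p e') /\ s (p e') = e' by apply: sS; rewrite SE.
Qed.

Lemma covering_locally_injective (e : E) :
  exists S : set E, [/\ open S, S e & forall x y, S x -> S y -> p x = p y -> x = y].
Proof.
have [_ /(_ (p e))[U [sheets [[oU Ue] sh dis pU]]]] := p_covering.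
have : (p @^-1` U) e by [].
rewrite pU => -[S shS Se]; have [oS [s [_ _ sS]]] := sh _ shS.
by exists S; split=> // x y /sS[_ sx] /sS[_ sy] pxy; rewrite -sx -sy pxy.
Qed.

(** The set where the lifts agree is open, as [p] is locally injective, and closed, as distinct
    points of a fibre have disjoint neighbourhoods; the line is connected. *)
Lemma lift_unique (a b : R -> E) t0 : continuous a -> continuous b ->
  (forall t, p (a t) = p (b t)) -> a t0 = b t0 -> forall t, a t = b t.
Proof.
move=> ca cb pab ab0 t.
pose C : set R := [set t | a t = b t].
have oC : open C.
  rewrite openE => u Cu; have [S [oS Su injS]] := covering_locally_injective (a u).
  have Sbu : S (b u) by rewrite -(Cu : a u = b u).
  have := nbhsI (nbhs_preimage (ca u) oS Su) (nbhs_preimage (cb u) oS Sbu).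
  by move=> /nbhsS; apply => v /= [Sa Sb]; exact: injS.
have cC : closed C.
  rewrite -[C]setCK; apply: open_closedC; rewrite openE => u Cu.
  have [S [S' [oS oS' Su Su' SS']]] := covering_separated (pab u) Cu.
  have := nbhsI (nbhs_preimage (ca u) oS Su) (nbhs_preimage (cb u) oS' Su').
  move=> /nbhsS; apply => v /= [Sa Sb] Cv.
  suff : (S `&` S') (a v) by rewrite SS'.
  by split=> //; rewrite (Cv : a v = b v).
have cT : connected [set: R] by apply/connected_intervalP => x y _ _ z _.
suff CT : C = [set: R] by have : C t by rewrite CT.
by apply: cT; [exists t0|exists C => //; rewrite setTI|exists C => //; rewrite setTI].
Qed.

Lemma lift_unique_space (f g : E -> E) x0 :
  path_connected_space R E -> continuous f -> continuous g ->
  p \o f = p \o g -> f x0 = g x0 -> f = g.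
Proof.
move=> [_ pc] cf cg pfg fg0; apply/funext => x.
have [c [cc c0 c1]] := pc x0 x.
have cc' := within_clamp_continuous1 cc.
have -> : x = c (clamp 1 1) by rewrite clamp_id ?lexx ?ler01.
apply: (@lift_unique (f \o (c \o clamp 1)) (g \o (c \o clamp 1)) 0) => //.
- by move=> t; apply: continuous_comp; [exact: cc'|exact: cf].
- by move=> t; apply: continuous_comp; [exact: cc'|exact: cg].
- by move=> t; exact: (congr1 (fun h => h (c (clamp 1 t))) pfg).
- by rewrite /= clamp_id ?lexx ?ler01// c0.
Qed.

(** * Lifting homotopies that start at a constant map *)

Section Homotopy.
Variables (X : topologicalType) (e0 : E) (gam : X * R -> B).
Hypothesis gam_continuous : continuous gam.
Hypothesis gam0 : forall x, gam (x, 0) = p e0.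

(** Clamping the time makes a lift up to time [T] a map on the whole line, so continuity can be
    asked at every point over [V]. *)
Definition local_lift (T : R) (V : set X) (l : X * R -> E) : Prop :=
  [/\ open V, forall y t, V y -> {for (y, t), continuous l},
      forall y t, V y -> p (l (y, t)) = gam (y, clamp T t)
    & forall y, V y -> l (y, 0) = e0].

Definition liftable (x : X) (T : R) : Prop :=
  exists V l, V x /\ local_lift T V l.

Lemma liftable0 x : liftable x 0.
Proof.
exists setT, (fun=> e0); split=> //; split=> // [|y t _|y t _].
- exact: openT.
- exact: cvg_cst.
- by rewrite (_ : clamp 0 t = 0) ?gam0//; apply/eqP; rewrite eq_le andbC clamp_itv.
Qed.

(** [d] is such that all times within [d] of [T0], over a neighbourhood of [x], land in one evenly
    covered set. The lift is continued there by the section of the sheet occupied at time [T]. *)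
Lemma liftable_extend x T0 : 0 <= T0 -> exists2 d : R, 0 < d &
  forall T T1, 0 <= T -> T0 - d < T -> T <= T1 -> T1 < T0 + d ->
    liftable x T -> liftable x T1.
Proof.
move=> T00; have [_ /(_ (gam (x, T0)))[U [sheets [[oU Ux] sh dis pU]]]] := p_covering.
have [[A I] /= [Ax IT] AI] := nbhs_preimage (@gam_continuous (x, T0)) oU Ux.
move: Ax; rewrite nbhsE => -[V' [oV' V'x] V'A].
move: IT => /nbhs_ballP[d /= d0 dI].
have gamU y t : V' y -> T0 - d < t < T0 + d -> U (gam (y, t)).
  move=> /V'A Ay td; apply: (AI (y, t)); split => //=; apply: dI.
  by rewrite /ball /= ltr_distlC.
exists d => // T T1 T0' dT TT1 T1d [V [l [Vx [oV cl pl l0]]]].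
have cT : clamp T T = T by rewrite clamp_id// T0' lexx.
have : (p @^-1` U) (l (x, T)).
  rewrite /= pl// cT; apply: gamU => //; rewrite dT; exact: le_lt_trans TT1 T1d.
rewrite pU => -[S shS Sx]; have [oS [s [cs Ss sS]]] := sh _ shS.
(* The points over which the lift at time [T] lies in the same sheet as over [x]. *)
pose V1 := [set y | [/\ V y, V' y & S (l (y, T))]].
pose g (z : X * R) : E := s (gam (z.1, Num.max T (Num.min z.2 T1))).
pose l1 (z : X * R) : E := if z.2 <= T then l z else g z.
have Tm t : T <= Num.max T (Num.min t T1) <= T1.
  by rewrite le_max lexx /= ge_max TT1 ge_min lexx orbT.
have Um y t : V' y -> U (gam (y, Num.max T (Num.min t T1))).
  move=> V'y; have /andP[h1 h2] := Tm t; apply: gamU => //.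
  by rewrite (lt_le_trans dT h1) (le_lt_trans h2 T1d).
have gT y : V1 y -> g (y, T) = l (y, T).
  move=> [Vy V'y Sy]; rewrite /g /= min_l// maxxx.
  by have := pl y T Vy; rewrite cT => <-; have [] := sS _ Sy.
have oV1 : open V1.
  rewrite openE => y [Vy V'y Sy].
  have cy : {for y, continuous (fun y => l (y, T))}.
    apply: (@continuous_comp _ _ _ (fun y => (y, T)) l); last exact: cl.
    by apply: pair_continuous; [exact: cvg_id|exact: cvg_cst].
  have h := nbhsI (nbhsI (open_nbhs_nbhs (conj oV Vy)) (open_nbhs_nbhs (conj oV' V'y)))
    (nbhs_preimage cy oS Sy).
  by move/nbhsS: h; apply => z /= [[? ?] ?]; split.
have cg y t : V1 y -> {for (y, t), continuous g}.
  move=> [Vy V'y Sy]; pose k (z : X * R) : B := gam (z.1, Num.max T (Num.min z.2 T1)).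
  have ck : {for (y, t), continuous k}.
    apply: (@continuous_comp _ _ _ (fun z : X * R => (z.1, Num.max T (Num.min z.2 T1))) gam);
      last exact: gam_continuous.
    apply: pair_continuous; first exact: cvg_fst.
    apply: (@continuous_max R (X * R)%type (fun=> T) (fun z => Num.min z.2 T1));
      first exact: cvg_cst.
    by apply: (@continuous_min R (X * R)%type snd (fun=> T1)); [exact: cvg_snd|exact: cvg_cst].
  have Uk := Um y t V'y.
  move=> O sO; have sU := within_continuous_nbhs cs Uk sO.
  have := nbhsI (ck _ sU) (nbhs_preimage ck oU Uk).
  by move=> /nbhsS; apply => z /= [h1 h2]; exact: h1.
exists V1, l1; split; first by split.
split=> // [y t V1y|y t [Vy V'y Sy]|y [Vy V'y Sy]].
- have [Vy V'y Sy] := V1y.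
  have [tT|Tt|tT] := ltgtP t T.
  + have lt_nbhs : nbhs (y, t) [set z : X * R | z.2 < T].
      by apply: (@nbhs_preimage (X * R)%type R snd (y, t) [set u | u < T]) => //;
        first [exact: open_lt|exact: cvg_snd].
    move=> O; rewrite /l1 /= (ltW tT) => Ol.
    have := nbhsI (cl y t Vy _ Ol) lt_nbhs.
    by move=> /nbhsS; apply => z /= [h1 h2]; rewrite (ltW h2).
  + have lt_nbhs : nbhs (y, t) [set z : X * R | T < z.2].
      by apply: (@nbhs_preimage (X * R)%type R snd (y, t) [set u | T < u]) => //;
        first [exact: open_gt|exact: cvg_snd].
    move=> O; rewrite /l1 /= leNgt Tt /= => Ol.
    have := nbhsI (cg y t V1y _ Ol) lt_nbhs.
    by move=> /nbhsS; apply => z /= [h1 h2]; rewrite leNgt h2.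
  + move=> O; rewrite /l1 /= tT lexx => Ol.
    have Og : nbhs (g (y, T)) O by rewrite gT.
    have := nbhsI (cl y T Vy _ Ol) (cg y T V1y _ Og).
    by move=> /nbhsS; apply => z /= [h1 h2]; case: ifP.
- rewrite /l1 /=; have [tT|Tt] := leP t T.
    by rewrite pl// /clamp !min_l//; exact: le_trans TT1.
  rewrite /g /=; have [_ ->] := Ss _ (Um y t V'y); congr (gam (y, _)).
  have Tm' : T <= Num.min t T1 by rewrite le_min (ltW Tt).
  by rewrite /clamp !max_r//; exact: le_trans Tm'.
- by rewrite /l1 /= T0' l0.
Qed.

(** The supremum of the liftable times can be exceeded by [d / 2], unless 1 is reached before. *)
Lemma liftable1 x : liftable x 1.
Proof.
pose A := [set T | 0 <= T <= 1 /\ liftable x T].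
have A0 : A 0 by split; [rewrite lexx ler01|exact: liftable0].
have supA : has_sup A.
  by split; [exists 0|exists 1 => T [/andP[]]].
have T00 : 0 <= sup A by apply: ub_le_sup => //; case: supA.
have T01 : sup A <= 1 by apply: ge_sup; [exists 0|move=> T [/andP[]]].
have [d d0 ext] := liftable_extend x T00.
have [T [/andP[T0 T1] lT] TA] := sup_adherent d0 supA.
pose T' := Num.min 1 (sup A + d / 2).
have dd : d / 2 < d by rewrite ltr_pdivrMr// mulr_natr mulr2n ltrDl.
have d2 : 0 < d / 2 by rewrite divr_gt0.
have TT' : T <= T'.
  rewrite le_min T1 /=; apply: (@le_trans _ _ (sup A)); last by rewrite lerDl ltW.
  by apply: ub_le_sup; [case: supA|split=> //; rewrite T0].
have lT' : liftable x T'.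
  apply: (ext T) => //; apply: (@le_lt_trans _ _ (sup A + d / 2)).
    by rewrite ge_min lexx orbT.
  by rewrite ltrD2l.
have T'A : T' <= sup A.
  apply: ub_le_sup; first by case: supA.
  by split=> //; rewrite (le_trans T0 TT') ge_min lexx.
have [T'1|T'1] := leP 1 (sup A + d / 2).
  by have -> : 1 = T' by rewrite /T' min_l.
by move: T'A; rewrite /T' min_r ?(ltW T'1)// gerDl leNgt d2.
Qed.

(** Every point uses the local lift chosen for it. Uniqueness of lifts in the time variable makes
    the local lifts agree on overlaps, which gives continuity. *)
Lemma homotopy_lift : exists l : X * R -> E, [/\ continuous l,
  forall x t, p (l (x, t)) = gam (x, clamp 1 t) & forall x, l (x, 0) = e0].
Proof.
have /choice[V /choice[l lP]] := liftable1.
have agree x y t : V x y -> l y (y, t) = l x (y, t).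
  move=> xy; have [Vx [_ cx px lx0]] := lP x; have [Vy [_ cy py ly0]] := lP y.
  have cc (x' : X) : (forall t, {for (y, t), continuous (l x')}) ->
      continuous (fun t => l x' (y, t)).
    move=> h s; apply: (@continuous_comp _ _ _ (fun s => (y, s)) (l x')); last exact: h.
    by apply: pair_continuous; [exact: cvg_cst|exact: cvg_id].
  apply: (@lift_unique (fun t => l y (y, t)) (fun t => l x (y, t)) 0).
  - by apply: cc => s; exact: cy.
  - by apply: cc => s; exact: cx.
  - by move=> s; rewrite px// py.
  - by rewrite lx0// ly0.
exists (fun z => l z.1 z); split=> [[x t]|x t|x].
- have [Vx [oV cx _ _]] := lP x; move=> O /= Ol.
  have Vn : nbhs (x, t) [set z : X * R | V x z.1].
    by apply: (@nbhs_preimage (X * R)%type X fst (x, t) (V x)) => //; exact: cvg_fst.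
  have := nbhsI (cx x t Vx _ Ol) Vn.
  by move=> /nbhsS; apply => -[y s] /= [h1 h2]; rewrite (agree x).
- by have [Vx [_ _ h _]] := lP x; rewrite h.
- by have [Vx [_ _ _ h]] := lP x; rewrite h.
Qed.

End Homotopy.

(** * Deck transformations of a contractible covering space *)

Section Deck.
Hypothesis E_connected : path_connected_space R E.
Hypothesis E_contractible : contractible_space R E.

(** The contraction does the work of the lifting criterion. The path from [w] to its centre is
    projected and lifted from [w'], ending at some [x0']; the contraction run backwards is projected
    and lifted from [x0'], and [h] is its end. Over [w] this retraces the first lift, back to
    [w']. *)
Lemma lift_through (w w' : E) : p w = p w' ->
  exists h : E -> E, [/\ continuous h, p \o h = p & h w = w'].
Proof.
move=> pw; have [x0 [H [/within_clamp_continuous Hc H01]]] := E_contractible.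
have cp : continuous p by case: p_covering.
pose H1 (z : E * R) := H (z.1, clamp 1 z.2).
have cl0 : clamp 1 0 = 0 :> R by rewrite clamp_id// lexx ler01.
have cl1 : clamp 1 1 = 1 :> R by rewrite clamp_id// lexx ler01.
(* A single path is lifted; the first variable is a dummy. *)
have [|x|b [cb pb b0]] := @homotopy_lift E w' (fun z => p (H1 (w, z.2))).
- move=> z; apply: continuous_comp; last exact: cp.
  apply: (@continuous_comp _ _ _ (fun z : E * R => (w, z.2)) H1); last exact: Hc.
  by apply: pair_continuous; [exact: cvg_cst|exact: cvg_snd].
- by rewrite /H1 /= cl0 (H01 w).1.
pose x0' := b (w, 1).
have px0' : p x0' = p x0 by rewrite pb /H1 /= !cl1 (H01 w).2.
have [|x|l [cl pl l0]] := @homotopy_lift E x0' (fun z => p (H1 (z.1, 1 - z.2))).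
- move=> z; apply: continuous_comp; last exact: cp.
  apply: (@continuous_comp _ _ _ (fun z : E * R => (z.1, 1 - z.2)) H1); last exact: Hc.
  apply: pair_continuous; first exact: cvg_fst.
  by apply: cvgB; [exact: cvg_cst|exact: cvg_snd].
- by rewrite /H1 /= subr0 cl1 (H01 x).2.
exists (fun x => l (x, 1)); split.
- move=> x; apply: (@continuous_comp _ _ _ (fun x : E => (x, 1 : R)) l); last exact: cl.
  by apply: pair_continuous; [exact: cvg_id|exact: cvg_cst].
- by apply/funext => x; rewrite /= pl /H1 /= cl1 subrr cl0 (H01 x).1.
have -> : w' = b (w, 1 - clamp 1 1) by rewrite cl1 subrr b0.
rewrite -{1}cl1.
apply: (@lift_unique (fun t => l (w, clamp 1 t)) (fun t => b (w, 1 - clamp 1 t)) 0).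
- move=> t; apply: (@continuous_comp _ _ _ (fun t => (w, clamp 1 t)) l); last exact: cl.
  by apply: pair_continuous; [exact: cvg_cst|exact: clamp_continuous].
- move=> t; apply: (@continuous_comp _ _ _ (fun t => (w, 1 - clamp 1 t)) b); last exact: cb.
  apply: pair_continuous; first exact: cvg_cst.
  by apply: cvgB; [exact: cvg_cst|exact: clamp_continuous].
- move=> t; rewrite pl pb /H1 /=; have /andP[t0 t1] := clamp_itv t (@ler01 R).
  set u := clamp 1 t in t0 t1 *.
  have -> : clamp 1 u = u by rewrite clamp_id// t0.
  by have -> : clamp 1 (1 - u) = 1 - u; rewrite clamp_id// subr_ge0 t1 gerBl.
- by rewrite cl0 l0 subr0.
Qed.

(** The lifts taking [w] to [w'] and back compose to lifts of [p] with a fixed point, hence to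
    identities. *)
Lemma deck_transitive (w w' : E) : p w = p w' ->
  exists2 h, deck_transformation p h & h w = w'.
Proof.
move=> pw; have [h [ch ph hw]] := lift_through pw.
have [k [ck pk kw]] := lift_through (esym pw).
exists h => //; split=> //; exists k; split=> // x.
  have kh : k \o h = id.
    apply: (lift_unique_space (x0 := w)) => //=; last by rewrite hw.
    - by move=> y; apply: continuous_comp; [exact: ch|exact: ck].
    - by move=> y; exact: cvg_id.
    - apply/funext => y; rewrite -[LHS]/((p \o k) (h y)) pk.
      exact: (congr1 (@^~ y) ph).
  exact: (congr1 (@^~ x) kh).
have hk : h \o k = id.
  apply: (lift_unique_space (x0 := w')) => //=; last by rewrite kw.
  - by move=> y; apply: continuous_comp; [exact: ck|exact: ch].
  - by move=> y; exact: cvg_id.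
  - apply/funext => y; rewrite -[LHS]/((p \o h) (k y)) ph.
    exact: (congr1 (@^~ y) pk).
exact: (congr1 (@^~ x) hk).
Qed.

Lemma deck_fixed_point h w : deck_transformation p h -> h w = w -> h = id.
Proof.
move=> [ch _ ph] hw.
by apply: (lift_unique_space (x0 := w)) => //; move=> y; exact: cvg_id.
Qed.

End Deck.

End Lifting.

(** * Simplicial consequences of the covering hypotheses *)

Lemma delta_eq (R : nzRingType) (A : eqType) (x y : A) :
  (x == x)%:R = (x == y)%:R :> R -> x = y.
Proof. by rewrite eqxx; case: eqP => // _ /eqP; rewrite oner_eq0. Qed.

Section VertexPoints.
Variables (R : realType) (W : choiceType) (K : scomplex W).

Lemma sum_delta (s : {fset W}) (P : pred W) (w : W) : w \in s ->
  \sum_(v <- s | P v) (v == w)%:R = (P w)%:R :> R.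
Proof.
move=> ws; rewrite big_mkcond (big_fsetD1 w)//= eqxx.
rewrite big_seq big1 ?addr0 => [|v]; first by case: (P w).
by rewrite !inE => /andP[/negbTE -> _]; case: (P v).
Qed.

Lemma edge_point (w u : W) (t : R) : K [fset w; u]%fset -> 0 <= t <= 1 ->
  exists x : realization R K,
    forall v, x v = (1 - t) * (v == w)%:R + t * (v == u)%:R.
Proof.
move=> Kwu /andP[t0 t1].
pose b (v : W) : R := (1 - t) * (v == w)%:R + t * (v == u)%:R.
have bP : exists2 s, K s & [/\ forall v, 0 <= b v, forall v, v \notin s -> b v = 0
    & \sum_(v <- s) b v = 1].
  exists [fset w; u]%fset => //; split.
  - by move=> v; rewrite addr_ge0// mulr_ge0// subr_ge0.
  - by move=> v; rewrite !inE negb_or /b => /andP[/negbTE -> /negbTE ->]; rewrite !mulr0 addr0.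
  - rewrite big_split /= -!mulr_sumr !(sum_delta xpredT) ?inE ?eqxx ?orbT//.
    by rewrite !mulr1 subrK.
by exists (RPoint bP).
Qed.

Lemma vertex_point (w : W) : K [fset w]%fset ->
  exists x : realization R K, forall v, x v = (v == w)%:R.
Proof.
move=> Kw; have [||x xE] := @edge_point w w 0; first by rewrite fsetUid.
  by rewrite lexx ler01.
by exists x => v; rewrite xE mul0r addr0 subr0 mul1r.
Qed.

Lemma face_vertex (s : {fset W}) w : K s -> w \in s -> K [fset w]%fset.
Proof.
by move=> Ks ws; apply: (face_sub Ks); rewrite ?fsub1set//; apply/fset0Pn; exists w; rewrite inE.
Qed.

Lemma face_edge (s : {fset W}) w u : K s -> w \in s -> u \in s -> K [fset w; u]%fset.
Proof.
move=> Ks ws us; apply: (face_sub Ks).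
  by apply/fsubsetP => v; rewrite !inE => /orP[] /eqP ->.
by apply/fset0Pn; exists w; rewrite !inE eqxx.
Qed.

End VertexPoints.

Section MapPoints.
Variables (R : realType) (W V : choiceType) (K : scomplex W) (L : scomplex V).
Variable f : smap K L.

Lemma realization_map_edge (x : realization R K) (w u : W) (t : R) :
  (forall v, x v = (1 - t) * (v == w)%:R + t * (v == u)%:R) ->
  forall v, realization_map R f x v =
    (1 - t) * (v == f w)%:R + t * (v == f u)%:R.
Proof.
move=> xE v /=.
rewrite (@pushE _ _ _ _ _ f [fset w; u]%fset); last first.
  by move=> y; rewrite xE !inE negb_or => /andP[/negbTE -> /negbTE ->]; rewrite !mulr0 addr0.
under eq_bigr do rewrite xE.
rewrite big_split /= -!mulr_sumr !(sum_delta R (fun y => f y == v)) ?inE ?eqxx ?orbT//.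
by rewrite !(eq_sym v).
Qed.

Lemma realization_map_vertex (x : realization R K) (w : W) :
  (forall v, x v = (v == w)%:R) ->
  forall v, realization_map R f x v = (v == f w)%:R.
Proof.
move=> xE v; rewrite (@realization_map_edge x w w 0) => [|y].
  by rewrite mul0r addr0 subr0 mul1r.
by rewrite xE mul0r addr0 subr0 mul1r.
Qed.

End MapPoints.

Section CoveringComplex.
Variables (R : realType) (G : groupType) (V W : choiceType).
Variables (Y : scomplex V) (Yt : scomplex W) (p : smap Yt Y) (act : G -> smap Yt Yt).
Hypothesis p_universal : universal_covering (realization_map R p) R.
Hypothesis E_contractible : contractible_space R (realization R Yt).
Hypothesis act_deck : deck_action R p act.
Local Notation vertex w := (Yt [fset w]%fset).

Let p_covering : covering_map (realization_map R p) := p_universal.1.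
Let E_connected : path_connected_space R (realization R Yt) := p_universal.2.1.

(** Near [w], points of the two edges at the same small parameter have the same image. Local
    injectivity of the covering makes them equal, and their coordinates at [u] then identify the far
    ends. *)
Lemma star_inj (w u u' : W) : Yt [fset w; u]%fset -> Yt [fset w; u']%fset ->
  p u = p u' -> u = u'.
Proof.
move=> Kwu Kwu' puu'.
have Kw : vertex w by apply: (face_vertex Kwu); rewrite !inE eqxx.
have [x xE] := vertex_point R Kw.
have [S [oS Sx injS]] := covering_locally_injective p_covering x.
have near u0 : Yt [fset w; u0]%fset -> exists2 e : R, 0 < e &
    forall t (y : realization R Yt), 0 <= t < e ->
    (forall v, y v = (1 - t) * (v == w)%:R + t * (v == u0)%:R) -> S y.
  move=> Kwu0; have [|e e0 he] := (oS : weak_open S) _ Kwu0 x Sx.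
    by move=> v; rewrite xE !inE negb_or => /andP[/negbTE -> _].
  exists e => // t y /andP[t0 te] yE; apply: he.
    by move=> v; rewrite yE !inE negb_or => /andP[/negbTE -> /negbTE ->]; rewrite !mulr0 addr0.
  move=> v _; rewrite xE yE mulrBl mul1r; apply: le_lt_trans te.
  have -> : (v == w)%:R - ((v == w)%:R - t * (v == w)%:R + t * (v == u0)%:R) =
      t * ((v == w)%:R - (v == u0)%:R) :> R by ring.
  rewrite normrM ger0_norm// ler_piMr//.
  by case: (v == w); case: (v == u0); rewrite ?subrr ?subr0 ?sub0r ?normrN ?normr0 ?normr1 ?ler01.
have [e e0 he] := near u Kwu; have [e' e'0 he'] := near u' Kwu'.
pose t := Num.min 1 (Num.min e e') / 2.
have m0 : 0 < Num.min 1 (Num.min e e') by rewrite !lt_min ltr01 e0.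
have t0 : 0 < t by rewrite divr_gt0.
have tm : t < Num.min 1 (Num.min e e') by rewrite ltr_pdivrMr// mulr_natr mulr2n ltrDl.
move: tm; rewrite !lt_min => /and3P[t1 te te'].
have t01 : 0 <= t <= 1 by rewrite !ltW.
have [y yE] := edge_point Kwu t01; have [y' y'E] := edge_point Kwu' t01.
have Sy : S y by apply: (he t) => //; rewrite ltW.
have Sy' : S y' by apply: (he' t) => //; rewrite ltW.
have : y = y'.
  apply: injS => //; apply: realization_ext => v.
  by rewrite (realization_map_edge p yE) (realization_map_edge p y'E) puu'.
move=> yy'; have := yE u; rewrite yy' y'E eqxx => /addrI.
rewrite mulr1; case: eqP => // _ /eqP.
by rewrite mulr0 eq_sym gt_eqF.
Qed.

Lemma act_vertex g w : vertex w -> vertex (act g w).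
Proof.
move=> /(smapP (act g)); congr (Yt _); apply/fsetP => v; rewrite inE.
apply/imfsetP/eqP => [[u /=]|->]; first by rewrite inE => /eqP ->.
by exists w; rewrite //= inE.
Qed.

Let rho g := realization_map R (act g).

Lemma rhoE g (x : realization R Yt) w : (forall v, x v = (v == w)%:R) ->
  forall v, rho g x v = (v == act g w)%:R.
Proof. exact: realization_map_vertex. Qed.

(** The hypotheses concern maps of realizations; evaluated at points of vertices they give the
    action laws, for genuine vertices only, as nothing is known on the rest of [W]. *)
Lemma actM g h w : vertex w -> act (g * h)%g w = act g (act h w).
Proof.
move=> Kw; have [x xE] := vertex_point R Kw.
have [_ rhoM _ _] := act_deck.
have e : rho (g * h)%g x = rho g (rho h x) := congr1 (@^~ x) (rhoM g h).
have h1 := rhoE (g * h)%g xE (act (g * h)%g w).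
have h2 := rhoE g (rhoE h xE) (act (g * h)%g w).
exact: delta_eq (etrans (esym h1) (etrans (congr1 (fun r => bary r _) e) h2)).
Qed.

(** An injective idempotent map is the identity. *)
Lemma rho1 : rho 1%g = id.
Proof.
have [rhoD rhoM _ _] := act_deck.
have [_ [h' [_ hh' _]] _] := rhoD 1%g.
apply/funext => x; have := congr1 (fun r => h' (r x)) (rhoM 1%g 1%g).
by rewrite mul1g /= !hh'.
Qed.

Lemma act1 w : vertex w -> act 1%g w = w.
Proof.
move=> Kw; have [x xE] := vertex_point R Kw.
have := rhoE 1%g xE w; rewrite rho1 /= xE => /delta_eq e.
by rewrite -e.
Qed.

Lemma p_act g w : vertex w -> p (act g w) = p w.
Proof.
move=> Kw; have [x xE] := vertex_point R Kw.
have [rhoD _ _ _] := act_deck; have [_ _ prho] := rhoD g.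
have e := congr1 (fun r => bary (r x) (p w)) prho.
have h1 := realization_map_vertex p (rhoE g xE) (p w).
have h2 := realization_map_vertex p xE (p w).
by rewrite (delta_eq (etrans (esym h2) (etrans (esym e) h1))).
Qed.

Lemma act_free g w : vertex w -> act g w = w -> g = 1%g.
Proof.
move=> Kw gw; have [x xE] := vertex_point R Kw.
have [rhoD _ rhoI _] := act_deck.
apply: rhoI; rewrite -/(rho g) -/(rho 1%g) rho1.
apply: (deck_fixed_point p_covering E_connected (w := x) (rhoD g)).
by apply: realization_ext => v; rewrite (rhoE g xE) gw xE.
Qed.

Lemma act_transitive w w' : vertex w -> vertex w' -> p w = p w' ->
  exists g, act g w = w'.
Proof.
move=> Kw Kw' pww'; have [x xE] := vertex_point R Kw.
have [x' x'E] := vertex_point R Kw'.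
have [_ _ _ rho_surj] := act_deck.
have [|h hD hx] := deck_transitive p_covering E_connected E_contractible (w := x) (w' := x').
  apply: realization_ext => v.
  by rewrite (realization_map_vertex p xE) (realization_map_vertex p x'E) pww'.
have [g hg] := rho_surj h hD; exists g.
have := rhoE g xE w'; rewrite /rho -hg hx x'E => /delta_eq e.
by rewrite -e.
Qed.

(** * Tuples spanning a face *)

Lemma ftuple_vertex s : ftuple Yt s -> forall w, w \in s -> vertex w.
Proof. by move=> [->//|Ks] w ws; apply: (face_vertex Ks); rewrite inE. Qed.

Lemma ftuple_edge s : ftuple Yt s ->
  forall w u, w \in s -> u \in s -> Yt [fset w; u]%fset.
Proof. by move=> [->//|Ks] w u ws us; apply: (face_edge Ks); rewrite inE. Qed.

Lemma ftuple_act g s : ftuple Yt s -> ftuple Yt (map (act g) s).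
Proof.
move=> [->|Ks]; first by left.
right; have := smapP (act g) Ks; congr (Yt _).
apply/fsetP => w; rewrite !inE; apply/imfsetP/mapP => [[v /=]|[v vs ->]].
  by rewrite !inE => vs ->; exists v.
by exists v; rewrite // !inE.
Qed.

Lemma map_actM g h s : ftuple Yt s -> map (act (g * h)%g) s = map (act g) (map (act h) s).
Proof.
move=> /ftuple_vertex Ks; rewrite -map_comp; apply/eq_in_map => w /Ks /=; exact: actM.
Qed.

Lemma map_act1 s : ftuple Yt s -> map (act 1%g) s = s.
Proof.
move=> /ftuple_vertex Ks; rewrite -[RHS]map_id; apply/eq_in_map => w /Ks; exact: act1.
Qed.

Lemma ftuple_unique w s s' : ftuple Yt (w :: s) -> ftuple Yt (w :: s') ->
  map p s = map p s' -> s = s'.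
Proof.
move=> Ks Ks' pss'; apply: (@eq_from_nth _ w).
  by rewrite -(size_map p) pss' size_map.
move=> i si; have si' : (i < size s')%N by rewrite -(size_map p) -pss' size_map.
apply: (@star_inj w).
- by apply: (ftuple_edge Ks); rewrite ?mem_head// inE mem_nth ?orbT.
- by apply: (ftuple_edge Ks'); rewrite ?mem_head// inE mem_nth ?orbT.
- by rewrite -!(nth_map w (p w))// pss'.
Qed.

(** A deck transformation moves the first vertex where it should go; by [star_inj] the other
    vertices have no choice. *)
Lemma ftuple_transitive s s' : ftuple Yt s -> ftuple Yt s' -> map p s = map p s' ->
  exists g, map (act g) s = s'.
Proof.
move=> Ks Ks'; case: s s' Ks Ks' => [|w s] [|w' s'] //= Ks Ks'.
  by exists 1%g.
move=> [pww' pss'].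
have Kw := ftuple_vertex Ks (mem_head _ _); have Kw' := ftuple_vertex Ks' (mem_head _ _).
have [g gw] := act_transitive Kw Kw' pww'; exists g; rewrite gw; congr (_ :: _).
apply: (@ftuple_unique w') => //; first by have := ftuple_act g Ks; rewrite /= gw.
rewrite -pss' -map_comp; apply/eq_in_map => v vs /=; apply: p_act.
by apply: (ftuple_vertex Ks); rewrite inE vs orbT.
Qed.

End CoveringComplex.

(** * Orientations and signs *)

Section Inversions.
Variable U : choiceType.
Implicit Types (s t u : seq U) (x y v : U).

Lemma index_rem s x y v : uniq s -> x != v -> y != v ->
  (index x (rem v s) < index y (rem v s))%N = (index x s < index y s)%N.
Proof.
elim: s => //= z s IH /andP[zs us] xv yv.
have [->|zv] := eqVneq z v.
  by rewrite ![v == _]eq_sym (negbTE xv) (negbTE yv).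
rewrite /=; case: (z == x); case: (z == y) => //.
by rewrite ltnS IH.
Qed.

Lemma rem_cat_notin v s t : v \notin s -> rem v (s ++ t) = s ++ rem v t.
Proof.
elim: s => //= x s IH; rewrite inE negb_or => /andP[vx /IH ->].
by rewrite eq_sym (negbTE vx).
Qed.

Lemma count_index s v : uniq s -> v \in s ->
  count (fun y => index y s < index v s)%N s = index v s.
Proof.
elim: s => //= z s IH /andP[zs us]; rewrite inE eqxx.
have [->|vz] := eqVneq v z.
  move=> _ /=; rewrite ?eqxx ?ltnn ?add0n; apply/eqP.
  by rewrite -leqn0 leqNgt -has_count; apply/hasPn => y _; rewrite -leqNgt.
move=> /= vs; rewrite add1n -[in RHS](IH us vs).
congr S; apply: eq_in_count => y ys; rewrite eq_sym.
by have [yz|_] := eqVneq y z; [move: zs; rewrite -yz ys|rewrite ltnS].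
Qed.

Lemma odd_sum (I : Type) (r : seq I) (F : I -> nat) :
  odd (\sum_(i <- r) F i) = \big[addb/false]_(i <- r) odd (F i).
Proof. exact: (big_morph odd oddD (erefl _)). Qed.

Lemma odd_inversions s t : odd (inversions s t) =
  \big[addb/false]_(x <- s) \big[addb/false]_(y <- s)
    ((index x s < index y s)%N && (index y t < index x t)%N).
Proof.
rewrite odd_sum; apply: eq_bigr => x _; rewrite odd_sum.
by apply: eq_bigr => y _; case: (_ && _).
Qed.

(** Each unordered pair is counted twice, and the diagonal contributes nothing. *)
Lemma big_addb_sym s (f : U -> U -> bool) :
  {in s &, forall x y, f x y = f y x} -> {in s, forall x, f x x = false} ->
  \big[addb/false]_(x <- s) \big[addb/false]_(y <- s) f x y = false.
Proof.
elim: s => [|z s IH] fC f0; first by rewrite big_nil.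
rewrite big_cons big_cons f0 ?mem_head//.
have -> : \big[addb/false]_(x <- s) \big[addb/false]_(y <- z :: s) f x y =
    \big[addb/false]_(x <- s) f z x (+)
    \big[addb/false]_(x <- s) \big[addb/false]_(y <- s) f x y.
  rewrite -big_split /=; rewrite big_seq [RHS]big_seq; apply: eq_bigr => x xs.
  by rewrite big_cons fC ?mem_head// inE xs orbT.
rewrite IH ?addbF ?addbb// => [x y xs ys|x xs].
  by apply: fC; rewrite inE ?xs ?ys orbT.
by apply: f0; rewrite inE xs orbT.
Qed.

Lemma addb_falseP (a b : bool) : a (+) b = false -> a = b.
Proof. by case: a; case: b. Qed.

Lemma index_ltnN s x y : x \in s -> y \in s -> x != y ->
  (index y s < index x s)%N = ~~ (index x s < index y s)%N.
Proof.
move=> xs ys xy; rewrite -leqNgt [RHS]leq_eqVlt; case: eqP => [e|//].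
by move: xy; rewrite -(nth_index x ys) e nth_index// eqxx.
Qed.

(** Multiplicativity of the sign. Summed over pairs of entries of [s], the three parities add up to
    a symmetric function of the pair, so the total is even. *)
Lemma odd_inversions_trans s t u : perm_eq s t -> perm_eq s u ->
  odd (inversions s u) = odd (inversions s t) (+) odd (inversions t u).
Proof.
move=> st su; rewrite !odd_inversions.
have -> : \big[addb/false]_(x <- t) \big[addb/false]_(y <- t)
    ((index x t < index y t)%N && (index y u < index x u)%N) =
  \big[addb/false]_(x <- s) \big[addb/false]_(y <- s)
    ((index x t < index y t)%N && (index y u < index x u)%N).
  rewrite -(perm_big _ st); apply: eq_bigr => x _.
  by rewrite -(perm_big _ st).
apply: addb_falseP; rewrite -!big_split /=.
rewrite (eq_bigr (fun x => \big[addb/false]_(y <- s)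
  (((index x s < index y s)%N && (index y u < index x u)%N) (+)
   (((index x s < index y s)%N && (index y t < index x t)%N) (+)
   ((index x t < index y t)%N && (index y u < index x u)%N))))); last first.
  by move=> x _; rewrite !big_split.
apply: big_addb_sym => [x y xs ys|x xs]; last by rewrite !ltnn.
have [->//|xy] := eqVneq x y.
have [xt yt] : x \in t /\ y \in t by rewrite -!(perm_mem st).
have [xu yu] : x \in u /\ y \in u by rewrite -!(perm_mem su).
rewrite (index_ltnN xs ys xy) (index_ltnN xt yt xy) (index_ltnN xu yu xy).
by case: (index x s < index y s)%N; case: (index x t < index y t)%N;
  case: (index x u < index y u)%N.
Qed.

(** A pair formed by [v] and [y] is inverted when [y] precedes [v] in exactly one of the two lists,
    and the position of [v] counts the entries before it. *)
Lemma odd_inversions_rem s t v : uniq s -> perm_eq s t -> v \in s ->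
  odd (inversions s t) = odd (inversions (rem v s) (rem v t)) (+)
                         (odd (index v s) (+) odd (index v t)).
Proof.
move=> us st vs; have ut : uniq t by rewrite -(perm_uniq st).
have vt : v \in t by rewrite -(perm_mem st).
have cnt (w : seq U) : uniq w -> perm_eq s w -> v \in w -> odd (index v w) =
    \big[addb/false]_(y <- rem v s) (index y w < index v w)%N.
  move=> uw sw vw; rewrite -{1}(count_index uw vw) -sum1_count big_mkcond odd_sum /=.
  rewrite -(perm_big _ sw) (perm_big _ (perm_to_rem vs)) big_cons ltnn /=.
  by apply: eq_bigr => y _; case: ifP.
rewrite (cnt s)// (cnt t)// -big_split !odd_inversions /=.
rewrite (perm_big _ (perm_to_rem vs)) big_cons /=.
have E x : \big[addb/false]_(y <- s)
      ((index x s < index y s)%N && (index y t < index x t)%N) =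
    ((index x s < index v s)%N && (index v t < index x t)%N) (+)
    \big[addb/false]_(y <- rem v s)
      ((index x s < index y s)%N && (index y t < index x t)%N).
  by rewrite (perm_big _ (perm_to_rem vs)) big_cons.
rewrite E ltnn /=.
under [X in _ (+) X = _]eq_bigr do rewrite E.
rewrite big_split /= addbCA addbA addbC; congr (_ (+) _).
  rewrite big_seq [RHS]big_seq; apply: eq_bigr => x; rewrite mem_rem_uniq// !inE => /andP[xv xs].
  rewrite big_seq [RHS]big_seq; apply: eq_bigr => y; rewrite mem_rem_uniq// !inE => /andP[yv ys].
  by rewrite !index_rem.
rewrite -big_split big_seq [RHS]big_seq; apply: eq_bigr => y.
rewrite mem_rem_uniq// !inE => /andP[yv ys] /=.
have yt : y \in t by rewrite -(perm_mem st).
rewrite (index_ltnN ys vs yv) (index_ltnN yt vt yv).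
by case: (index y s < index v s)%N; case: (index y t < index v t)%N.
Qed.

End Inversions.

Section SdiffFormulas.
Variables (U : choiceType) (N : zmodType).
Implicit Types (H : seq U -> N).

Lemma sdiff_rem (K : pzRingType) (H : seq U -> K) s : uniq s ->
  sdiff H s = \sum_(v <- s) (-1) ^+ index v s * H (rem v s).
Proof.
elim: s H => [|x s IH] H /=; first by rewrite big_nil.
move=> /andP[xs us]; rewrite big_cons !eqxx expr0 mul1r; congr (_ + _).
rewrite IH// -sumrN big_seq [RHS]big_seq; apply: eq_bigr => v vs.
have xv : x == v = false by apply/eqP => xv; rewrite xv vs in xs.
by rewrite xv exprS mulN1r mulNr.
Qed.

Lemma sdiff_cat H s t : (forall u, face_of u s -> H (u ++ t) = 0) ->
  sdiff H (s ++ t) =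
  if odd (size s) then - sdiff (fun u => H (s ++ u)) t
  else sdiff (fun u => H (s ++ u)) t.
Proof.
elim: s H => [//|x s IH] H Hs /=.
rewrite Hs; last by left.
rewrite IH => [|u us]; last by apply: (Hs (x :: u)); right.
by rewrite sub0r; case: (odd (size s)) => //=; rewrite opprK.
Qed.

(* The two faces of a tuple with exactly one repetition cancel; all its other
   faces still contain the repetition. *)
Lemma sdiff_repeated H s : ~~ uniq s -> (forall t, ~~ uniq t -> H t = 0) ->
  (forall (a b c : seq U) v, uniq (a ++ b ++ v :: c) ->
    H (a ++ b ++ v :: c) =
    if odd (size b) then - H (a ++ v :: b ++ c) else H (a ++ v :: b ++ c)) ->
  sdiff H s = 0.
Proof.
move=> us H0 Hc.
have [v [a [b [c sE]]]] : exists v a b c, s = a ++ v :: b ++ v :: c.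
  elim: s us => [//|x s IH] /=; rewrite negb_and negbK => /orP[xs|/IH].
    by have [b c] := splitPr xs; exists x, [::], b, c.
  by move=> [v [a [b [c ->]]]]; exists v, (x :: a), b, c.
have dup (a' b' c' : seq U) : ~~ uniq (a' ++ v :: b' ++ v :: c').
  by rewrite cat_uniq /= mem_cat inE eqxx orbT /= !andbF.
rewrite sE sdiff_cat => [|u _]; last by rewrite H0// dup.
have -> : sdiff (fun u => H (a ++ u)) (v :: b ++ v :: c) = 0; last by rewrite oppr0; case: ifP.
rewrite /= sdiff_cat => [|u _]; last by rewrite H0// dup.
have -> : sdiff (fun u => H (a ++ v :: b ++ u)) (v :: c) = H (a ++ v :: b ++ c).
  rewrite /= (@eq_sdiff _ _ _ (fun=> 0)); first by rewrite sdiff0 subr0.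
  by move=> u _; rewrite H0// dup.
have [u1|nu1] := boolP (uniq (a ++ b ++ v :: c)).
  by rewrite Hc//; case: ifP; rewrite ?subrr// opprK addNr.
rewrite (H0 _ nu1) (H0 (a ++ v :: b ++ c)) ?oppr0 ?if_same ?subr0//.
apply: contra nu1; congr is_true; apply: perm_uniq.
by rewrite perm_cat2l -cat_rcons -cat_cons perm_cat2r -perm_rcons perm_refl.
Qed.

End SdiffFormulas.

(** * Oriented cochains as alternating functions of tuples *)

Section Alternating.
Variables (R : realType) (U : choiceType) (Z : scomplex U) (o : orientation Z).
Hypothesis finZ : finite_set (faces Z).
Local Notation C := R[i].

Lemma finite_simplices l : finite_set [set s | Z s /\ #|` s| = l.+1].
Proof. by apply: sub_finite_set finZ => s []. Qed.

Lemma in_simplices l s : (s \in simplices Z l) = `[< Z s /\ #|` s| = l.+1 >].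
Proof.
rewrite in_fset_set; last exact: finite_simplices.
by apply/idP/asboolP => [/set_mem//|h]; apply/mem_set.
Qed.

Definition fval l (f : cochain R Z l) (s : {fset U}) : C :=
  if insub s is Some s' then f s' else 0.

Lemma fvalE l (f : cochain R Z l) (s : simplices Z l) : fval f (val s) = f s.
Proof. by rewrite /fval valK. Qed.

Lemma fval_out l (f : cochain R Z l) s : s \notin simplices Z l -> fval f s = 0.
Proof. by move=> s0; rewrite /fval insubN. Qed.

(** The sign compares the tuple with the chosen ordering of its face, so that the coboundary of
    [alt f] is given by [sdiff], whatever the orientations. Tuples that span no l-simplex get
    zero. *)
Definition alt l (f : cochain R Z l) (s : seq U) : C :=
  if uniq s then (-1) ^+ inversions s (o [fset x in s]%fset) * fval f [fset x in s]%fset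
  else 0.

Lemma card_seq_fset (s : seq U) : uniq s -> #|` [fset x in s]%fset| = size s.
Proof. by move=> us; rewrite card_fseq undup_id. Qed.

Lemma signr_eq (K : pzRingType) m n : odd m = odd n -> (-1) ^+ m = (-1) ^+ n :> K.
Proof. by move=> mn; rewrite -signr_odd mn signr_odd. Qed.

Lemma ordering_perm (s : seq U) : uniq s -> Z [fset x in s]%fset ->
  perm_eq s (o [fset x in s]%fset).
Proof.
move=> us Zs; rewrite perm_sym; apply: perm_trans (orderingP o Zs) _.
by apply: uniq_perm; rewrite ?fset_uniq// => x; rewrite !inE.
Qed.

Lemma fset_rem (s : seq U) v : uniq s ->
  [fset x in rem v s]%fset = ([fset x in s] `\ v)%fset.
Proof. by move=> us; apply/fsetP => x; rewrite !inE mem_rem_uniq. Qed.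

Lemma coboundaryE l (f : cochain R Z l) (t : {fset U}) : t \in simplices Z l.+1 ->
  fval (coboundary o f) t =
  \sum_(v <- o t) (-1) ^+ (index v (o t) + inversions (rem v (o t)) (o (t `\ v)%fset)) *
                 fval f (t `\ v)%fset.
Proof.
move=> tl; have [Zt ct] : Z t /\ #|` t| = l.+2 by move: tl; rewrite in_simplices => /asboolP.
rewrite -[t in LHS](SubK (simplices Z l.+1) tl : val (Sub t tl) = t) fvalE ffunE.
under eq_bigr do rewrite /incidence mulr_suml big_mkcond.
rewrite exchange_big /= big_seq [RHS]big_seq; apply: eq_bigr => v.
rewrite (perm_mem (orderingP o Zt)) => vt.
have tv : (t `\ v)%fset \in simplices Z l.
  rewrite in_simplices; apply/asboolP.
  have c : #|` (t `\ v)%fset| = l.+1 by move: ct; rewrite (cardfsD1 v) vt => -[].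
  split=> //; apply: face_sub Zt (fsubD1set _ _) _.
  by rewrite -cardfs_gt0 c.
rewrite (bigD1 [` tv]%fset)//= eqxx big1 ?addr0 => [|s sN].
  by rewrite -fvalE.
by case: eqP => // e; move: sN; rewrite -val_eqE /= e eqxx.
Qed.

(** Only the values of [H] on the faces of [s] are prescribed, so the lemma applies to [alt] and
    also to functions that are not alternating. The signs match by [odd_inversions_rem] and
    [odd_inversions_trans]. *)
Lemma sdiff_coboundary l (f : cochain R Z l) (H : seq U -> C) (s : seq U) :
  uniq s -> [fset x in s]%fset \in simplices Z l.+1 ->
  (forall v, v \in s -> H (rem v s) =
    (-1) ^+ inversions (rem v s) (o [fset x in rem v s]%fset) *
    fval f [fset x in rem v s]%fset) ->
  sdiff H s = (-1) ^+ inversions s (o [fset x in s]%fset) *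
              fval (coboundary o f) [fset x in s]%fset.
Proof.
move=> us sl HE; set t := [fset x in s]%fset in sl *.
have [Zt ct] : Z t /\ #|` t| = l.+2 by move: sl; rewrite in_simplices => /asboolP.
have pst := ordering_perm us Zt; rewrite -/t in pst.
have uot : uniq (o t) by rewrite -(perm_uniq pst).
rewrite sdiff_rem// coboundaryE// mulr_sumr -(perm_big _ pst) /=.
rewrite big_seq [RHS]big_seq; apply: eq_bigr => v vs.
rewrite HE// fset_rem// -/t !mulrA -!exprD; congr (_ * _); apply: signr_eq.
have uv : uniq (rem v s) by rewrite rem_uniq.
have Zv : Z [fset x in rem v s]%fset.
  rewrite fset_rem// -/t; apply: face_sub Zt (fsubD1set _ _) _.
  have vt : v \in t by rewrite /t inE.
  by rewrite -cardfs_gt0; move: ct; rewrite (cardfsD1 v) vt add1n => -[->].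
have p1 := ordering_perm uv Zv; rewrite fset_rem// -/t in p1.
have p2 : perm_eq (rem v s) (rem v (o t)).
  apply: uniq_perm; rewrite ?rem_uniq// => x.
  by rewrite !mem_rem_uniq// !inE (perm_mem pst).
rewrite !oddD (odd_inversions_rem us pst vs) (odd_inversions_trans p2 p1).
case: (odd (inversions (rem v s) _)); case: (odd (inversions _ _));
  by case: (odd (index v s)); case: (odd (index v _)).
Qed.

(** The assumption rules out an (l+1)-dimensional tuple outside [Z] whose faces lie in [Z]. For
    repeated entries and for other sizes both sides vanish. *)
Lemma alt_sdiff l (f : cochain R Z l) (s : seq U) :
  (size s = l.+2 -> uniq s -> Z [fset x in s]%fset) ->
  sdiff (alt f) s = alt (coboundary o f) s.
Proof.
move=> Zs; have [us|nus] := boolP (uniq s); last first.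
  rewrite {2}/alt (negbTE nus); apply: sdiff_repeated => // [t nut|a b c v u1].
    by rewrite /alt (negbTE nut).
  have p12 : perm_eq (a ++ b ++ v :: c) (a ++ v :: b ++ c).
    by rewrite perm_cat2l -cat_rcons -cat_cons perm_cat2r perm_rcons perm_refl.
  have u2 : uniq (a ++ v :: b ++ c) by rewrite -(perm_uniq p12).
  have e12 : [fset x in a ++ b ++ v :: c]%fset = [fset x in a ++ v :: b ++ c]%fset.
    by apply/fsetP => x; have := perm_mem p12 x; rewrite !inE /= !mem_cat !inE !mem_cat.
  rewrite /alt u1 u2 e12; set t := [fset x in _]%fset.
  have [tl|tl] := boolP (t \in simplices Z l); last first.
    by rewrite fval_out// !mulr0 ?oppr0 if_same.
  have [Zt _] : Z t /\ #|` t| = l.+1 by move: tl; rewrite in_simplices => /asboolP.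
  have pt2 : perm_eq (a ++ v :: b ++ c) (o t) by exact: ordering_perm.
  have pt1 : perm_eq (a ++ b ++ v :: c) (o t) by rewrite (perm_trans p12).
  have v1 : v \in a ++ b ++ v :: c by rewrite !mem_cat inE eqxx !orbT.
  have v2 : v \in a ++ v :: b ++ c by rewrite !mem_cat inE eqxx !orbT.
  have va : v \notin a.
    by move: u2; rewrite cat_uniq /= => /and3P[_ + _]; rewrite negb_or => /andP[].
  have vb : v \notin b.
    by move: u2; rewrite cat_uniq /= mem_cat => /and4P[_ _ + _]; rewrite negb_or => /andP[].
  have r1 : rem v (a ++ b ++ v :: c) = a ++ b ++ c.
    by rewrite !rem_cat_notin//= eqxx.
  have r2 : rem v (a ++ v :: b ++ c) = a ++ b ++ c.
    by rewrite !rem_cat_notin//= eqxx.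
  (* Without [v] the two tuples coincide, and the positions of [v] differ by [size b]: this is the
     sign of moving [v] across [b]. *)
  have := odd_inversions_rem u1 pt1 v1; have := odd_inversions_rem u2 pt2 v2.
  rewrite r1 r2 !index_cat (negbTE va) (negbTE vb) /= eqxx !addn0 oddD.
  move=> e2 e1.
  have -> : (-1) ^+ inversions (a ++ b ++ v :: c) (o t) =
      (-1) ^+ (inversions (a ++ v :: b ++ c) (o t) + size b) :> C.
    apply: signr_eq; rewrite oddD e1 e2.
    by case: (odd (inversions _ _)); case: (odd (size a)); case: (odd (size b));
      case: (odd (index v (o t))).
  rewrite exprD -(signr_odd _ (size b)).
  by case: (odd (size b)); rewrite ?expr1 ?expr0 ?mulr1// mulrN1 mulNr.
have [tl|tl] := boolP ([fset x in s]%fset \in simplices Z l.+1).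
  rewrite {2}/alt us; apply: sdiff_coboundary => // v vs.
  by rewrite /alt rem_uniq.
rewrite {2}/alt us fval_out// mulr0.
have sl : size s <> l.+2.
  move=> sl; move: tl; rewrite in_simplices => /asboolP; apply.
  by split; [exact: Zs|rewrite card_seq_fset].
rewrite (@eq_sdiff _ _ _ (fun=> 0)) ?sdiff0// => t ts.
rewrite /alt; case: ifP => // ut; rewrite fval_out ?mulr0// in_simplices.
apply/asboolP => -[_]; rewrite card_seq_fset// => st; apply: sl.
by rewrite -(size_face ts) st.
Qed.

End Alternating.

(** * Quotients by subgroups *)

Section Quotients.
Variables (R : realType) (n : nat) (G : groupType) (V W : choiceType).
Variables (Y : scomplex V) (Yt : scomplex W) (p : smap Yt Y) (act : G -> smap Yt Yt).
Hypothesis p_universal : universal_covering (realization_map R p) R.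
Hypothesis E_contractible : contractible_space R (realization R Yt).
Hypothesis act_deck : deck_action R p act.
Local Notation vertex w := (Yt [fset w]%fset).
Local Notation C := R[i].

Let star_inj := star_inj p_universal.
Let actM := actM act_deck.
Let act1 := act1 act_deck.
Let p_act := p_act act_deck.
Let act_free := act_free p_universal act_deck.
Let map_actM := map_actM act_deck.
Let map_act1 := map_act1 act_deck.

Lemma act_inj g h w : vertex w -> act g w = act h w -> g = h.
Proof.
move=> Kw gh; have : (h^-1 * g)%g = 1%g.
  by apply: (act_free Kw); rewrite actM// gh -actM// mulVg act1.
by move=> /(congr1 (fun x => h * x)%g); rewrite mulVKg mulg1.
Qed.

Section Subgroup.
Variable L : set G.
Hypothesis sL : is_subgroup L.

Lemma subgroup1 : L 1%g.
Proof. by case: sL => + _; rewrite !inE. Qed.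

Lemma subgroupV g : L g -> L g^-1%g.
Proof. by move=> Lg; have := group_closedV sL; move=> /(_ g); rewrite !inE; exact. Qed.

Lemma subgroupM g h : L g -> L h -> L (g * h)%g.
Proof.
by move=> Lg Lh; have := group_closedM sL; move=> /(_ g h); rewrite !inE; exact.
Qed.

Definition lcos (g : G) : set G := [set (g * h)%g | h in L].

Lemma lcosP g h : lcos g = lcos h -> exists2 k, L k & h = (g * k)%g.
Proof.
move=> gh; have : lcos h h by exists 1%g; [exact: subgroup1|rewrite mulg1].
by rewrite -gh => -[k Lk <-]; exists k.
Qed.

Lemma lcosM g k : L k -> lcos (g * k)%g = lcos g.
Proof.
move=> Lk; apply/seteqP; split=> _ [h Lh <-].
  by exists (k * h)%g; [exact: subgroupM|rewrite mulgA].
exists (k^-1 * h)%g; first by apply: subgroupM => //; exact: subgroupV.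
by rewrite -mulgA mulVKg.
Qed.

Local Notation vorb := (vorbit act L).

Lemma vorb_act g w : L g -> vertex w -> vorb (act g w) = vorb w.
Proof.
move=> Lg Kw; apply/seteqP; split=> _ [h Lh <-].
  by exists (h * g)%g; [exact: subgroupM|rewrite actM].
exists (h * g^-1)%g; first by apply: subgroupM => //; exact: subgroupV.
by rewrite -actM// mulgVK.
Qed.

Lemma vorbP w w' : vertex w' -> vorb w = vorb w' -> exists2 g, L g & act g w = w'.
Proof.
move=> Kw' ww'; have : vorb w' w' by exists 1%g; [exact: subgroup1|rewrite act1].
by rewrite -ww' => -[g Lg <-]; exists g.
Qed.

Lemma vorb_p w w' : vertex w -> vertex w' -> vorb w = vorb w' -> p w = p w'.
Proof. by move=> Kw Kw' /(vorbP Kw')[g _ <-]; rewrite p_act. Qed.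

Lemma map_vorb_act g s : L g -> ftuple Yt s ->
  map vorb (map (act g) s) = map vorb s.
Proof.
move=> Lg /ftuple_vertex Ks; rewrite -map_comp; apply/eq_in_map => w /Ks Kw /=.
exact: vorb_act.
Qed.

Lemma map_vorb_p s s' : ftuple Yt s -> ftuple Yt s' -> map vorb s = map vorb s' ->
  map p s = map p s'.
Proof.
elim: s s' => [|w s IH] [|w' s'] //= Ks Ks' [ww' ss'].
have Kw := ftuple_vertex Ks (mem_head _ _); have Kw' := ftuple_vertex Ks' (mem_head _ _).
rewrite (vorb_p Kw Kw' ww') (IH s')//.
  by apply: (ftuple_sub Ks) => x xs; rewrite inE xs orbT.
by apply: (ftuple_sub Ks') => x xs; rewrite inE xs orbT.
Qed.

(** Vertexwise equality of orbits provides a different element of [L] for each vertex; the one for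
    the first vertex works for all, because the tuples have the same image in [Y] and [star_inj]
    applies. *)
Lemma map_vorb_eq s s' : ftuple Yt s -> ftuple Yt s' -> map vorb s = map vorb s' ->
  exists2 g, L g & map (act g) s = s'.
Proof.
move=> Ks Ks' e; have pss' := map_vorb_p Ks Ks' e.
case: s s' Ks Ks' e pss' => [|w s] [|w' s'] //= Ks Ks'.
  by exists 1%g; first exact: subgroup1.
have Kw' := ftuple_vertex Ks' (mem_head _ _).
move=> [/(vorbP Kw')[g Lg gw] _] [_ pss']; exists g => //; rewrite gw; congr (_ :: _).
apply: (ftuple_unique p_universal (w := w')) => //.
  by have := ftuple_act act g Ks; rewrite /= gw.
rewrite -pss' -map_comp; apply/eq_in_map => v vs /=; apply: p_act.
by apply: (ftuple_vertex Ks); rewrite inE vs orbT.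
Qed.

Local Notation Z := (quotient_complex act L (skeleton Yt n)).

Lemma ftuple_quot s : ftuple Yt s -> (0 < size s <= n.+1)%N ->
  Z [fset x in map vorb s]%fset.
Proof.
move=> Ks /andP[s0 sn]; exists [fset x in s]%fset.
  split; last by apply: leq_trans sn; rewrite card_fseq size_undup.
  by case: Ks s0 => // ->.
apply/fsetP => a; rewrite inE; apply/imfsetP/mapP => -[w /= ws ->].
  by exists w => //; rewrite inE in ws.
by exists w; rewrite //= inE.
Qed.

Lemma quot_lift vs : Z [fset x in vs]%fset ->
  exists2 s, ftuple Yt s & map vorb s = vs.
Proof.
move=> [t [Kt tn] te].
have lift a : a \in vs -> exists2 w, w \in t & vorb w = a.
  move=> avs; have : a \in [fset x in vs]%fset by rewrite inE.
  by rewrite -te => /imfsetP[w /= wt ->]; exists w.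
suff [s st sE] : exists2 s, {subset s <= t} & map vorb s = vs.
  by exists s => //; exact: ftuple_in Kt st.
elim: vs lift {te} => [|a vs IH] lift; first by exists [::].
have [|s st sE] := IH; first by move=> b bvs; apply: lift; rewrite inE bvs orbT.
have [w wt wa] := lift a (mem_head _ _).
exists (w :: s); last by rewrite /= wa sE.
by move=> x; rewrite inE => /orP[/eqP ->//|/st].
Qed.

Definition descend (T : Type) (f : seq W -> T) (vs : seq (set W)) : T :=
  f (xget [::] [set s | ftuple Yt s /\ map vorb s = vs]).

Lemma descendE T (f : seq W -> T) s :
  (forall g t, L g -> ftuple Yt t -> f (map (act g) t) = f t) ->
  ftuple Yt s -> descend f (map vorb s) = f s.
Proof.
move=> fL Ks; rewrite /descend; case: xgetP => [t _ [Kt ts]|/(_ s)[]//].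
by have [g Lg <-] := map_vorb_eq Ks Kt (esym ts); rewrite fL.
Qed.

(** The equivariant cochain attached to a function on tuples of the quotient: at the coset gL its
    value is that of [Phi] on the orbits of g^-1 s. It is extended by zero to all of [set G], so
    that different subgroups share one index set. *)
Definition colift (Phi : seq (set W) -> C) (s : seq W) (A : set G) : C :=
  let g := xget 1%g [set g | A = lcos g] in
  if `[< A = lcos g >] then Phi (map vorb (map (act g^-1%g) s)) else 0.

Lemma colift_lcos Phi s g : ftuple Yt s ->
  colift Phi s (lcos g) = Phi (map vorb (map (act g^-1%g) s)).
Proof.
move=> Ks; rewrite /colift; set h := xget _ _.
have hg : lcos g = lcos h by rewrite /h; case: xgetP => [h' _ //|/(_ g)[]].
rewrite asboolT//; have [k Lk ->] := lcosP hg.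
by rewrite invgM map_actM// map_vorb_act//; [exact: subgroupV|exact: ftuple_act].
Qed.

Lemma colift_out Phi s A : (forall g, A <> lcos g) -> colift Phi s A = 0.
Proof. by move=> nA; rewrite /colift asboolF//; exact: nA. Qed.

Lemma colift_sdiff Phi s A :
  sdiff (fun t => colift Phi t A) s = colift (sdiff Phi) s A.
Proof.
rewrite /colift; case: asboolP => _; last exact: sdiff0.
rewrite -(sdiff_map (vorbit act L) Phi).
by rewrite -(sdiff_map _ (fun t : seq W => Phi (map vorb t))).
Qed.

Lemma colift_act Phi s h A : ftuple Yt s ->
  colift Phi (map (act h) s) A = colift Phi s [set (h^-1 * a)%g | a in A].
Proof.
move=> Ks; have Khs := ftuple_act act h Ks.
have lE g : [set (h^-1 * a)%g | a in lcos g] = lcos (h^-1 * g)%g.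
  apply/seteqP; split=> [_ [_ [k Lk <-] <-]|_ [k Lk <-]].
    by exists k; rewrite // mulgA.
  by exists (g * k)%g; [exists k|rewrite mulgA].
have [[g ->]|nA] := pselect (exists g, A = lcos g).
  by rewrite lE !colift_lcos// invgM invgK map_actM.
rewrite !colift_out// => g; last by move=> e; apply: nA; exists g.
move=> e; apply: nA; exists (h * g)%g.
apply/seteqP; split=> [a Aa|_ [k Lk <-]].
  have : lcos g (h^-1 * a)%g by rewrite -e; exists a.
  by move=> [k Lk ka]; exists k; rewrite // -mulgA ka mulVKg.
have : [set (h^-1 * a)%g | a in A] (g * k)%g by rewrite e; exists k.
by move=> [a Aa ak]; rewrite -mulgA -ak mulVKg.
Qed.

Lemma quot_star w t : vertex w -> Z t -> vorb w \in t ->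
  exists s, [/\ skeleton Yt n s, w \in s & [fset vorb x | x in s]%fset = t].
Proof.
move=> Kw [s0 [Ks0 s0n] <-] /imfsetP[w' /= w's0 ww'].
have [g Lg gw] := vorbP Kw (esym ww').
exists [fset act g x | x in s0]%fset; split.
- split; first exact: smapP.
  by apply: leq_trans s0n; exact: leq_imfset_card.
- by apply/imfsetP; exists w'.
- apply/fsetP => a; apply/imfsetP/imfsetP => -[x /= xs ->].
    have [y /= ys ->] := imfsetP _ _ _ _ xs.
    by exists y => //; rewrite vorb_act//; exact: face_vertex Ks0 ys.
  exists (act g x); first by apply/imfsetP; exists x.
  by rewrite vorb_act//; exact: face_vertex Ks0 xs.
Qed.

End Subgroup.

Hypothesis finY : finite_set (faces (skeleton Y n)).

Lemma skeleton_star_inj w s s' : vertex w -> Yt s -> Yt s' -> w \in s -> w \in s' ->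
  [fset p x | x in s]%fset = [fset p x | x in s']%fset -> s = s'.
Proof.
move=> Kw; suff h t t' : Yt t -> Yt t' -> w \in t -> w \in t' ->
    [fset p x | x in t]%fset = [fset p x | x in t']%fset -> (t `<=` t')%fset.
  move=> Ks Ks' ws ws' e; apply/eqP; rewrite eqEfsubset.
  by rewrite (h s s')// (h s' s).
move=> Kt Kt' wt wt' e; apply/fsubsetP => x xt.
have : p x \in [fset p y | y in t]%fset by apply/imfsetP; exists x.
rewrite e => /imfsetP[y /= yt' pxy].
by rewrite (star_inj (face_edge Kt wt xt) (face_edge Kt' wt' yt') pxy).
Qed.

Section FiniteIndex.
Variable L : set G.
Hypothesis sL : is_subgroup L.
Local Notation Z := (quotient_complex act L (skeleton Yt n)).
Local Notation vorb := (vorbit act L).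

(** Each face at [v] lifts to a face through a fixed lift [w], and faces through [w] are determined
    by their images in [Y]. So the star embeds in the faces of the skeleton of [Y], whatever [L]
    is. *)
Lemma quot_degree v : Z [fset v]%fset ->
  ([set s | Z s /\ v \in s] #<= faces (skeleton Y n))%card.
Proof.
move=> [s0 [Ks0 _] s0v].
have /fset0Pn[w ws0] := face_neq0 Ks0; have Kw := face_vertex Ks0 ws0.
have vE : v = vorb w.
  have : vorb w \in [fset v]%fset by rewrite -s0v; apply/imfsetP; exists w.
  by rewrite inE => /eqP.
pose F (y : {fset V}) := [fset vorb x | x in xget fset0 [set s : {fset W} |
  [/\ Yt s, w \in s & [fset p x | x in s]%fset = y]]]%fset.
apply: (@card_le_trans _ _ _ (F @` faces (skeleton Y n))).
  apply: subset_card_le => t /= [Zt vt]; rewrite vE in vt.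
  have [s [[Ks sn] ws <-]] := quot_star sL Kw Zt vt.
  exists [fset p x | x in s]%fset.
    split; first exact: smapP.
    by apply: leq_trans sn; exact: leq_imfset_card.
  rewrite /F; case: xgetP => [s' _ [Ks' ws' e]|/(_ s)[]//].
  by rewrite (skeleton_star_inj Kw Ks' Ks ws' ws e).
exact: card_image_le.
Qed.

Lemma finite_base_vertices : finite_set [set v | Y [fset v]%fset].
Proof.
apply: (@sub_finite_set _ _ (\bigcup_(s in faces (skeleton Y n)) [set` s])).
  move=> v /= Yv; exists [fset v]%fset; last by rewrite /= inE.
  by split; rewrite // cardfs1.
by apply: bigcup_finite => // s _; exact: finite_fset.
Qed.

Hypothesis finL : finite_set (left_cosets L).

(** Every orbit of vertices comes from a coset gL and a vertex of [Y], by applying g^-1 to a chosen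
    lift; both range over finite sets, and faces are subsets of the finite set of orbits. *)
Lemma finite_quotient : finite_set (faces Z).
Proof.
have [[w0 Kw0]|nW] := pselect (exists w, vertex w); last first.
  apply: (@sub_finite_set _ _ set0) => // t [s [Ks _] _].
  by have /fset0Pn[w ws] := face_neq0 Ks; apply: nW; exists w; exact: face_vertex Ks ws.
pose rep v := xget w0 [set w | vertex w /\ p w = v].
pose F (Av : set G * V) := vorb (act (xget 1%g Av.1)^-1%g (rep Av.2)).
have finV : finite_set (F @` (left_cosets L `*` [set v | Y [fset v]%fset])).
  by apply/finite_image/finite_setX => //; exact: finite_base_vertices.
pose E := fset_set (F @` (left_cosets L `*` [set v | Y [fset v]%fset])).
apply: (@sub_finite_set _ _ [set` fpowerset E]); last exact: finite_fset.
move=> _ [s [Ks _] <-] /=; rewrite fpowersetE; apply/fsubsetP => a /imfsetP[w /= ws ->].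
have Kw := face_vertex Ks ws.
rewrite in_fset_set//; apply/mem_set.
have [Kr pr] : vertex (rep (p w)) /\ p (rep (p w)) = p w.
  by rewrite /rep; case: xgetP => [u _ //|/(_ w)[]].
have [g gw] := act_transitive p_universal E_contractible act_deck Kr Kw pr.
exists (lcos L g^-1%g, p w).
  split; first by exists g^-1%g.
  have := smapP p Kw; congr (Y _); apply/fsetP => v; rewrite inE.
  apply/imfsetP/eqP => [[u /=]|->]; first by rewrite inE => /eqP ->.
  by exists w; rewrite //= inE.
rewrite /F /=; set h := xget _ _.
have : lcos L g^-1%g h.
  rewrite /h; apply: (@xgetPex _ 1%g); exists g^-1%g.
  by exists 1%g; [exact: subgroup1|rewrite mulg1].
move=> [k Lk <-]; rewrite invgM invgK actM// gw.
by rewrite vorb_act//; exact: subgroupV.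
Qed.

(** The coset gL is sent to the orbit of g^-1 w0; freeness of the action makes this injective. *)
Lemma index_le_vertices : (exists w, vertex w) ->
  (subgroup_index L <= #|` simplices Z 0|)%N.
Proof.
move=> [w0 Kw0]; rewrite /subgroup_index.
pose F (A : set G) : {fset set W} := [fset vorb (act (xget 1%g A)^-1%g w0)]%fset.
have -> : #|` fset_set (left_cosets L)| = #|` (F @` fset_set (left_cosets L))%fset|.
  rewrite card_in_imfset//= => A B; rewrite !in_fset_set// => /set_mem[g _ <-] /set_mem[h _ <-].
  rewrite -![[set _ | _ in L]]/(lcos L _).
  have xP k : lcos L (xget 1%g (lcos L k)) = lcos L k.
    have : lcos L k (xget 1%g (lcos L k)).
      apply: (@xgetPex _ 1%g); exists k.
      by exists 1%g; [exact: subgroup1|rewrite mulg1].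
    by move=> [j Lj <-]; rewrite lcosM.
  move=> /fset1_inj; set g' := xget _ _; set h' := xget _ _ => e.
  rewrite -(xP g) -(xP h) -/g' -/h'.
  have Kh : vertex (act h'^-1%g w0) by exact: act_vertex.
  have [k Lk] := vorbP sL Kh e; rewrite -actM// => /(act_inj Kw0) kgh.
  have -> : g' = (h' * k)%g by rewrite -[h']invgK -kgh invgM invgK mulgVK.
  by rewrite lcosM.
apply: fsubset_leq_card; apply/fsubsetP => _ /imfsetP[A /= _ ->].
rewrite in_simplices; last exact: finite_quotient.
apply/asboolP; rewrite cardfs1; split=> //.
have Kw := act_vertex act (xget 1%g A)^-1%g Kw0.
exists [fset act (xget 1%g A)^-1%g w0]%fset; first by split; rewrite // cardfs1.
apply/fsetP => a; rewrite inE; apply/imfsetP/eqP => [[u /=]|->].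
  by rewrite inE => /eqP ->.
by exists (act (xget 1%g A)^-1%g w0); rewrite //= inE.
Qed.

End FiniteIndex.

End Quotients.

(** * Uniform exactness over a family of subgroups *)

Section LiftExact.
Variables (R : realType) (n : nat) (G : groupType) (V W : choiceType).
Variables (Y : scomplex V) (Yt : scomplex W) (p : smap Yt Y) (act : G -> smap Yt Yt).
Hypothesis p_universal : universal_covering (realization_map R p) R.
Hypothesis E_contractible : contractible_space R (realization R Yt).
Hypothesis act_deck : deck_action R p act.
Hypothesis kazhdan : strongly_kazhdan R G n.
Local Notation vertex w := (Yt [fset w]%fset).
Local Notation C := R[i].
Local Notation S := (ftuple Yt).

Lemma ftuple_allp s : S s -> allp (fun w => S [:: w]) s.
Proof.
move=> Ks; apply/allpP => w ws; apply: (ftuple_sub Ks) => x.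
by rewrite inE => /eqP ->.
Qed.

(** A base point is chosen in each orbit of vertices; by freeness a unique group element takes it to
    a given vertex. *)
Lemma equivariant_map : exists q : W -> G,
  forall g w, S [:: w] -> q (act g w) = (g * q w)%g.
Proof.
have vx w : S [:: w] -> vertex w by move=> Kw; apply: (ftuple_vertex Kw); rewrite inE.
pose orb w := [set u | exists g, act g w = u].
have orbE g w : vertex w -> orb (act g w) = orb w.
  move=> Kw; apply/seteqP; split=> _ [h <-].
    by exists (h * g)%g; rewrite (actM act_deck).
  by exists (h * g^-1)%g; rewrite -(actM act_deck)// mulgVK.
have [[w0 _]|nW] := pselect (exists w, vertex w); last first.
  by exists (fun=> 1%g) => g w /vx Kw; case: nW; exists w.
pose rep w := xget w0 (orb w).
have repP w : vertex w -> exists g, act g (rep w) = w.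
  move=> Kw; have [g gw] : orb w (rep w).
    by rewrite /rep; apply: (@xgetPex _ w0); exists w; exists 1%g; rewrite (act1 act_deck).
  by exists g^-1%g; rewrite -gw -(actM act_deck)// mulVg (act1 act_deck).
exists (fun w => xget 1%g [set g | act g (rep w) = w]) => g w /vx Kw.
have Kgw := act_vertex act g Kw.
have repE : rep (act g w) = rep w by rewrite /rep orbE.
have qP u : vertex u -> act (xget 1%g [set g | act g (rep u) = u]) (rep u) = u.
  by move=> Ku; apply: (@xgetPex _ 1%g [set g | act g (rep u) = u]); exact: repP.
have Kr : vertex (rep w).
  have [h hw] : orb w (rep w).
    by rewrite /rep; apply: (@xgetPex _ w0); exists w; exists 1%g; rewrite (act1 act_deck).
  by rewrite -hw; exact: act_vertex.
apply: (act_inj p_universal act_deck Kr).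
by rewrite (actM act_deck)// qP// -[X in act _ X = _]repE qP.
Qed.

Local Notation T := (nat * set G)%type.

Definition coset_act (g : G) (t : T) : T := (t.1, [set (g * a)%g | a in t.2]).

Lemma coset_act1 t : coset_act 1%g t = t.
Proof.
case: t => k A; congr pair; apply/seteqP; split=> [_ [a Aa <-]|a Aa].
  by rewrite mul1g.
by exists a; rewrite // mul1g.
Qed.

Lemma coset_actM g h t : coset_act (g * h)%g t = coset_act g (coset_act h t).
Proof.
case: t => k A; congr pair; apply/seteqP; split=> [_ [a Aa <-]|_ [_ [a Aa <-] <-]] /=.
  by exists (h * a)%g; rewrite ?mulgA//; exists a.
by exists a; rewrite // mulgA.
Qed.

Variable Lam : nat -> set G.
Hypothesis Lam_sub : forall k, is_subgroup (Lam k).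
Local Notation vorb k := (vorbit act (Lam k)).

Definition colifts (Phi : nat -> seq (set W) -> C) (s : seq W) (t : T) : C :=
  colift act (Lam t.1) (Phi t.1) s t.2.

(** All the [Phi k] become one equivariant cocycle [c] with values in the Hilbert space. The
    coordinate of its primitive at [(k, Lam k)] is invariant under [Lam k] and descends to [Psi k];
    the other coordinates at cosets follow by equivariance, so the colift of [Psi] is as summable as
    the primitive. *)
Lemma lift_exact j (Phi : nat -> seq (set W) -> C) : (j < n)%N ->
  (forall k s, S s -> sdiff (Phi k) (map (vorb k) s) = 0) ->
  (forall s, S s -> colifts Phi s \in @l2_pred R T) ->
  exists Psi : nat -> seq (set W) -> C,
    (forall s, S s -> colifts Psi s \in @l2_pred R T) /\
    forall k s, S s -> size s = j.+2 ->
      sdiff (Psi k) (map (vorb k) s) = Phi k (map (vorb k) s).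
Proof.
move=> jn dPhi l2Phi.
pose H := l2 R T.
(* The default zero is met only on tuples that span no face. *)
pose c (s : seq W) : H := insubd (0 : H) (colifts Phi s).
have cE s t : S s -> c s t = colifts Phi s t.
  by move=> Ks; rewrite /c -[LHS]/(val (insubd _ _) t) insubdK//; exact: l2Phi.
pose pi := @l2_perm R T G coset_act coset_act1 coset_actM.
have ce : equivariant act S pi c.
  move=> g s Ks; apply: l2_ext => -[k A]; rewrite cE; last exact: ftuple_act.
  by rewrite /= cE// /colifts (colift_act act_deck (Lam_sub _)).
have S_face s t : S t -> face_of s t -> S s by exact: ftuple_face.
have dc s : S s -> sdiff c s = 0.
  move=> Ks; apply: l2_ext => -[k A].
  rewrite (sdiff_raddf (h := fun f : H => f (k, A)))//.
  rewrite (@eq_sdiff _ _ _ (fun u => colift act (Lam k) (Phi k) u A)); last first.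
    by move=> u us /=; rewrite cE//; exact: S_face us.
  rewrite colift_sdiff.
  have [[g ->]|nA] := pselect (exists g, A = lcos (Lam k) g); last first.
    by rewrite colift_out// => g e; apply: nA; exists g.
  by rewrite (colift_lcos act_deck (Lam_sub k))// dPhi//; exact: ftuple_act.
have [q q_act] := equivariant_map.
have Hj := kazhdan (@l2_hilbert R T) (@l2_perm_unitary R T G coset_act coset_act1 coset_actM) jn.
have S0 : S [::] by left.
have [h he dh] : exists2 h, equivariant act S pi h &
    forall s, S s -> size s = j.+2 -> sdiff h s = c s.
  apply: (@equivariant_acyclic G C H pi W (fun g => act g) S q) => //.
  - exact: ftuple_allp.
  - by move=> g s; exact: ftuple_act.
  - by move=> k s Ks; apply: (ftuple_sub Ks) => x; exact: mem_take.
  - by move=> k s Ks; apply: (ftuple_sub Ks) => x; exact: mem_drop.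
  - by move=> x Kx; rewrite (act1 act_deck)//; apply: (ftuple_vertex Kx); rewrite inE.
  - by move=> g g' x Kx; rewrite (actM act_deck)//; apply: (ftuple_vertex Kx); rewrite inE.
  - by move=> g x y; apply: l2_ext => t; rewrite !(l2DE, l2NE)/=.
  - by move=> z cz zd; exact: (contractible_acyclic E_contractible cz zd).
have hE g s k A : S s -> h (map (act g) s) (k, A) = h s (coset_act g^-1%g (k, A)).
  by move=> Ks; rewrite he.
have Lam1 k : lcos (Lam k) 1%g = Lam k.
  apply/seteqP; split=> [_ [a La <-]|a La]; first by rewrite mul1g.
  by exists a; rewrite // mul1g.
pose Psi k := descend act (Lam k) (fun s => h s (k, Lam k)).
have PsiE k s : S s -> Psi k (map (vorb k) s) = h s (k, Lam k).
  move=> Ks; apply: (descendE p_universal act_deck (Lam_sub k)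
    (f := fun s => h s (k, Lam k)) _ Ks) => g t Lg Kt.
  rewrite hE//; congr (h t (k, _)) => /=.
  rewrite -[RHS](Lam1 k) -(lcosM (Lam_sub k) 1%g (subgroupV (Lam_sub k) Lg)).
  by rewrite mul1g.
exists Psi; split.
  move=> s Ks; apply/l2_predP; apply: (psummable_le (l2P (h s))) => -[k A].
  rewrite sqmod_ge0 /colifts /=.
  have [[g ->]|nA] := pselect (exists g, A = lcos (Lam k) g); last first.
    by rewrite colift_out ?sqmod0 ?sqmod_ge0// => g e; apply: nA; exists g.
  rewrite (colift_lcos act_deck (Lam_sub k))// PsiE; last exact: ftuple_act.
  by rewrite hE// invgK.
move=> k s Ks sj; rewrite -(sdiff_map (vorb k) (Psi k)).
rewrite (@eq_sdiff _ _ _ (fun u => h u (k, Lam k))); last first.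
  by move=> u us; rewrite PsiE//; exact: S_face us.
have := dh s Ks sj => /(congr1 (fun f : H => f (k, Lam k))).
rewrite (sdiff_raddf (h := fun f : H => f (k, Lam k)))// => ->.
rewrite cE// /colifts /= -{2}(Lam1 k) (colift_lcos act_deck (Lam_sub k))//.
by rewrite invg1 (map_act1 act_deck).
Qed.

End LiftExact.

Section Sums.
Variable R : realType.

Lemma uniq_sum_le (T : eqType) (s1 s2 : seq T) (b : T -> R) : (forall t, 0 <= b t) ->
  uniq s1 -> {subset s1 <= s2} -> \sum_(t <- s1) b t <= \sum_(t <- s2) b t.
Proof.
move=> b0; elim: s1 s2 => [|x s1 IH] s2 /=.
  by move=> _ _; rewrite big_nil sumr_ge0.
move=> /andP[xs1 us1] s12; have xs2 : x \in s2 by apply: s12; exact: mem_head.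
rewrite big_cons (perm_big _ (perm_to_rem xs2)) big_cons lerD2l IH// => y ys1.
have : y \in s2 by apply: s12; rewrite inE ys1 orbT.
rewrite (perm_mem (perm_to_rem xs2)) inE => /orP[/eqP e|//].
by move: xs1; rewrite -e ys1.
Qed.

(** Injectivity of [h] is asked on the support of [a] only: where a colift vanishes, a coordinate
    determines no simplex. *)
Lemma sum_reindex_le (T U : eqType) (F : seq T) (E : seq U) (h : T -> U)
    (a : T -> R) (b : U -> R) : (forall u, 0 <= b u) -> uniq F ->
  (forall t, t \in F -> a t != 0 -> h t \in E /\ a t = b (h t)) ->
  {in [pred t | (t \in F) && (a t != 0)] &, injective h} ->
  \sum_(t <- F) a t <= \sum_(u <- E) b u.
Proof.
move=> b0 uF hE hi; set F' := [seq t <- F | a t != 0].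
have F'E t : t \in F' = (t \in F) && (a t != 0) by rewrite mem_filter andbC.
have -> : \sum_(t <- F) a t = \sum_(u <- map h F') b u.
  rewrite big_map (bigID (fun t => a t != 0))/= [X in _ + X]big1 ?addr0 => [|t]; last first.
    by rewrite negbK => /eqP.
  rewrite -big_filter big_seq [RHS]big_seq; apply: eq_bigr => t.
  by rewrite F'E => /andP[tF at0]; case: (hE t tF at0).
apply: uniq_sum_le => //.
  rewrite map_inj_in_uniq ?filter_uniq// => x y; rewrite !F'E => xF yF.
  by apply: hi; rewrite inE.
by move=> _ /mapP[t + ->]; rewrite F'E => /andP[tF at0]; case: (hE t tF at0).
Qed.

Lemma finite_tuples (T : eqType) (E : seq T) k : exists YS : seq (seq T),
  forall s, size s = k -> {subset s <= E} -> s \in YS.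
Proof.
elim: k => [|k [YS YSP]].
  by exists [:: [::]] => -[|//] _ _; rewrite inE.
exists [seq x :: s | x <- E, s <- YS] => -[//|x s] [sk] sE.
apply: allpairs_f; first by apply: sE; exact: mem_head.
by apply: YSP => // y ys; apply: sE; rewrite inE ys orbT.
Qed.

End Sums.

(** * Square norms of cochains and the passage from tuples to oriented faces *)

Section SquareNorm.
Variables (R : realType) (U : choiceType) (Z : scomplex U) (o : orientation Z).
Local Notation C := R[i].

Definition csq l (f : cochain R Z l) : R :=
  \sum_(s <- simplices Z l) sqmod (fval f s).

Lemma csqE l (f : cochain R Z l) : csq f = \sum_s sqmod (f s).
Proof. by rewrite /csq big_seq_fsetE; apply: eq_bigr => s _; rewrite fvalE. Qed.

Lemma sqmodE (z : C) : (sqmod z)%:C%C = z * z^*.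
Proof. by case: z => a b; rewrite /sqmod; simpc; congr (_ +i* _)%C; ring. Qed.

Lemma inner_csq l (f : cochain R Z l) : inner f f = (csq f)%:C%C.
Proof.
by rewrite csqE rmorph_sum; apply: eq_bigr => s _; rewrite -sqmodE.
Qed.

Lemma csq_ge0 l (f : cochain R Z l) : 0 <= csq f.
Proof. by apply: sumr_ge0 => s _; exact: sqmod_ge0. Qed.

Lemma csq_eq0 l (f : cochain R Z l) : csq f = 0 -> f = 0.
Proof.
rewrite csqE => /eqP; rewrite psumr_eq0 => [/allP f0|s _]; last exact: sqmod_ge0.
apply/ffunP => s; rewrite ffunE; apply: sqmod_eq0; apply/eqP.
by apply: f0; rewrite mem_index_enum.
Qed.

Lemma csqZ l (c : C) (f : cochain R Z l) : csq (c *: f) = sqmod c * csq f.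
Proof. by rewrite !csqE mulr_sumr; apply: eq_bigr => s _; rewrite ffunE sqmodM. Qed.

Lemma csq_perpB l (f g : cochain R Z l) : inner f g = 0 ->
  csq (f - g) = csq f + csq g.
Proof.
move=> /(congr1 (@complex.Re R)) fg0.
have {}fg0 : \sum_s complex.Re (f s * (g s)^*) = 0.
  by rewrite -[RHS]fg0 /inner raddf_sum.
have -> : csq f + csq g = csq f + csq g - 2 * \sum_s complex.Re (f s * (g s)^*).
  by rewrite fg0 mulr0 subr0.
rewrite !csqE mulr_sumr.
transitivity (\sum_s (sqmod (f s) + sqmod (g s) - 2 * complex.Re (f s * (g s)^*)));
  last by rewrite sumrB big_split.
apply: eq_bigr => s _; rewrite !ffunE.
by case: (f s) (g s) => [a b] [c d]; rewrite /sqmod; simpc => /=; ring.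
Qed.

Lemma coboundaryB l (f g : cochain R Z l) :
  coboundary o (f - g) = coboundary o f - coboundary o g.
Proof.
apply/ffunP => t; rewrite !ffunE -sumrB; apply: eq_bigr => s _.
by rewrite !ffunE mulrBr.
Qed.

Lemma coboundaryZ l (c : C) (f : cochain R Z l) :
  coboundary o (c *: f) = c *: coboundary o f.
Proof.
apply/ffunP => t; rewrite !ffunE [RHS]mulr_sumr; apply: eq_bigr => s _.
by rewrite !ffunE /= mulrCA.
Qed.

Lemma csq_coboundary l (a : R) (f : cochain R Z l) :
  upper_laplacian o f = (a%:C)%C *: f -> csq (coboundary o f) = a * csq f.
Proof.
move=> fa; have := coboundary_adjP o f (coboundary o f).
rewrite inner_csq -[coboundary_adj _ _]/(upper_laplacian o f) fa.
have -> : inner f ((a%:C)%C *: f) = ((a * csq f)%:C)%C.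
  rewrite rmorphM /= -[X in _ * X]inner_csq mulr_sumr; apply: eq_bigr => s _.
  by rewrite ffunE -[_ *: _]/(_ * _); case: (f s) => x y; simpc; congr (_ +i* _)%C; ring.
by move=> /(congr1 (@complex.Re R)).
Qed.

Hypothesis finZ : finite_set (faces Z).

Section Sorted.
Variable E : seq U.
Hypothesis uE : uniq E.
Hypothesis ZE : forall s : {fset U}, Z s -> {subset s <= E}.

(** A primitive on tuples need not be alternating, so it is read on one ordering of each face.
    Orderings induced by a common list are stable under deletion of a vertex, which is enough for
    [sdiff_coboundary]. *)
Definition sorted_face (s : {fset U}) : seq U := [seq x <- E | x \in s].

Lemma sorted_face_uniq s : uniq (sorted_face s).
Proof. exact: filter_uniq. Qed.

Lemma sorted_faceK s : Z s -> [fset x in sorted_face s]%fset = s.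
Proof.
move=> /ZE sE; apply/fsetP => x; rewrite !inE mem_filter.
by case: (boolP (x \in s)) => //= /sE.
Qed.

Lemma size_sorted_face s : Z s -> size (sorted_face s) = #|` s|.
Proof.
by move=> Zs; rewrite -(card_seq_fset (sorted_face_uniq s)) sorted_faceK.
Qed.

Lemma rem_sorted_face s v : rem v (sorted_face s) = sorted_face (s `\ v)%fset.
Proof.
rewrite rem_filter ?sorted_face_uniq// -filter_predI; apply: eq_filter => x /=.
by rewrite !inE.
Qed.

Definition unalt l (Psi : seq U -> C) : cochain R Z l :=
  [ffun s => (-1) ^+ inversions (sorted_face (val s)) (o (val s)) *
             Psi (sorted_face (val s))].

Lemma fval_unalt l Psi s : s \in simplices Z l ->
  fval (unalt l Psi) s = (-1) ^+ inversions (sorted_face s) (o s) * Psi (sorted_face s).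
Proof. by move=> sl; rewrite -[s in LHS]/(val [` sl]%fset) fvalE ffunE. Qed.

Lemma sqmod_sign k (z : C) : sqmod ((-1) ^+ k * z) = sqmod z.
Proof.
rewrite sqmodM -signr_odd; case: (odd k); rewrite ?expr0 ?expr1 /sqmod /=; ring.
Qed.

Lemma coboundary_unalt l Psi t : t \in simplices Z l.+1 ->
  sdiff Psi (sorted_face t) =
  (-1) ^+ inversions (sorted_face t) (o t) * fval (coboundary o (unalt l Psi)) t.
Proof.
move=> tl; have [Zt ct] : Z t /\ #|` t| = l.+2 by move: tl; rewrite in_simplices// => /asboolP.
have := @sdiff_coboundary R U Z o finZ l (unalt l Psi) Psi (sorted_face t).
rewrite sorted_faceK//; apply; rewrite ?sorted_face_uniq// => v.
rewrite mem_filter => /andP[vt _]; rewrite rem_sorted_face.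
have c : #|` (t `\ v)%fset| = l.+1 by move: ct; rewrite (cardfsD1 v) vt => -[].
have Zv : Z (t `\ v)%fset.
  by apply: face_sub Zt (fsubD1set _ _) _; rewrite -cardfs_gt0 c.
rewrite sorted_faceK// fval_unalt; last by rewrite in_simplices//; exact/asboolP.
by rewrite mulrA -exprD addnn -signr_odd odd_double mul1r.
Qed.

End Sorted.

Lemma vertex_list : exists E : seq U, uniq E /\
  forall s : {fset U}, Z s -> {subset s <= E}.
Proof.
exists (undup (flatten [seq enum_fset s | s <- fset_set (faces Z)])).
split=> [|s Zs x xs]; first exact: undup_uniq.
rewrite mem_undup; apply/flattenP; exists (enum_fset s) => //.
by apply: map_f; rewrite in_fset_set//; exact/mem_set.
Qed.

End SquareNorm.

Lemma mem_fset_seq (K : choiceType) (s : seq K) x : (x \in [fset y in s]%fset) = (x \in s).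
Proof. by rewrite inE. Qed.

(** * Square summable families of cochains on the quotients *)

Section ExactFamily.
Variables (R : realType) (n : nat) (G : groupType) (V W : choiceType).
Variables (Y : scomplex V) (Yt : scomplex W) (p : smap Yt Y) (act : G -> smap Yt Yt).
Hypothesis p_universal : universal_covering (realization_map R p) R.
Hypothesis E_contractible : contractible_space R (realization R Yt).
Hypothesis act_deck : deck_action R p act.
Hypothesis finY : finite_set (faces (skeleton Y n)).
Local Notation C := R[i].
Local Notation S := (ftuple Yt).
Local Notation T := (nat * set G)%type.

Variable Lam : nat -> set G.
Hypothesis Lam_sub : forall k, is_subgroup (Lam k).
Hypothesis Lam_fin : forall k, finite_set (left_cosets (Lam k)).
Local Notation Z k := (quotient_complex act (Lam k) (skeleton Yt n)).
Variable o : forall k, orientation (Z k).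
Local Notation vorb k := (vorbit act (Lam k)).

Let finZ k : finite_set (faces (Z k)) :=
  finite_quotient p_universal E_contractible act_deck finY (Lam_sub k) (Lam_fin k).

(** An orbit shared by the two translated faces relates vertices of [s] with equal image in [Y],
    hence equal by [star_inj]; freeness then identifies the cosets. *)
Lemma vorb_face_inj k s g h : S s -> (0 < size s)%N ->
  [fset x in map (vorb k) (map (act g^-1%g) s)]%fset =
  [fset x in map (vorb k) (map (act h^-1%g) s)]%fset ->
  lcos (Lam k) g = lcos (Lam k) h.
Proof.
case: s => [//|x s] Ks _ e.
have Kx := ftuple_vertex Ks (mem_head _ _).
have : vorb k (act g^-1%g x) \in [fset y in map (vorb k) (map (act g^-1%g) (x :: s))]%fset.
  by rewrite mem_fset_seq mem_head.
rewrite e mem_fset_seq -map_comp => /mapP[y ys /= xy].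
have Ky := ftuple_vertex Ks ys.
have Kgx := act_vertex act g^-1%g Kx; have Khy := act_vertex act h^-1%g Ky.
have pxy : p x = p y.
  by have := vorb_p act_deck (Lam_sub k) Kgx Khy xy; rewrite !(p_act act_deck).
have xyE : x = y.
  exact: (star_inj p_universal (ftuple_edge Ks (mem_head _ _) (mem_head _ _))
    (ftuple_edge Ks (mem_head _ _) ys) pxy).
rewrite -xyE in xy Khy.
have [j Lj] := vorbP act_deck (Lam_sub k) Khy xy.
rewrite -(actM act_deck)// => /(act_inj p_universal act_deck Kx) jgh.
have -> : h = (g * j^-1)%g by rewrite -[h]invgK -jgh invgM invgK.
by rewrite lcosM//; exact: subgroupV.
Qed.

(** For a fixed [s], each nonzero coordinate of the colift is, up to sign, the value of [phi k] on a
    simplex of its quotient. Distinct cosets give distinct simplices by [vorb_face_inj], so the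
    square norm is at most the sum of the [csq (phi k)]. *)
Lemma colifts_bound m (phi : forall k, cochain R (Z k) m) (B : R) s : S s ->
  (forall K, \sum_(k < K) csq (phi k) <= B) ->
  colifts act Lam (fun k => alt (o k) (phi k)) s \in @l2_pred R T.
Proof.
move=> Ks hB; apply/l2_predP; split=> [t|]; first exact: sqmod_ge0.
exists B => _ [F _ <-].
pose g_ (t : T) := xget 1%g [set g | t.2 = lcos (Lam t.1) g].
pose h (t : T) : nat * {fset set W} :=
  (t.1, [fset x in map (vorb t.1) (map (act (g_ t)^-1%g) s)]%fset).
(* Beyond every first index that occurs in [F]. *)
pose K := (\max_(t <- F) t.1).+1.
pose E := [seq (k, A) | k <- iota 0 K, A <- simplices (Z k) m].
pose b (u : nat * {fset set W}) := sqmod (fval (phi u.1) u.2).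
have gP t : sqmod (colifts act Lam (fun k => alt (o k) (phi k)) s t) != 0 ->
    t.2 = lcos (Lam t.1) (g_ t).
  move=> t0; have [[g ge]|nA] := pselect (exists g, t.2 = lcos (Lam t.1) g).
    by rewrite /g_; case: xgetP => [g' _ //|/(_ g)[]].
  by move: t0; rewrite /colifts colift_out ?sqmod0 ?eqxx// => g e; apply: nA; exists g.
have tE t : sqmod (colifts act Lam (fun k => alt (o k) (phi k)) s t) != 0 ->
    [/\ (0 < size s)%N, (h t).2 \in simplices (Z t.1) m &
      sqmod (colifts act Lam (fun k => alt (o k) (phi k)) s t) = b (h t)].
  move=> t0; move: (t0); rewrite /colifts (gP t t0) (colift_lcos act_deck (Lam_sub _))//.
  rewrite /alt; case: ifP => [ut|_]; last by rewrite sqmod0 eqxx.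
  rewrite sqmod_sign -/(h t).2 => t1.
  have tl : (h t).2 \in simplices (Z t.1) m.
    by apply: contraNT t1 => tl; rewrite /= fval_out// sqmod0.
  split=> //; move: tl; rewrite in_simplices// => /asboolP[_].
  by rewrite card_seq_fset// !size_map => ->.
apply: (@le_trans _ _ (\sum_(u <- E) b u)).
  apply: (@sum_reindex_le R _ _ F E h _ b).
  - by move=> u; exact: sqmod_ge0.
  - exact: fset_uniq.
  - move=> t tF /tE[_ tl te]; split=> //.
    apply/allpairsPdep; exists t.1, (h t).2; split=> //.
    rewrite mem_iota /= add0n ltnS.
    exact: (@leq_bigmax_seq _ (enum_fset F) xpredT (fun t : T => t.1) t tF isT).
  - move=> t t'; rewrite !inE => /andP[_ t0] /andP[_ t'0] [e1 e2].
    have [s0 _ _] := tE t t0; have h1 := gP t t0; have h2 := gP t' t'0.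
    move: t t' h1 h2 e1 e2 {t0 t'0} => [k A] [k' A'] /= h1 h2 e1.
    move: h2; rewrite -e1 => h2 /(vorb_face_inj Ks s0) e2.
    by congr pair; apply: etrans h1 (etrans e2 (esym h2)).
rewrite /E big_allpairs_dep -[X in iota 0 X]subn0 -/(index_iota 0 K) big_mkord.
exact: hB.
Qed.

(** The bound is a sum over the finitely many tuples [ys] of vertices of [Y], each with a chosen
    lift [rho ys]. Every simplex of every quotient, in sorted order, is the orbit tuple of a
    translate of some [rho ys]. The value there is a coordinate of the colift at [rho ys], and
    distinct simplices use distinct pairs of a tuple and a coordinate. *)
Lemma unalt_bound m (E : forall k, seq (set W)) (Psi : nat -> seq (set W) -> C) :
  (m <= n)%N -> (forall k, uniq (E k)) ->
  (forall k (s : {fset set W}), Z k s -> {subset s <= E k}) ->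
  (forall s, S s -> colifts act Lam Psi s \in @l2_pred R T) ->
  exists B : R, forall K, \sum_(k < K) csq (unalt (o k) (E k) m (Psi k)) <= B.
Proof.
move=> mn uE ZE l2Psi.
pose VY := fset_set [set v | Y [fset v]%fset].
have VYE v : Y [fset v]%fset -> v \in VY.
  by move=> Yv; rewrite in_fset_set; [exact/mem_set|exact: (finite_base_vertices finY)].
have [YS YSP] := finite_tuples VY m.+1.
pose rho ys := xget [::] [set s | S s /\ map p s = ys].
have rhoS ys : S (rho ys).
  by rewrite /rho; case: xgetP => [s _ []//|_]; left.
exists (\sum_(ys <- YS) psum (fun t => sqmod (colifts act Lam Psi (rho ys) t))) => K.
pose U := (nat * {fset set W})%type.
pose a (u : U) := sqmod (fval (unalt (o u.1) (E u.1) m (Psi u.1)) u.2).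
pose D := [seq (k, A) | k <- iota 0 K, A <- simplices (Z k) m].
pose P (u : U) (v : seq V * T) := exists g,
  [/\ v.1 \in YS, v.2 = (u.1, lcos (Lam u.1) g) &
      sorted_face (E u.1) u.2 = map (vorb u.1) (map (act g^-1%g) (rho v.1))].
have hex u : exists v, u \in D -> P u v.
  have [uD|] := boolP (u \in D); last by exists ([::], (0%N, set0)).
  suff [v Pv] : exists v, P u v by exists v.
  move: uD => /allpairsPdep[k [A [_]]]; rewrite in_simplices// => /asboolP[ZA cA] -> /=.
  have ZsA : Z k [fset x in sorted_face (E k) A]%fset by rewrite (sorted_faceK (ZE k) ZA).
  have [s Ks sE] := quot_lift ZsA.
  have [rS rp] : S (rho (map p s)) /\ map p (rho (map p s)) = map p s.
    by rewrite /rho; case: xgetP => [? _ //|/(_ s)[]].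
  have [g gs] := ftuple_transitive p_universal E_contractible act_deck rS Ks rp.
  exists (map p s, (k, lcos (Lam k) g^-1%g)), g^-1%g; split=> //=.
    apply: YSP.
      by rewrite size_map -(size_map (vorb k)) sE (size_sorted_face (uE k) (ZE k) ZA).
    move=> _ /mapP[w ws ->]; apply: VYE.
    have := smapP p (ftuple_vertex Ks ws); congr (Y _); apply/fsetP => v; rewrite inE.
    apply/imfsetP/eqP => [[u' /=]|->]; first by rewrite inE => /eqP ->.
    by exists w; rewrite //= inE.
  by rewrite invgK gs sE.
have /choice[h hP] := hex.
pose F := [fset (h u).2 | u in D]%fset.
apply: (@le_trans _ _ (\sum_(v <- [seq (ys, t) | ys <- YS, t <- F])
  sqmod (colifts act Lam Psi (rho v.1) v.2))); last first.
  rewrite big_allpairs_dep /=; apply: ler_sum => ys _.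
  by apply: psum_ub; apply/l2_predP; exact: l2Psi.
have -> : \sum_(k < K) csq (unalt (o k) (E k) m (Psi k)) = \sum_(u <- D) a u.
  by rewrite /D big_allpairs_dep -[X in iota 0 X]subn0 -/(index_iota 0 K) big_mkord.
have DP u : u \in D -> Z u.1 u.2 /\ u.2 \in simplices (Z u.1) m.
  move=> /allpairsPdep[k [A [_ Al ->]]] /=; split=> //.
  by move: Al; rewrite in_simplices// => /asboolP[].
apply: (@sum_reindex_le R _ _ D _ h a).
- by move=> v; exact: sqmod_ge0.
- rewrite allpairs_uniq_dep ?iota_uniq// => [[k A] [k' A'] _ _ /= [-> ->]//].
- move=> u uD _; have [g [hYS h2 hs]] := hP u uD; split.
    rewrite [h u]surjective_pairing; apply: allpairs_f => //.
    by apply/imfsetP; exists u.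
  have [Zu ul] := DP u uD.
  rewrite /a fval_unalt// sqmod_sign hs h2 /colifts /= (colift_lcos act_deck (Lam_sub _))//.
- move=> u u'; rewrite !inE => /andP[uD _] /andP[u'D _] huu'.
  have [g [_ h2 hs]] := hP u uD; have [g' [_ h2' hs']] := hP u' u'D.
  have [Zu _] := DP u uD; have [Zu' _] := DP u' u'D.
  move: u u' {uD u'D} huu' h2 h2' hs hs' Zu Zu' => [k A] [k' A'] /= huu' h2 h2' hs hs' Zu Zu'.
  have kk : k = k' by move: h2; rewrite huu' h2' => -[].
  rewrite -kk in huu' h2' hs' Zu' *; congr pair.
  rewrite -(sorted_faceK (ZE k) Zu) -(sorted_faceK (ZE k) Zu') hs hs' huu'.
  have [j Lj ->] : exists2 j, Lam k j & g' = (g * j)%g.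
    by apply: (lcosP (Lam_sub k)); move: h2; rewrite huu' h2' => -[].
  rewrite invgM (map_actM act_deck)// (map_vorb_act act_deck (Lam_sub k) (g := j^-1%g))//.
    exact: (subgroupV (Lam_sub k)).
  exact: ftuple_act.
Qed.

Hypothesis kazhdan : strongly_kazhdan R G n.

(** For [j.+1 = n], closedness is a condition on tuples spanning (n+1)-dimensional faces of the
    universal cover; the quotients, being n-dimensional, do not see it, so it is stated upstairs. *)
Lemma exact_family j (phi : forall k, cochain R (Z k) j.+1) (B : R) : (j < n)%N ->
  (forall k s, S s -> sdiff (alt (o k) (phi k)) (map (vorb k) s) = 0) ->
  (forall K, \sum_(k < K) csq (phi k) <= B) ->
  exists (h : forall k, cochain R (Z k) j) (B' : R),
    (forall k, coboundary (o k) (h k) = phi k) /\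
    forall K, \sum_(k < K) csq (h k) <= B'.
Proof.
move=> jn dphi hB.
have [|Psi [l2Psi dPsi]] := lift_exact p_universal E_contractible act_deck kazhdan
  Lam_sub jn dphi.
  by move=> s Ks; exact: colifts_bound hB.
have /choice[E EP] := fun k => vertex_list (finZ k).
have uE k := (EP k).1; have ZE k := (EP k).2.
have [B' hB'] := unalt_bound (ltnW jn) uE ZE l2Psi.
exists (fun k => unalt (o k) (E k) j (Psi k)), B'; split=> // k.
apply/ffunP => t; rewrite -!fvalE; have tl := valP t; set A := val t in tl *.
have [ZA cA] : Z k A /\ #|` A| = j.+2 by move: tl; rewrite in_simplices// => /asboolP.
have ZsA : Z k [fset x in sorted_face (E k) A]%fset by rewrite (sorted_faceK (ZE k) ZA).
have [s Ks sE] := quot_lift ZsA.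
have := dPsi k s Ks; rewrite -(size_map (vorb k)) sE (size_sorted_face (uE k) (ZE k) ZA) => /(_ cA).
rewrite (coboundary_unalt (o k) (finZ k) (uE k) (ZE k) _ tl) /alt.
rewrite sorted_face_uniq// (sorted_faceK (ZE k) ZA).
by apply: mulfI; rewrite signr_eq0.
Qed.

End ExactFamily.

(** * The uniform spectral gap *)

Section SpectralGap.
Variables (R : realType) (n : nat) (G : groupType) (V W : choiceType).
Variables (Y : scomplex V) (Yt : scomplex W) (p : smap Yt Y) (act : G -> smap Yt Yt).
Hypothesis p_universal : universal_covering (realization_map R p) R.
Hypothesis E_contractible : contractible_space R (realization R Yt).
Hypothesis act_deck : deck_action R p act.
Hypothesis finY : finite_set (faces (skeleton Y n)).
Hypothesis kazhdan : strongly_kazhdan R G n.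
Local Notation C := R[i].
Local Notation S := (ftuple Yt).
Local Notation Z L := (quotient_complex act L (skeleton Yt n)).

(** [l < n] ensures that the (l+1)-dimensional faces survive in the skeleton, as [alt_sdiff]
    requires. *)
Lemma sdiff_alt_vorb (L : set G) (o : orientation (Z L)) l (f : cochain R (Z L) l) s :
  finite_set (faces (Z L)) -> (l < n)%N -> S s ->
  sdiff (alt o f) (map (vorbit act L) s) =
  alt o (coboundary o f) (map (vorbit act L) s).
Proof.
move=> finZ ln Ks; apply: (alt_sdiff o finZ) => sl _; apply: ftuple_quot => //.
by rewrite -(size_map (vorbit act L)) sl.
Qed.

Section Single.
Variable L : set G.
Hypothesis sL : is_subgroup L.
Hypothesis finL : finite_set (left_cosets L).
Variable o : orientation (Z L).

Let finZ : finite_set (faces (Z L)) :=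
  finite_quotient p_universal E_contractible act_deck finY sL finL.

Lemma alt0 l (s : seq (set W)) : alt o (0 : cochain R (Z L) l) s = 0.
Proof.
rewrite /alt; case: ifP => // _; rewrite /fval; case: insubP => [u _ _|_].
  by rewrite ffunE mulr0.
by rewrite mulr0.
Qed.

(** The difference of two vertices is a cycle of the augmented complex, hence a boundary upstairs;
    evaluating there the lift of the closed function [f] shows that its two values agree. *)
Lemma closed_constant (f : cochain R (Z L) 0) : (0 < n)%N -> coboundary o f = 0 ->
  coboundaries o f.
Proof.
move=> n0 df0.
have vP s : s \in simplices (Z L) 0 -> exists2 w, Yt [fset w]%fset & s = [fset vorbit act L w]%fset.
  rewrite in_simplices// => /asboolP[[t [Kt _] tE] /eqP/cardfs1P[a sa]].
  have /fset0Pn[w wt] := face_neq0 Kt; exists w; first exact: face_vertex Kt wt.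
  have : vorbit act L w \in s by rewrite -tE; apply/imfsetP; exists w.
  by rewrite sa inE => /eqP ->.
have S1 w : Yt [fset w]%fset -> S [:: w].
  by move=> Kw; right; move: Kw; congr (Yt _); apply/fsetP => x; rewrite !inE orbF.
have fE w : Yt [fset w]%fset ->
    alt o f (map (vorbit act L) [:: w]) = fval f [fset vorbit act L w]%fset.
  move=> Kw; rewrite /alt /= /inversions !big_seq1 ltnn expr0 mul1r.
  by congr (fval f _); apply/fsetP => x; rewrite !inE orbF.
suff cf w w' : Yt [fset w]%fset -> Yt [fset w']%fset ->
    fval f [fset vorbit act L w]%fset = fval f [fset vorbit act L w']%fset.
  have [[w0 K0]|nW] := pselect (exists w, Yt [fset w]%fset); last first.
    exists 0; apply/ffunP => s; have [w Kw _] := vP _ (valP s).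
    by case: nW; exists w.
  exists (fval f [fset vorbit act L w0]%fset); apply/ffunP => s.
  rewrite ffunE -fvalE; have [w Kw ->] := vP _ (valP s).
  exact: cf.
move=> Kw Kw'; rewrite -!fE//.
pose Phi s := alt o f (map (vorbit act L) s).
have cz : is_chain S (fun g : seq W -> C => g [:: w] - g [:: w']).
  by apply: chainB; apply: chain_tuple; exact: S1.
have [|b cb bd] := contractible_acyclic E_contractible cz.
  by move=> g /=; rewrite subrr.
apply/eqP; rewrite -subr_eq0; apply/eqP; rewrite -[LHS]/(Phi [:: w] - Phi [:: w']).
rewrite -(bd Phi) -[RHS](chain_zero cb); apply: (chain_ext cb) => s Ks.
by rewrite /Phi sdiff_map sdiff_alt_vorb// df0 alt0.
Qed.

Lemma closed_exact l (f : cochain R (Z L) l) : (l < n)%N -> coboundary o f = 0 ->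
  coboundaries o f.
Proof.
case: l f => [|l] f ln df0; first exact: closed_constant.
(* A family concentrated at index 0 is square summable, so a single cochain is covered by
   [exact_family]. *)
pose phi (k : nat) : cochain R (Z L) l.+1 := (k == 0%N)%:R *: f.
have [k s Ks|K|h [B' [hE _]]] := @exact_family R n G V W Y Yt p act p_universal
  E_contractible act_deck finY (fun=> L) (fun=> sL) (fun=> finL) (fun=> o) kazhdan
  l phi (csq f) (ltnW ln).
- by rewrite sdiff_alt_vorb// coboundaryZ df0 scaler0 alt0.
- case: K => [|K]; first by rewrite big_ord0 csq_ge0.
  rewrite big_ord_recl big1 ?addr0 => [|k _].
    by rewrite csqZ /sqmod /= expr1n expr0n addr0 mul1r.
  by rewrite csqZ /sqmod /= expr0n addr0 mul0r.
by exists (h 0%N); rewrite // hE /phi scale1r.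
Qed.

End Single.

Variables (I : Type) (L : I -> set G).
Hypothesis sL : forall i, is_subgroup (L i).
Hypothesis finL : forall i, finite_set (left_cosets (L i)).
Variable o : forall i, orientation (Z (L i)).

Let finZ i : finite_set (faces (Z (L i))) :=
  finite_quotient p_universal E_contractible act_deck finY (sL i) (finL i).

Lemma eigenvalue_bound l : (l < n)%N -> exists2 e : R, 0 < e &
  forall i (a : R) (f : cochain R (Z (L i)) l), f != 0 -> coboundaries_perp (o i) f ->
    upper_laplacian (o i) f = (a%:C)%C *: f -> e <= a.
Proof.
move=> ln; apply: contrapT => nE.
(* The quotient may change with [k], so the index is chosen together with the cochain. *)
pose U := {i : I & cochain R (Z (L i)) l}.
pose P (u : U) k := [/\ csq (projT2 u) = 1, coboundaries_perp (o (projT1 u)) (projT2 u)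
  & csq (coboundary (o (projT1 u)) (projT2 u)) <= 2^-1 ^+ k].
have hex k : exists u, P u k.
  apply: contrapT => nu; apply: nE; exists (2^-1 ^+ k) => [|i a f f0 fp fa].
    by rewrite exprn_gt0// invr_gt0.
  rewrite leNgt; apply/negP => ak; apply: nu.
  have c0 : 0 < csq f.
    by rewrite lt_def csq_ge0 andbT; apply: contra_neq f0; exact: csq_eq0.
  (* Normalization: for a unit eigenvector the square norm of the coboundary is the eigenvalue, here
     below [2^-1 ^+ k]. *)
  pose c := (Num.sqrt (csq f))^-1.
  have cc : sqmod (c%:C)%C * csq f = 1.
    rewrite /sqmod /= expr0n addr0 exprVn sqr_sqrtr ?csq_ge0// mulVf//.
    by rewrite gt_eqF.
  exists (existT _ i ((c%:C)%C *: f)); split => /=; first by rewrite csqZ.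
    move=> g /fp fg; rewrite /inner; under eq_bigr do rewrite ffunE -mulrA.
    by rewrite -mulr_sumr -/(inner f g) fg mulr0.
  by rewrite coboundaryZ csqZ (csq_coboundary fa) mulrCA cc mulr1 ltW.
have /choice[u uP] := hex.
pose phi k := projT2 (u k).
pose dphi k := coboundary (o (projT1 (u k))) (phi k).
have [k s Ks|K|h [B' [hE hB']]] := @exact_family R n G V W Y Yt p act p_universal
  E_contractible act_deck finY (fun k => L (projT1 (u k))) (fun k => sL _)
  (fun k => finL _) (fun k => o (projT1 (u k))) kazhdan l dphi 2 ln.
(* On tuples, [dphi k] is the [sdiff] of the lift of [phi k], so it is closed also on faces outside
   the skeleton. *)
- rewrite -sdiff_map -[RHS](sdiff_sdiff
    (fun t => alt (o (projT1 (u k))) (phi k) (map (vorbit act (L (projT1 (u k)))) t)) s).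
  apply: eq_sdiff => t ts; rewrite sdiff_map sdiff_alt_vorb//.
  exact: ftuple_face Ks ts.
(* Partial sums of the geometric series, whence the bound 2. *)
- suff : \sum_(k < K) csq (dphi k) <= 2 - 2 * 2^-1 ^+ K.
    by move=> /le_trans; apply; rewrite gerBl mulr_ge0// exprn_ge0// invr_ge0.
  elim: K => [|K IH]; first by rewrite big_ord0 expr0 mulr1 subrr.
  rewrite big_ord_recr /= exprS; have [_ _] := uP K; rewrite -/(phi K) -/(dphi K).
  move: IH; set x := _ ^+ K; lra.
have h1 k : 1 <= csq (h k).
  have [c1 fp _] := uP k.
  have : coboundaries (o (projT1 (u k))) (phi k - h k).
    apply: closed_exact => //.
    by rewrite coboundaryB hE subrr.
  move=> /fp /csq_perpB; rewrite opprB addrC subrK c1 => ->.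
  by rewrite lerDl csq_ge0.
(* Each of the first [K] terms is at least 1, so the bound [B'] would exceed every natural
   number. *)
have KB K : K%:R <= B'.
  apply: le_trans (hB' K); rewrite -[K in leLHS]card_ord -sumr_const.
  exact: ler_sum.
have := KB (Num.bound B'); rewrite leNgt => /negP; apply.
by apply: archi_boundP; have := KB 0%N.
Qed.

Lemma uniform_spectral_gap : exists2 e : R, 0 < e & forall i l, (l < n)%N ->
  (e%:E <= spectral_gap R (o i) l)%E.
Proof.
suff [e e0 eP] : exists2 e : R, 0 < e & forall l, (l < n)%N ->
    forall i (a : R) (f : cochain R (Z (L i)) l), f != 0 ->
    coboundaries_perp (o i) f -> upper_laplacian (o i) f = (a%:C)%C *: f -> e <= a.
  exists e => // i l ln; apply/ereal_infP => _ [a [f [f0 fp fa]] <-].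
  by rewrite lee_fin; exact: eP fp fa.
suff: forall m, (m <= n)%N -> exists2 e : R, 0 < e & forall l, (l < m)%N ->
    forall i (a : R) (f : cochain R (Z (L i)) l), f != 0 ->
    coboundaries_perp (o i) f -> upper_laplacian (o i) f = (a%:C)%C *: f -> e <= a.
  by move=> /(_ n (leqnn n)).
elim=> [|m IH] mn; first by exists 1.
have [e e0 eP] := IH (ltnW mn); have [d d0 dP] := eigenvalue_bound mn.
exists (Num.min e d) => [|l]; first by rewrite lt_min e0.
rewrite ltnS leq_eqVlt => /orP[/eqP ->|lm] i a f f0 fp fa; rewrite ge_min.
  by rewrite (dP i a f)// orbT.
by rewrite (eP l lm i a f).
Qed.

End SpectralGap.

Theorem theorem1p2 (R : realType) (n : nat) (G : groupType)
    (V : choiceType) (Y : scomplex V)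
    (W : choiceType) (Yt : scomplex W) (p : smap Yt Y) (act : G -> smap Yt Yt)
    (I : Type) (L : I -> set G)
    (o : forall i, orientation (quotient_complex act (L i) (skeleton Yt n))) :
  (1 <= n)%N ->
  type_F R n G ->
  eilenberg_maclane1 R G (realization R Y) ->
  finite_set (faces (skeleton Y n)) ->
  universal_covering (realization_map R p) R ->
  deck_action R p act ->
  (forall i, is_subgroup (L i) /\ finite_set (left_cosets (L i))) ->
  strongly_kazhdan R G n ->
  let Z i := quotient_complex act (L i) (skeleton Yt n) in
  [/\ exists D : nat, forall i, finite_set (faces (Z i)) /\
        forall v, Z i [fset v]%fset ->
          ([set s | Z i s /\ v \in s] #<= `I_D)%card,
      exists2 e : R, 0 < e & forall i l, (l < n)%N ->
        (e%:E <= spectral_gap R (o i) l)%E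
    & forall F : set_system I, Filter F ->
        subgroup_index (L i) @[i --> F] --> \oo ->
        #|` simplices (Z i) 0| @[i --> F] --> \oo].
Proof.
move=> _ _ [_ _ _ univ_contractible] finY p_universal act_deck hL kazhdan Z.
have E_contractible := univ_contractible _ _ p_universal.
have sL i := (hL i).1; have finL i := (hL i).2.
have finZ i := finite_quotient p_universal E_contractible act_deck finY (sL i) (finL i).
split.
(* [D] is the number of faces of the [n]-skeleton of [Y], the same for all subgroups. *)
- have [D YD] := finY; exists D => i; split; first exact: finZ.
  move=> v Zv; rewrite -(card_le_eqr YD).
  exact: (quot_degree p_universal act_deck (sL i) Zv).
- exact: (uniform_spectral_gap p_universal).
(* The universal cover, being path connected, has a point, and a face carrying it provides a
   vertex. *)
- have [[[x _] _] _] := p_universal.2.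
  have [A KA _] := realization_carrier x.
  have /fset0Pn[w wA] := face_neq0 KA.
  have hw : exists w, Yt [fset w]%fset by exists w; exact: face_vertex KA wA.
  move=> F FF /cvgnyPge idx; apply/cvgnyPge => A0.
  apply: filterS (idx A0) => i; move=> /leq_trans; apply.
  exact: (index_le_vertices p_universal E_contractible act_deck finY (sL i) (finL i) hw).
Qed.
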